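(* Let $\xi\in\mathfrak{h}^*/\mathbb{Z}R$ be of nonzero central charge and assume that $\lambda(h)\in\mathbb{Z}+\frac12$ for any $\lambda\in\xi$. For $i\in\mathbb{Z}_+=\{0,1,2,\dots\}$ let $\lambda_i\in\xi$ be the element with $\lambda_i(h)=-\frac32+i$, and let $\mathcal{O}[\xi]_{\lambda_i}$ be the Serre subcategory of $\mathcal{O}[\xi]$ generated by $\Delta(\lambda_i)$ and $\Delta(r\cdot\lambda_i)$. Then: (i) For $\lambda\in\xi$ the module $\Delta(\lambda)$ is simple if and only if $\lambda(h)\le-\frac32$. (ii) For each $i\ge1$ there is a non-split short exact sequence $0\to\Delta(r\cdot\lambda_i)\to\Delta(\lambda_i)\to L(\lambda_i)\to0$. (iii) There is a decomposition $\mathcal{O}[\xi]\cong\bigoplus_{i\in\mathbb{Z}_+}\mathcal{O}[\xi]_{\lambda_i}$. (iv) The category $\mathcal{O}[\xi]_{\lambda_0}$ is equivalent to the category of finite dimensional complex vector spaces; more precisely, the functor given on objects by $N\mapsto N_{\lambda_0}$ (and on morphisms by restriction) is such an equivalence. (v) For each $i\geq 1$ the category $\mathcal{O}[\xi]_{\lambda_i}$ is equivalent to the category of finite dimensional complex representations of the quiver with two vertices $1,2$, one arrow $a:1\to2$ and one arrow $b:2\to1$, subject to the relation $ab=0$.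
   Context: The Schrödinger algebra $\mathfrak{s}$ is the complex Lie algebra with basis $e,h,f,p,q,z$, with $z$ central and the remaining brackets $[h,e]=2e$, $[e,f]=h$, $[h,f]=-2f$, $[e,q]=p$, $[e,p]=0$, $[h,p]=p$, $[f,p]=q$, $[f,q]=0$, $[h,q]=-q$, $[p,q]=z$. Put $U=U(\mathfrak{s})$, $\mathfrak{h}=\mathbb{C}h\oplus\mathbb{C}z$, $\mathfrak{n}_+=\mathbb{C}e\oplus\mathbb{C}p$, $\mathfrak{n}_-=\mathbb{C}f\oplus\mathbb{C}q$, $\mathfrak{b}=\mathfrak{h}\oplus\mathfrak{n}_+$. Let $\{h^\vee,z^\vee\}\subset\mathfrak{h}^*$ be the basis dual to $\{h,z\}$, and $R=\{\pm h^\vee,\pm 2h^\vee\}$, so $\mathbb{Z}R=\mathbb{Z}h^\vee$. Let $\rho=\frac32h^\vee$, let $r$ be the linear map on $\mathfrak{h}^*$ with $r(z^\vee)=z^\vee$, $r(h^\vee)=-h^\vee$, and put $r\cdot\lambda=r(\lambda+\rho)-\rho$; thus $(r\cdot\lambda)(z)=\lambda(z)$ and $(r\cdot\lambda)(h)=-\lambda(h)-3$. For a $U$-module $M$ and $\lambda\in\mathfrak{h}^*$ let $M_\lambda=\{v\in M: Hv=\lambda(H)v\ \forall H\in\mathfrak{h}\}$; $M$ is a weight module if $M=\bigoplus_\lambda M_\lambda$; its support is the set of $\lambda$ with $M_\lambda\ne0$. Category $\mathcal{O}$ is the full subcategory of the category of $U$-modules consisting of the finitely generated weight modules $M$ with $\dim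 U(\mathfrak{n}_+)v<\infty$ for all $v\in M$. The Verma module is $\Delta(\lambda)=U\otimes_{U(\mathfrak{b})}\mathbb{C}_\lambda$, where $\mathfrak{n}_+$ acts on the one-dimensional module $\mathbb{C}_\lambda$ by $0$ and $\mathfrak{h}$ acts via $\lambda$; $L(\lambda)$ is its unique simple quotient. For a coset $\xi\in\mathfrak{h}^*/\mathbb{Z}R$, $\mathcal{O}[\xi]$ is the full subcategory of $\mathcal{O}$ of modules with support contained in $\xi$. The value $\lambda(z)$, which does not depend on $\lambda\in\xi$, is called the central charge of $\xi$. *)

(* Defs.v *)
(* MathComp, with the classical logic of mathcomp.classical. *)
From HB Require Import structures.
From mathcomp Require Import all_boot all_order all_algebra.
From mathcomp Require Import ring.
From mathcomp Require Import boolp classical_sets reals.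
From mathcomp Require Export complex.

Set Implicit Arguments.
Unset Strict Implicit.
Unset Printing Implicit Defensive.

Import Order.TTheory GRing.Theory Num.Theory.
Local Open Scope quotient_scope.
Local Open Scope ring_scope.

Section Submodules.
Variables (A : pzRingType) (M : lmodType A).

Record submod := Submod {
  sm_set :> M -> Prop;
  sm_closed : sm_set 0 /\
              forall (a : A) (u v : M), sm_set u -> sm_set v -> sm_set (a *: u + v) }.

HB.instance Definition _ := gen_eqMixin submod.
HB.instance Definition _ := gen_choiceMixin submod.

Lemma submod0_closed : (0 : M) = 0 /\
  forall (a : A) (u v : M), u = 0 -> v = 0 -> a *: u + v = 0.
Proof. by split=> // a u v -> ->; rewrite scaler0 addr0. Qed.

Definition submod0 : submod := @Submod (fun v => v = 0) submod0_closed.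

Variable S : submod.

Definition sm_pred : {pred M} := fun v => `[< S v >].

Lemma sm_predP v : reflect (S v) (v \in sm_pred).
Proof. exact: asboolP. Qed.

Lemma sm_subsemimod_closed : subsemimod_closed sm_pred.
Proof.
have [S0 SD] := sm_closed S.
split; first split.
- exact/sm_predP.
- by move=> u v /sm_predP Su /sm_predP Sv; apply/sm_predP; rewrite -[u]scale1r; apply: SD.
- by move=> a v /sm_predP Sv; apply/sm_predP; rewrite -[_ *: _]addr0; apply: SD.
Qed.

Record subm := Subm { sm_val :> M; sm_valP : sm_val \in sm_pred }.

HB.instance Definition _ := [isSub for sm_val].
HB.instance Definition _ := [Choice of subm by <:].
HB.instance Definition _ :=
  GRing.SubChoice_isSubLmodule.Build A M sm_pred subm sm_subsemimod_closed.

Lemma sm_val_linear : linear sm_val.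
Proof. exact: (linearP (val : subm -> M)). Qed.

HB.instance Definition _ := GRing.isLinear.Build A subm M _ sm_val sm_val_linear.

Definition quom_rel (u v : M) : bool := `[< S (u - v) >].

Lemma quom_rel_equiv : equiv_class_of quom_rel.
Proof.
have [S0 SD] := sm_closed S.
split=> [u|u v|v u w].
- by apply/asboolP; rewrite subrr.
- apply/asboolP/asboolP => h;
    rewrite -opprB -scaleN1r -[_ *: _]addr0; exact: SD.
- move=> /asboolP h1 /asboolP h2; apply/asboolP.
  have -> : u - w = 1 *: (u - v) + (v - w) by rewrite scale1r addrA subrK.
  exact: SD.
Qed.

Canonical quom_equiv := EquivRelPack quom_rel_equiv.

Definition quom := {eq_quot quom_equiv}.

HB.instance Definition _ := Choice.on quom.
HB.instance Definition _ := EqQuotient.on quom.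

Definition quom_pi (v : M) : quom := \pi_quom v.

Lemma quom_piP u v : quom_pi u = quom_pi v <-> S (u - v).
Proof. by split=> [/eqmodP/asboolP//|h]; apply/eqmodP/asboolP. Qed.

Definition quom_add (x y : quom) : quom := quom_pi (repr x + repr y).
Definition quom_opp (x : quom) : quom := quom_pi (- repr x).
Definition quom_scale (a : A) (x : quom) : quom := quom_pi (a *: repr x).

Lemma quom_reprK x : quom_pi (repr x) = x.
Proof. exact: reprK. Qed.

Lemma quom_addE u v : quom_add (quom_pi u) (quom_pi v) = quom_pi (u + v).
Proof.
apply/quom_piP; have [S0 SD] := sm_closed S.
rewrite opprD addrACA -[_ - u]scale1r; apply: SD; by apply/quom_piP/quom_reprK.
Qed.

Lemma quom_scaleE a u : quom_scale a (quom_pi u) = quom_pi (a *: u).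
Proof.
apply/quom_piP; have [S0 SD] := sm_closed S.
rewrite -scalerBr -[_ *: _]addr0; apply: SD => //; exact/quom_piP/quom_reprK.
Qed.

Lemma quom_oppE u : quom_opp (quom_pi u) = quom_pi (- u).
Proof.
have h v : quom_pi (- v) = quom_scale (-1) (quom_pi v).
  by rewrite quom_scaleE scaleN1r.
by rewrite /quom_opp h quom_reprK h.
Qed.

Lemma quom_ind (T : quom -> Prop) : (forall u, T (quom_pi u)) -> forall x, T x.
Proof. by move=> h x; rewrite -[x]quom_reprK. Qed.

Lemma quom_addA : associative quom_add.
Proof.
elim/quom_ind=> u; elim/quom_ind=> v; elim/quom_ind=> w.
by rewrite !quom_addE addrA.
Qed.
Lemma quom_addC : commutative quom_add.
Proof. by elim/quom_ind=> u; elim/quom_ind=> v; rewrite !quom_addE addrC. Qed.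
Lemma quom_add0 : left_id (quom_pi 0) quom_add.
Proof. by elim/quom_ind=> u; rewrite quom_addE add0r. Qed.
Lemma quom_addN : left_inverse (quom_pi 0) quom_opp quom_add.
Proof. by elim/quom_ind=> u; rewrite quom_oppE quom_addE addNr. Qed.

HB.instance Definition _ :=
  GRing.isZmodule.Build quom quom_addA quom_addC quom_add0 quom_addN.

Lemma quom_scaleA a b v : quom_scale a (quom_scale b v) = quom_scale (a * b) v.
Proof. by elim/quom_ind: v => u; rewrite !quom_scaleE scalerA. Qed.
Lemma quom_scale1 : left_id 1 quom_scale.
Proof. by elim/quom_ind=> u; rewrite quom_scaleE scale1r. Qed.
Lemma quom_scaleDr : right_distributive quom_scale +%R.
Proof.
move=> a; elim/quom_ind=> u; elim/quom_ind=> v.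
by rewrite [quom_pi u + _]quom_addE !quom_scaleE [RHS]quom_addE scalerDr.
Qed.
Lemma quom_scaleDl v : {morph quom_scale^~ v : a b / a + b}.
Proof.
by move=> a b; elim/quom_ind: v => u; rewrite !quom_scaleE [RHS]quom_addE scalerDl.
Qed.

HB.instance Definition _ := GRing.Zmodule_isLmodule.Build A quom
  quom_scaleA quom_scale1 quom_scaleDr quom_scaleDl.

Lemma quom_pi_linear : linear quom_pi.
Proof.
by move=> a u v; rewrite [a *: quom_pi u]quom_scaleE [RHS]quom_addE.
Qed.

HB.instance Definition _ := GRing.isLinear.Build A M quom _ quom_pi quom_pi_linear.

End Submodules.

Section Simple.
Variable A : pzRingType.

Definition simple (M : lmodType A) : Prop :=
  (exists v : M, v <> 0) /\
  forall S : submod M, (forall v, S v -> v = 0) \/ (forall v, S v).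

(* The simple quotient of a module that has exactly one (junk otherwise). *)
Definition simple_quotient (M : lmodType A) : lmodType A :=
  quom (xget (submod0 M) [set S : submod M | simple (quom S)]%classic).

Definition short_exact (M1 M2 M3 : lmodType A)
    (f : {linear M1 -> M2}) (g : {linear M2 -> M3}) : Prop :=
  [/\ injective f,
      forall y, g y = 0 <-> exists x, f x = y &
      forall y, exists x, g x = y].

Definition split_epi (M2 M3 : lmodType A) (g : {linear M2 -> M3}) : Prop :=
  exists s : {linear M3 -> M2}, forall y, g (s y) = y.

Definition fin_generated (M : lmodType A) : Prop :=
  exists (n : nat) (g : 'I_n -> M), forall v, exists c : 'I_n -> A,
    v = \sum_(i < n) c i *: g i.

End Simple.

Definition fin_dim (K : fieldType) (V : lmodType K) (W : set V) : Prop :=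
  exists (n : nat) (g : 'I_n -> V), forall v, W v -> exists c : 'I_n -> K,
    v = \sum_(i < n) c i *: g i.

(* A B-module M viewed as an A-module through phi. *)
Definition restr (A B : pzRingType) (phi : {rmorphism A -> B}) (M : lmodType B)
  : Type := M.

Section Restr.
Variables (A B : pzRingType) (phi : {rmorphism A -> B}) (M : lmodType B).
HB.instance Definition _ := GRing.Zmodule.on (restr phi M).

Definition restr_scale (a : A) (v : restr phi M) : restr phi M :=
  phi a *: (v : M).

Lemma restr_scaleA a b v :
  restr_scale a (restr_scale b v) = restr_scale (a * b) v.
Proof. by rewrite /restr_scale scalerA rmorphM. Qed.
Lemma restr_scale1 : left_id 1 restr_scale.
Proof. by move=> v; rewrite /restr_scale rmorph1 scale1r. Qed.
Lemma restr_scaleDr : right_distributive restr_scale +%R.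
Proof. by move=> a u v; rewrite /restr_scale scalerDr. Qed.
Lemma restr_scaleDl v : {morph restr_scale^~ v : a b / a + b}.
Proof. by move=> a b; rewrite /restr_scale rmorphD scalerDl. Qed.

HB.instance Definition _ := GRing.Zmodule_isLmodule.Build A (restr phi M)
  restr_scaleA restr_scale1 restr_scaleDr restr_scaleDl.
End Restr.

Section Tensor.
Variables (A B : pzRingType) (phi : {rmorphism B -> A}) (M : lmodType B).

Inductive tens_term : Type :=
  | TPure of A & M
  | TZero
  | TAdd of tens_term & tens_term
  | TOpp of tens_term.

Inductive tens_eq : tens_term -> tens_term -> Prop :=
  | TErefl t : tens_eq t t
  | TEsym t u : tens_eq t u -> tens_eq u t
  | TEtrans t u v : tens_eq t u -> tens_eq u v -> tens_eq t v
  | TEadd t t' u u' :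
      tens_eq t t' -> tens_eq u u' -> tens_eq (TAdd t u) (TAdd t' u')
  | TEopp t t' : tens_eq t t' -> tens_eq (TOpp t) (TOpp t')
  | TEaddA t u v : tens_eq (TAdd t (TAdd u v)) (TAdd (TAdd t u) v)
  | TEaddC t u : tens_eq (TAdd t u) (TAdd u t)
  | TEadd0 t : tens_eq (TAdd TZero t) t
  | TEaddN t : tens_eq (TAdd (TOpp t) t) TZero
  | TEpureDl a a' m : tens_eq (TPure (a + a') m) (TAdd (TPure a m) (TPure a' m))
  | TEpureDr a m m' : tens_eq (TPure a (m + m')) (TAdd (TPure a m) (TPure a m'))
  | TEbalanced a b m : tens_eq (TPure (a * phi b) m) (TPure a (b *: m)).

Fixpoint tens_term_scale (a : A) (t : tens_term) : tens_term :=
  match t with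
  | TPure a' m => TPure (a * a') m
  | TZero => TZero
  | TAdd t u => TAdd (tens_term_scale a t) (tens_term_scale a u)
  | TOpp t => TOpp (tens_term_scale a t)
  end.

Lemma tens_term_scale_eq a t u :
  tens_eq t u -> tens_eq (tens_term_scale a t) (tens_term_scale a u).
Proof.
elim=> /=; try by constructor.
- by move=> t0 u0 v0 _ h1 _ h2; apply: TEtrans h1 h2.
- by move=> b b' m; rewrite mulrDr; constructor.
- by move=> b b' m; rewrite mulrA; constructor.
Qed.

HB.instance Definition _ := gen_eqMixin tens_term.
HB.instance Definition _ := gen_choiceMixin tens_term.

Definition tens_rel (t u : tens_term) : bool := `[< tens_eq t u >].

Lemma tens_rel_equiv : equiv_class_of tens_rel.
Proof.
split=> [t|t u|u t v].
- exact/asboolP/TErefl.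
- by apply/asboolP/asboolP => h; apply: TEsym.
- by move=> /asboolP h1 /asboolP h2; apply/asboolP; apply: TEtrans h1 h2.
Qed.

Canonical tens_equiv := EquivRelPack tens_rel_equiv.

Definition tens := {eq_quot tens_equiv}.
HB.instance Definition _ := Choice.on tens.
HB.instance Definition _ := EqQuotient.on tens.

Definition tens_pi (t : tens_term) : tens := \pi_tens t.

Lemma tens_piP t u : tens_pi t = tens_pi u <-> tens_eq t u.
Proof. by split=> [/eqmodP/asboolP//|h]; apply/eqmodP/asboolP. Qed.

Lemma tens_reprK x : tens_pi (repr x) = x.
Proof. exact: reprK. Qed.

Lemma tens_ind (T : tens -> Prop) : (forall u, T (tens_pi u)) -> forall x, T x.
Proof. by move=> h x; rewrite -[x]tens_reprK. Qed.

Definition tens_add (x y : tens) : tens := tens_pi (TAdd (repr x) (repr y)).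
Definition tens_opp (x : tens) : tens := tens_pi (TOpp (repr x)).
Definition tens_scale (a : A) (x : tens) : tens :=
  tens_pi (tens_term_scale a (repr x)).

Lemma tens_addE t u : tens_add (tens_pi t) (tens_pi u) = tens_pi (TAdd t u).
Proof. by apply/tens_piP/TEadd; apply/tens_piP; rewrite tens_reprK. Qed.
Lemma tens_oppE t : tens_opp (tens_pi t) = tens_pi (TOpp t).
Proof. by apply/tens_piP/TEopp; apply/tens_piP; rewrite tens_reprK. Qed.
Lemma tens_scaleE a t :
  tens_scale a (tens_pi t) = tens_pi (tens_term_scale a t).
Proof.
by apply/tens_piP/tens_term_scale_eq; apply/tens_piP; rewrite tens_reprK.
Qed.

Lemma tens_addA : associative tens_add.
Proof.
elim/tens_ind=> u; elim/tens_ind=> v; elim/tens_ind=> w.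
by rewrite !tens_addE; apply/tens_piP; constructor.
Qed.
Lemma tens_addC : commutative tens_add.
Proof.
by elim/tens_ind=> u; elim/tens_ind=> v; rewrite !tens_addE; apply/tens_piP; constructor.
Qed.
Lemma tens_add0 : left_id (tens_pi TZero) tens_add.
Proof. by elim/tens_ind=> u; rewrite tens_addE; apply/tens_piP; constructor. Qed.
Lemma tens_addN : left_inverse (tens_pi TZero) tens_opp tens_add.
Proof.
by elim/tens_ind=> u; rewrite tens_oppE tens_addE; apply/tens_piP; constructor.
Qed.

HB.instance Definition _ :=
  GRing.isZmodule.Build tens tens_addA tens_addC tens_add0 tens_addN.

Lemma tens_scaleA a b v : tens_scale a (tens_scale b v) = tens_scale (a * b) v.
Proof.
elim/tens_ind: v => t; rewrite !tens_scaleE; congr tens_pi.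
by elim: t => //= [c m|t -> u -> //|t -> //]; rewrite mulrA.
Qed.
Lemma tens_scale1 : left_id 1 tens_scale.
Proof.
elim/tens_ind=> t; rewrite !tens_scaleE; congr tens_pi.
by elim: t => //= [c m|t -> u -> //|t -> //]; rewrite mul1r.
Qed.
Lemma tens_scaleDr : right_distributive tens_scale +%R.
Proof.
move=> a; elim/tens_ind=> u; elim/tens_ind=> v.
by rewrite [tens_pi u + _]tens_addE !tens_scaleE [RHS]tens_addE.
Qed.
Lemma tens_scaleDl v : {morph tens_scale^~ v : a b / a + b}.
Proof.
have pD t u : tens_pi (TAdd t u) = tens_pi t + tens_pi u by rewrite -tens_addE.
have pN t : tens_pi (TOpp t) = - tens_pi t by rewrite -tens_oppE.
move=> a b; elim/tens_ind: v => t; rewrite !tens_scaleE.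
elim: t => /= [c m||t IHt u IHu|t IHt].
- by rewrite mulrDl -pD; apply/tens_piP; constructor.
- by rewrite -[tens_pi TZero]/(0 : tens) addr0.
- by rewrite !pD IHt IHu addrACA.
- by rewrite !pN IHt opprD.
Qed.

HB.instance Definition _ := GRing.Zmodule_isLmodule.Build A tens
  tens_scaleA tens_scale1 tens_scaleDr tens_scaleDl.

Definition pure_tensor (a : A) (m : M) : tens := tens_pi (TPure a m).

End Tensor.

Record lieAlg (K : fieldType) := LieAlg {
  lie_car :> lmodType K;
  lie : lie_car -> lie_car -> lie_car;
  lie_linl : forall y, linear (fun x => lie x y);
  lie_linr : forall x, linear (lie x);
  lie_alt : forall x, lie x x = 0;
  lie_jacobi : forall x y z,
    lie x (lie y z) + lie y (lie z x) + lie z (lie x y) = 0 }.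

(* Lie algebra maps from L to an associative algebra. *)
Record lieRep (K : fieldType) (L : lieAlg K) (A : algType K) := LieRep {
  lr_fun :> {linear L -> A};
  lr_lie : forall x y, lr_fun (lie x y) = lr_fun x * lr_fun y - lr_fun y * lr_fun x }.

Section Enveloping.
Variables (K : fieldType) (L : lieAlg K).

Inductive env_term : Type :=
  | EGen of L
  | EZero
  | EOne
  | EAdd of env_term & env_term
  | EOpp of env_term
  | EMul of env_term & env_term
  | EScale of K & env_term.

(* The congruence making [env_term] the free unital associative K-algebra on
   the vector space L, modulo xy - yx = [x, y]. *)
Inductive env_eq : env_term -> env_term -> Prop :=
  | EErefl t : env_eq t t
  | EEsym t u : env_eq t u -> env_eq u t
  | EEtrans t u v : env_eq t u -> env_eq u v -> env_eq t v
  | EEadd t t' u u' : env_eq t t' -> env_eq u u' -> env_eq (EAdd t u) (EAdd t' u')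
  | EEopp t t' : env_eq t t' -> env_eq (EOpp t) (EOpp t')
  | EEmul t t' u u' : env_eq t t' -> env_eq u u' -> env_eq (EMul t u) (EMul t' u')
  | EEscale a t t' : env_eq t t' -> env_eq (EScale a t) (EScale a t')
  | EEaddA t u v : env_eq (EAdd t (EAdd u v)) (EAdd (EAdd t u) v)
  | EEaddC t u : env_eq (EAdd t u) (EAdd u t)
  | EEadd0 t : env_eq (EAdd EZero t) t
  | EEaddN t : env_eq (EAdd (EOpp t) t) EZero
  | EEmulA t u v : env_eq (EMul t (EMul u v)) (EMul (EMul t u) v)
  | EEmul1l t : env_eq (EMul EOne t) t
  | EEmul1r t : env_eq (EMul t EOne) t
  | EEmulDl t u v : env_eq (EMul (EAdd t u) v) (EAdd (EMul t v) (EMul u v))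
  | EEmulDr t u v : env_eq (EMul t (EAdd u v)) (EAdd (EMul t u) (EMul t v))
  | EEscaleA a b t : env_eq (EScale a (EScale b t)) (EScale (a * b) t)
  | EEscale1 t : env_eq (EScale 1 t) t
  | EEscaleDr a t u : env_eq (EScale a (EAdd t u)) (EAdd (EScale a t) (EScale a u))
  | EEscaleDl a b t : env_eq (EScale (a + b) t) (EAdd (EScale a t) (EScale b t))
  | EEscaleAl a t u : env_eq (EScale a (EMul t u)) (EMul (EScale a t) u)
  | EEscaleAr a t u : env_eq (EScale a (EMul t u)) (EMul t (EScale a u))
  | EEgenD x y : env_eq (EGen (x + y)) (EAdd (EGen x) (EGen y))
  | EEgenZ a x : env_eq (EGen (a *: x)) (EScale a (EGen x))
  | EEgen_lie x y :
      env_eq (EGen (lie x y))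
             (EAdd (EMul (EGen x) (EGen y)) (EOpp (EMul (EGen y) (EGen x)))).

Fixpoint env_eval (A : algType K) (phi : L -> A) (t : env_term) : A :=
  match t with
  | EGen x => phi x
  | EZero => 0
  | EOne => 1
  | EAdd t u => env_eval phi t + env_eval phi u
  | EOpp t => - env_eval phi t
  | EMul t u => env_eval phi t * env_eval phi u
  | EScale a t => a *: env_eval phi t
  end.

Lemma env_eval_eq (A : algType K) (phi : lieRep L A) t u :
  env_eq t u -> env_eval phi t = env_eval phi u.
Proof.
elim=> //= [*|*|*|*|*|*|*|*|*|*|*|*|*|*|*|*|*|*|*|*|*|*|*].
all: try by congruence.
- by rewrite addrA.
- by rewrite addrC.
- by rewrite add0r.
- by rewrite addNr.
- by rewrite mulrA.
- by rewrite mul1r.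
- by rewrite mulr1.
- by rewrite mulrDl.
- by rewrite mulrDr.
- by rewrite scalerA.
- by rewrite scale1r.
- by rewrite scalerDr.
- by rewrite scalerDl.
- by rewrite scalerAl.
- by rewrite scalerAr.
- by rewrite linearD.
- by rewrite linearZ.
- by rewrite lr_lie.
Qed.

HB.instance Definition _ := gen_eqMixin env_term.
HB.instance Definition _ := gen_choiceMixin env_term.

Definition env_rel (t u : env_term) : bool := `[< env_eq t u >].

Lemma env_rel_equiv : equiv_class_of env_rel.
Proof.
split=> [t|t u|u t v].
- exact/asboolP/EErefl.
- by apply/asboolP/asboolP => h; apply: EEsym.
- by move=> /asboolP h1 /asboolP h2; apply/asboolP; apply: EEtrans h1 h2.
Qed.

Canonical env_equiv := EquivRelPack env_rel_equiv.

(* The universal enveloping algebra of L. *)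
Definition env := {eq_quot env_equiv}.
HB.instance Definition _ := Choice.on env.
HB.instance Definition _ := EqQuotient.on env.

Definition env_pi (t : env_term) : env := \pi_env t.

Lemma env_piP t u : env_pi t = env_pi u <-> env_eq t u.
Proof. by split=> [/eqmodP/asboolP//|h]; apply/eqmodP/asboolP. Qed.

Lemma env_reprK x : env_pi (repr x) = x.
Proof. exact: reprK. Qed.

Lemma env_ind (T : env -> Prop) : (forall u, T (env_pi u)) -> forall x, T x.
Proof. by move=> h x; rewrite -[x]env_reprK. Qed.

Definition env_add (x y : env) : env := env_pi (EAdd (repr x) (repr y)).
Definition env_opp (x : env) : env := env_pi (EOpp (repr x)).
Definition env_mul (x y : env) : env := env_pi (EMul (repr x) (repr y)).
Definition env_scale (a : K) (x : env) : env := env_pi (EScale a (repr x)).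

Lemma env_addE t u : env_add (env_pi t) (env_pi u) = env_pi (EAdd t u).
Proof. by apply/env_piP/EEadd; apply/env_piP; rewrite env_reprK. Qed.
Lemma env_oppE t : env_opp (env_pi t) = env_pi (EOpp t).
Proof. by apply/env_piP/EEopp; apply/env_piP; rewrite env_reprK. Qed.
Lemma env_mulE t u : env_mul (env_pi t) (env_pi u) = env_pi (EMul t u).
Proof. by apply/env_piP/EEmul; apply/env_piP; rewrite env_reprK. Qed.
Lemma env_scaleE a t : env_scale a (env_pi t) = env_pi (EScale a t).
Proof. by apply/env_piP/EEscale; apply/env_piP; rewrite env_reprK. Qed.

Local Ltac env_tac :=
  rewrite ?(env_addE, env_oppE, env_mulE, env_scaleE); apply/env_piP; by constructor.

Lemma env_addA : associative env_add.
Proof. by elim/env_ind=> u; elim/env_ind=> v; elim/env_ind=> w; env_tac. Qed.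
Lemma env_addC : commutative env_add.
Proof. by elim/env_ind=> u; elim/env_ind=> v; env_tac. Qed.
Lemma env_add0 : left_id (env_pi EZero) env_add.
Proof. by elim/env_ind=> u; env_tac. Qed.
Lemma env_addN : left_inverse (env_pi EZero) env_opp env_add.
Proof. by elim/env_ind=> u; env_tac. Qed.

HB.instance Definition _ :=
  GRing.isZmodule.Build env env_addA env_addC env_add0 env_addN.

Lemma env_mulA : associative env_mul.
Proof. by elim/env_ind=> u; elim/env_ind=> v; elim/env_ind=> w; env_tac. Qed.
Lemma env_mul1l : left_id (env_pi EOne) env_mul.
Proof. by elim/env_ind=> u; env_tac. Qed.
Lemma env_mul1r : right_id (env_pi EOne) env_mul.
Proof. by elim/env_ind=> u; env_tac. Qed.
Lemma env_mulDl : left_distributive env_mul env_add.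
Proof. by elim/env_ind=> u; elim/env_ind=> v; elim/env_ind=> w; env_tac. Qed.
Lemma env_mulDr : right_distributive env_mul env_add.
Proof. by elim/env_ind=> u; elim/env_ind=> v; elim/env_ind=> w; env_tac. Qed.

Lemma zero_lieRep_lie (x y : L) :
  (\0%R : {linear L -> K^o}) (lie x y)
  = (\0%R : {linear L -> K^o}) x * (\0%R : {linear L -> K^o}) y
    - (\0%R : {linear L -> K^o}) y * (\0%R : {linear L -> K^o}) x.
Proof. by rewrite /= mul0r subrr. Qed.

Lemma env_one_neq0 : env_pi EOne != 0.
Proof.
apply/eqP => /env_piP /(env_eval_eq (LieRep zero_lieRep_lie)) /= /eqP.
by rewrite oner_eq0.
Qed.

HB.instance Definition _ := GRing.Zmodule_isNzRing.Build env
  env_mulA env_mul1l env_mul1r env_mulDl env_mulDr env_one_neq0.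

Lemma env_scaleA a b v : env_scale a (env_scale b v) = env_scale (a * b) v.
Proof. by elim/env_ind: v => u; env_tac. Qed.
Lemma env_scale1 : left_id 1 env_scale.
Proof. by elim/env_ind=> u; env_tac. Qed.
Lemma env_scaleDr : right_distributive env_scale env_add.
Proof. by move=> a; elim/env_ind=> u; elim/env_ind=> v; env_tac. Qed.
Lemma env_scaleDl v : {morph env_scale^~ v : a b / a + b >-> env_add a b}.
Proof. by move=> a b; elim/env_ind: v => u; env_tac. Qed.

HB.instance Definition _ := GRing.Zmodule_isLmodule.Build K env
  env_scaleA env_scale1 env_scaleDr env_scaleDl.

Lemma env_scaleAl a (u v : env) : env_scale a (env_mul u v) = env_mul (env_scale a u) v.
Proof. by elim/env_ind: u => u; elim/env_ind: v => v; env_tac. Qed.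

HB.instance Definition _ := GRing.Lmodule_isLalgebra.Build K env env_scaleAl.

Lemma env_scaleAr a (u v : env) : env_scale a (env_mul u v) = env_mul u (env_scale a v).
Proof. by elim/env_ind: u => u; elim/env_ind: v => v; env_tac. Qed.

HB.instance Definition _ := GRing.Lalgebra_isAlgebra.Build K env env_scaleAr.

Definition env_gen (x : L) : env := env_pi (EGen x).

Lemma env_gen_linear : linear env_gen.
Proof.
move=> a x y; have -> : a *: env_gen x = env_pi (EScale a (EGen x)) := env_scaleE _ _.
rewrite [RHS]env_addE; apply/env_piP; apply: (EEtrans (EEgenD _ _)).
by apply: EEadd; constructor.
Qed.

HB.instance Definition _ := GRing.isLinear.Build K L env _ env_gen env_gen_linear.

Lemma env_gen_lie x y :
  env_gen (lie x y) = env_gen x * env_gen y - env_gen y * env_gen x.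
Proof.
have gM u v : env_gen u * env_gen v = env_pi (EMul (EGen u) (EGen v)) := env_mulE _ _.
by rewrite !gM [- _]env_oppE [RHS]env_addE; apply/env_piP; constructor.
Qed.

Definition env_gen_rep : lieRep L env := LieRep env_gen_lie.

Section Lift.
Variables (A : algType K) (phi : lieRep L A).

Definition env_lift (x : env) : A := env_eval phi (repr x).

Lemma env_liftE t : env_lift (env_pi t) = env_eval phi t.
Proof. by apply: env_eval_eq; apply/env_piP; rewrite env_reprK. Qed.

Lemma env_lift_gen x : env_lift (env_gen x) = phi x.
Proof. exact: env_liftE. Qed.

Lemma env_lift_linear : linear env_lift.
Proof.
move=> a; elim/env_ind=> t; elim/env_ind=> u.
by rewrite [a *: env_pi t]env_scaleE [_ + env_pi u]env_addE !env_liftE.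
Qed.

HB.instance Definition _ := GRing.isLinear.Build K env A _ env_lift env_lift_linear.

Lemma env_lift_monoid : monoid_morphism env_lift.
Proof.
split; first exact: env_liftE.
elim/env_ind=> t; elim/env_ind=> u.
by rewrite [_ * env_pi u]env_mulE !env_liftE.
Qed.

HB.instance Definition _ := GRing.isMonoidMorphism.Build env A env_lift env_lift_monoid.

End Lift.

End Enveloping.

Section SubLie.
Variables (K : fieldType) (L : lieAlg K) (S : submod L).
Hypothesis S_lie : forall x y, S x -> S y -> S (lie x y).

Lemma sub_lie_proof (x y : subm S) : lie (x : L) (y : L) \in sm_pred S.
Proof. by apply/sm_predP/S_lie; apply/sm_predP/sm_valP. Qed.

Definition sub_bracket (x y : subm S) : subm S := Subm (sub_lie_proof x y).

Lemma sub_lie_linl y : linear (fun x => sub_bracket x y).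
Proof. by move=> a u v; apply: val_inj; exact: lie_linl. Qed.
Lemma sub_lie_linr x : linear (sub_bracket x).
Proof. by move=> a u v; apply: val_inj; exact: lie_linr. Qed.
Lemma sub_lie_alt x : sub_bracket x x = 0.
Proof. by apply: val_inj; exact: lie_alt. Qed.
Lemma sub_lie_jacobi x y z :
  sub_bracket x (sub_bracket y z) + sub_bracket y (sub_bracket z x)
  + sub_bracket z (sub_bracket x y) = 0.
Proof. by apply: val_inj; exact: lie_jacobi. Qed.

Definition sub_lie : lieAlg K :=
  LieAlg sub_lie_linl sub_lie_linr sub_lie_alt sub_lie_jacobi.

Definition sub_incl (x : sub_lie) : env L := env_gen (sm_val x).

Lemma sub_incl_linear : linear sub_incl.
Proof. by move=> a x y; rewrite /sub_incl !linearP. Qed.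

HB.instance Definition _ := GRing.isLinear.Build K sub_lie (env L) _ sub_incl sub_incl_linear.

Lemma sub_incl_lie x y :
  sub_incl (lie x y) = sub_incl x * sub_incl y - sub_incl y * sub_incl x.
Proof. exact: env_gen_lie. Qed.

(* The algebra map U(S) -> U(L). *)
Definition env_incl : {lrmorphism env sub_lie -> env L} :=
  env_lift (LieRep sub_incl_lie).

End SubLie.

Record category := Category {
  obj :> Type;
  hom : obj -> obj -> Type;
  idc : forall x, hom x x;
  compc : forall x y z, hom y z -> hom x y -> hom x z;
  comp_idl : forall x y (f : hom x y), compc (idc y) f = f;
  comp_idr : forall x y (f : hom x y), compc f (idc x) = f;
  compA : forall x y z t (f : hom z t) (g : hom y z) (h : hom x y),
    compc f (compc g h) = compc (compc f g) h }.

Arguments hom {c} _ _.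
Arguments idc {c} _.
Arguments compc {c x y z} _ _.

Record functor (C D : category) := Functor {
  fobj :> C -> D;
  fmap : forall x y : C, hom x y -> hom (fobj x) (fobj y);
  fmap_id : forall x : C, fmap (idc x) = idc (fobj x);
  fmap_comp : forall (x y z : C) (f : hom y z) (g : hom x y),
    fmap (compc f g) = compc (fmap f) (fmap g) }.

Arguments fmap {C D} _ {x y} _.

Definition functor_id (C : category) : functor C C :=
  @Functor C C (fun x => x) (fun _ _ f => f) (fun _ => erefl) (fun _ _ _ _ _ => erefl).

Section FunctorComp.
Variables (C D E : category) (G : functor D E) (F : functor C D).

Lemma fcomp_id x : fmap G (fmap F (idc x)) = idc (G (F x)).
Proof. by rewrite !fmap_id. Qed.
Lemma fcomp_comp x y z (f : hom y z) (g : hom x y) :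
  fmap G (fmap F (compc f g)) = compc (fmap G (fmap F f)) (fmap G (fmap F g)).
Proof. by rewrite !fmap_comp. Qed.

Definition functor_comp : functor C E :=
  @Functor C E (fun x => G (F x)) (fun _ _ f => fmap G (fmap F f)) fcomp_id fcomp_comp.
End FunctorComp.

Definition is_iso (C : category) (x y : C) (f : hom x y) : Prop :=
  exists g : hom y x, compc g f = idc x /\ compc f g = idc y.

Definition nat_isomorphic (C D : category) (F G : functor C D) : Prop :=
  exists eta : forall x, hom (F x) (G x),
    (forall (x y : C) (f : hom x y),
       compc (eta y) (fmap F f) = compc (fmap G f) (eta x)) /\
    (forall x, is_iso (eta x)).

Definition is_equivalence (C D : category) (F : functor C D) : Prop :=
  exists G : functor D C,
    nat_isomorphic (functor_comp G F) (functor_id C) /\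
    nat_isomorphic (functor_comp F G) (functor_id D).

Definition equivalent (C D : category) : Prop :=
  exists F : functor C D, is_equivalence F.

Section FullSubcategory.
Variables (C : category) (T : C -> Prop).

Definition full_sub : category :=
  @Category {x : C | T x} (fun x y => hom (sval x) (sval y))
    (fun x => idc (sval x)) (fun _ _ _ f g => compc f g)
    (fun _ _ f => comp_idl f) (fun _ _ f => comp_idr f)
    (fun _ _ _ _ f g h => compA f g h).

Definition full_incl : functor full_sub C :=
  @Functor full_sub C (fun x => sval x) (fun _ _ f => f)
    (fun _ => erefl) (fun _ _ _ _ _ => erefl).

(* A functor to C with values in T, as a functor to the full subcategory. *)
Definition corestrict (B : category) (F : functor B C) (FT : forall x, T (F x)) :
    functor B full_sub :=
  @Functor B full_sub (fun x => exist _ (F x) (FT x)) (fun _ _ f => fmap F f)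
    (fun x => fmap_id F x) (fun _ _ _ f g => fmap_comp F f g).
End FullSubcategory.

Definition is_zero_obj (C : category) (x : C) : Prop :=
  forall y : C, (exists f : hom x y, forall g, g = f) /\
                (exists f : hom y x, forall g, g = f).

Section DirectSumCategory.
Variable C : nat -> category.

Lemma dsum_cat_idl (x y : forall i, C i) (f : forall i, hom (x i) (y i)) :
  (fun i => compc (idc (y i)) (f i)) = f.
Proof. by apply: functional_extensionality_dep => i; apply: comp_idl. Qed.
Lemma dsum_cat_idr (x y : forall i, C i) (f : forall i, hom (x i) (y i)) :
  (fun i => compc (f i) (idc (x i))) = f.
Proof. by apply: functional_extensionality_dep => i; apply: comp_idr. Qed.
Lemma dsum_catA (x y z t : forall i, C i) (f : forall i, hom (z i) (t i))
    (g : forall i, hom (y i) (z i)) (h : forall i, hom (x i) (y i)) :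
  (fun i => compc (f i) (compc (g i) (h i))) = (fun i => compc (compc (f i) (g i)) (h i)).
Proof. by apply: functional_extensionality_dep => i; apply: compA. Qed.

(* The direct sum of the categories C i: families of objects almost all of
   which are zero objects. *)
Definition dsum_cat : category :=
  @Category
    {x : forall i, C i | exists n, forall i, (n <= i)%N -> is_zero_obj (x i)}
    (fun x y => forall i, hom (sval x i) (sval y i))
    (fun x i => idc (sval x i))
    (fun _ _ _ f g i => compc (f i) (g i))
    (fun _ _ f => dsum_cat_idl f) (fun _ _ f => dsum_cat_idr f)
    (fun _ _ _ _ f g h => dsum_catA f g h).
End DirectSumCategory.

Lemma linear_eq (A : pzRingType) (M N : lmodType A) (f g : {linear M -> N}) :
  f =1 g -> f = g.
Proof.
case: f => f cf; case: g => g cg /= fg.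
have {}fg : f = g by apply: funext.
case: _ / fg in cg *; congr GRing.Linear.Pack.
case: cf => [[a1] [b1]]; case: cg => [[a2] [b2]].
by congr GRing.Linear.Class; [congr Algebra.isNmodMorphism.Axioms_ | congr GRing.isScalable.Axioms_];
  apply: Prop_irrelevance.
Qed.

Section ModuleCategory.
Variable A : pzRingType.

Definition mod_id (M : lmodType A) : {linear M -> M} := idfun.
Definition mod_comp (M N T : lmodType A) (f : {linear N -> T}) (g : {linear M -> N}) :
  {linear M -> T} := f \o g.

Lemma mod_comp_idl (M N : lmodType A) (f : {linear M -> N}) : mod_comp (mod_id N) f = f.
Proof. exact: linear_eq. Qed.
Lemma mod_comp_idr (M N : lmodType A) (f : {linear M -> N}) : mod_comp f (mod_id M) = f.
Proof. exact: linear_eq. Qed.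
Lemma mod_compA (M N T S : lmodType A) (f : {linear T -> S}) (g : {linear N -> T})
  (h : {linear M -> N}) : mod_comp f (mod_comp g h) = mod_comp (mod_comp f g) h.
Proof. exact: linear_eq. Qed.

Definition Mod : category :=
  @Category (lmodType A) (fun M N => {linear M -> N}) mod_id mod_comp
    mod_comp_idl mod_comp_idr mod_compA.

(* The smallest Serre subcategory of the full subcategory [T] of [Mod]
   containing M1 and M2.  [T] is meant to be abelian, with the exact sequences
   of [Mod]. *)
Definition is_serre (T S : lmodType A -> Prop) : Prop :=
  (forall M, S M -> T M) /\
  forall (M1 M2 M3 : lmodType A) (f : {linear M1 -> M2}) (g : {linear M2 -> M3}),
    T M1 -> T M2 -> T M3 -> short_exact f g -> (S M2 <-> S M1 /\ S M3).

Definition serre_gen (T : lmodType A -> Prop) (M1 M2 M : lmodType A) : Prop :=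
  forall S : lmodType A -> Prop, is_serre T S -> S M1 -> S M2 -> S M.
End ModuleCategory.

Section DirectSum.
Variables (A : pzRingType) (N : nat -> lmodType A).

Record dsum := Dsum {
  ds_fun :> forall i, N i;
  ds_fin : exists n, forall i, (n <= i)%N -> ds_fun i = 0 }.

Lemma dsum_eq (x y : dsum) : (forall i, x i = y i) -> x = y.
Proof.
case: x => x px; case: y => y py /= xy.
have {}xy : x = y by apply: functional_extensionality_dep.
by case: _ / xy in py *; congr Dsum; apply: Prop_irrelevance.
Qed.

HB.instance Definition _ := gen_eqMixin dsum.
HB.instance Definition _ := gen_choiceMixin dsum.

Lemma ds_zero_fin : exists n, forall i, (n <= i)%N -> (0 : N i) = 0.
Proof. by exists 0%N. Qed.
Lemma ds_add_fin (x y : dsum) : exists n, forall i, (n <= i)%N -> x i + y i = 0.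
Proof.
case: (ds_fin x) (ds_fin y) => n hn [m hm]; exists (maxn n m) => i.
by rewrite geq_max => /andP[/hn -> /hm ->]; rewrite addr0.
Qed.
Lemma ds_opp_fin (x : dsum) : exists n, forall i, (n <= i)%N -> - x i = 0.
Proof. by case: (ds_fin x) => n hn; exists n => i /hn ->; rewrite oppr0. Qed.
Lemma ds_scale_fin (a : A) (x : dsum) : exists n, forall i, (n <= i)%N -> a *: x i = 0.
Proof. by case: (ds_fin x) => n hn; exists n => i /hn ->; rewrite scaler0. Qed.

Definition ds_zero := Dsum ds_zero_fin.
Definition ds_add x y := Dsum (ds_add_fin x y).
Definition ds_opp x := Dsum (ds_opp_fin x).
Definition ds_scale a x := Dsum (ds_scale_fin a x).

Lemma ds_addA : associative ds_add.
Proof. by move=> x y z; apply: dsum_eq => i /=; rewrite addrA. Qed.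
Lemma ds_addC : commutative ds_add.
Proof. by move=> x y; apply: dsum_eq => i /=; rewrite addrC. Qed.
Lemma ds_add0 : left_id ds_zero ds_add.
Proof. by move=> x; apply: dsum_eq => i /=; rewrite add0r. Qed.
Lemma ds_addN : left_inverse ds_zero ds_opp ds_add.
Proof. by move=> x; apply: dsum_eq => i /=; rewrite addNr. Qed.

HB.instance Definition _ := GRing.isZmodule.Build dsum ds_addA ds_addC ds_add0 ds_addN.

Lemma ds_scaleA a b v : ds_scale a (ds_scale b v) = ds_scale (a * b) v.
Proof. by apply: dsum_eq => i /=; rewrite scalerA. Qed.
Lemma ds_scale1 : left_id 1 ds_scale.
Proof. by move=> x; apply: dsum_eq => i /=; rewrite scale1r. Qed.
Lemma ds_scaleDr : right_distributive ds_scale +%R.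
Proof. by move=> a x y; apply: dsum_eq => i /=; rewrite scalerDr. Qed.
Lemma ds_scaleDl v : {morph ds_scale^~ v : a b / a + b}.
Proof. by move=> a b; apply: dsum_eq => i /=; rewrite scalerDl. Qed.

HB.instance Definition _ := GRing.Zmodule_isLmodule.Build A dsum
  ds_scaleA ds_scale1 ds_scaleDr ds_scaleDl.
End DirectSum.

Section DirectSumMap.
Variables (A : pzRingType) (M N : nat -> lmodType A) (f : forall i, {linear M i -> N i}).

Lemma dsum_map_fin (x : dsum M) : exists n, forall i, (n <= i)%N -> f i (x i) = 0.
Proof. by case: (ds_fin x) => n hn; exists n => i /hn ->; rewrite linear0. Qed.

Definition dsum_map (x : dsum M) : dsum N := Dsum (dsum_map_fin x).

Lemma dsum_map_linear : linear dsum_map.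
Proof. by move=> a x y; apply: dsum_eq => i /=; rewrite linearP. Qed.

HB.instance Definition _ := GRing.isLinear.Build A (dsum M) (dsum N) _ dsum_map dsum_map_linear.
End DirectSumMap.

Section DirectSumFunctor.
Variables (A : pzRingType) (T : nat -> lmodType A -> Prop).

Let D := dsum_cat (fun i => @full_sub (Mod A) (T i)).

Definition dsum_fobj (x : D) : Mod A := dsum (fun i => sval (sval x i)) : lmodType A.
Definition dsum_fmap (x y : D) (f : hom x y) : hom (dsum_fobj x) (dsum_fobj y) :=
  dsum_map (f : forall i, {linear sval (sval x i) -> sval (sval y i)}).

Lemma dsum_fmap_id (x : D) : dsum_fmap (idc x) = idc (dsum_fobj x).
Proof. by apply: linear_eq => v; apply: dsum_eq. Qed.
Lemma dsum_fmap_comp (x y z : D) (f : hom y z) (g : hom x y) :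
  dsum_fmap (compc f g) = compc (dsum_fmap f) (dsum_fmap g).
Proof. by apply: linear_eq => v; apply: dsum_eq. Qed.

Definition dsum_functor : functor D (Mod A) :=
  Functor dsum_fmap_id dsum_fmap_comp.
End DirectSumFunctor.

Section VectorSpaces.
Variable K : fieldType.

Definition FinVect : category :=
  @full_sub (Mod K) (fun V => fin_dim [set: V]%classic).

(* Finite dimensional representations of the quiver with vertices 1, 2 and
   arrows a : 1 -> 2, b : 2 -> 1, with the relation ab = 0. *)
Record quiver_rep := QuiverRep {
  qr_1 : lmodType K;
  qr_2 : lmodType K;
  qr_fin1 : fin_dim [set: qr_1]%classic;
  qr_fin2 : fin_dim [set: qr_2]%classic;
  qr_a : {linear qr_1 -> qr_2};
  qr_b : {linear qr_2 -> qr_1};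
  qr_ab : forall v, qr_a (qr_b v) = 0 }.

Record quiver_hom (V W : quiver_rep) := QuiverHom {
  qh_1 : {linear qr_1 V -> qr_1 W};
  qh_2 : {linear qr_2 V -> qr_2 W};
  qh_a : forall v, qh_2 (qr_a V v) = qr_a W (qh_1 v);
  qh_b : forall v, qh_1 (qr_b V v) = qr_b W (qh_2 v) }.

Lemma quiver_hom_eq V W (f g : quiver_hom V W) :
  qh_1 f =1 qh_1 g -> qh_2 f =1 qh_2 g -> f = g.
Proof.
case: f => f1 f2 fa fb; case: g => g1 g2 ga gb /= /linear_eq e1 /linear_eq e2.
case: _ / e1 in ga gb *; case: _ / e2 in ga gb *.
by congr QuiverHom; apply: Prop_irrelevance.
Qed.

Definition quiver_id V : quiver_hom V V :=
  @QuiverHom V V (mod_id _) (mod_id _) (fun=> erefl) (fun=> erefl).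

Section Comp.
Variables (V W X : quiver_rep) (f : quiver_hom W X) (g : quiver_hom V W).
Lemma quiver_comp_a v :
  mod_comp (qh_2 f) (qh_2 g) (qr_a V v) = qr_a X (mod_comp (qh_1 f) (qh_1 g) v).
Proof. by rewrite /= !qh_a. Qed.
Lemma quiver_comp_b v :
  mod_comp (qh_1 f) (qh_1 g) (qr_b V v) = qr_b X (mod_comp (qh_2 f) (qh_2 g) v).
Proof. by rewrite /= !qh_b. Qed.
Definition quiver_comp : quiver_hom V X := QuiverHom quiver_comp_a quiver_comp_b.
End Comp.

Lemma quiver_comp_idl V W (f : quiver_hom V W) : quiver_comp (quiver_id W) f = f.
Proof. exact: quiver_hom_eq. Qed.
Lemma quiver_comp_idr V W (f : quiver_hom V W) : quiver_comp f (quiver_id V) = f.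
Proof. exact: quiver_hom_eq. Qed.
Lemma quiver_compA V W X Y (f : quiver_hom X Y) (g : quiver_hom W X) (h : quiver_hom V W) :
  quiver_comp f (quiver_comp g h) = quiver_comp (quiver_comp f g) h.
Proof. exact: quiver_hom_eq. Qed.

Definition QuiverReps : category :=
  @Category quiver_rep quiver_hom quiver_id quiver_comp
    quiver_comp_idl quiver_comp_idr quiver_compA.
End VectorSpaces.

Inductive sgen := sE | sH | sF | sP | sQ | sZ.

Definition sgen_code (g : sgen) : 'I_6 :=
  match g with
  | sE => @Ordinal 6 0 isT | sH => @Ordinal 6 1 isT | sF => @Ordinal 6 2 isT
  | sP => @Ordinal 6 3 isT | sQ => @Ordinal 6 4 isT | sZ => @Ordinal 6 5 isT
  end.
Definition sgen_decode (i : 'I_6) : sgen := nth sE [:: sE; sH; sF; sP; sQ; sZ] i.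

Lemma sgen_codeK : cancel sgen_code sgen_decode.
Proof. by case. Qed.

HB.instance Definition _ := Finite.copy sgen (can_type sgen_codeK).

Section Schroedinger.
Variable K : fieldType.

Definition svec := {ffun sgen -> K^o}.
HB.instance Definition _ := GRing.Lmodule.on svec.

Definition sb (i : sgen) : svec := [ffun j => (j == i)%:R].

Definition bracket_table (i j : sgen) : svec :=
  match i, j with
  | sH, sE => 2 *: sb sE    | sE, sH => - (2 *: sb sE)
  | sE, sF => sb sH         | sF, sE => - sb sH
  | sH, sF => - (2 *: sb sF)| sF, sH => 2 *: sb sF
  | sE, sQ => sb sP         | sQ, sE => - sb sP
  | sH, sP => sb sP         | sP, sH => - sb sP
  | sF, sP => sb sQ         | sP, sF => - sb sQ
  | sH, sQ => - sb sQ       | sQ, sH => sb sQ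
  | sP, sQ => sb sZ         | sQ, sP => - sb sZ
  | _, _ => 0
  end.

Definition sbracket (x y : svec) : svec :=
  \sum_(i : sgen) \sum_(j : sgen) (x i * y j) *: bracket_table i j.

Lemma sgen_sum (V : nmodType) (G : sgen -> V) :
  \sum_(i : sgen) G i = G sE + (G sH + (G sF + (G sP + (G sQ + G sZ)))).
Proof.
rewrite (reindex_onto sgen_decode sgen_code) /=; last by move=> i _; apply: sgen_codeK.
rewrite (eq_bigl xpredT); last first.
  by case; do 6![case=> [i|]; first by apply/eqP/val_inj].
by rewrite !big_ord_recl big_ord0 addr0.
Qed.

Lemma sbracketE x y : sbracket x y = [ffun k => match k with
  | sE => 2 * (x sH * y sE - x sE * y sH)
  | sH => x sE * y sF - x sF * y sE
  | sF => 2 * (x sF * y sH - x sH * y sF)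
  | sP => x sE * y sQ - x sQ * y sE + (x sH * y sP - x sP * y sH)
  | sQ => x sF * y sP - x sP * y sF - (x sH * y sQ - x sQ * y sH)
  | sZ => x sP * y sQ - x sQ * y sP
  end : K^o].
Proof.
apply/ffunP => k; rewrite /sbracket !sgen_sum /= !ffunE /=.
by case: k; rewrite /GRing.scale /=; ring.
Qed.

Lemma sbracket_linl y : linear (fun x => sbracket x y).
Proof.
by move=> a u v; apply/ffunP; rewrite !sbracketE; case;
  rewrite !ffunE /GRing.scale /=; ring.
Qed.
Lemma sbracket_linr x : linear (sbracket x).
Proof.
by move=> a u v; apply/ffunP; rewrite !sbracketE; case;
  rewrite !ffunE /GRing.scale /=; ring.
Qed.
Lemma sbracket_alt x : sbracket x x = 0.
Proof. by apply/ffunP; rewrite !sbracketE; case; rewrite !ffunE; ring. Qed.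
Lemma sbracket_jacobi x y z :
  sbracket x (sbracket y z) + sbracket y (sbracket z x) + sbracket z (sbracket x y) = 0.
Proof. by apply/ffunP; rewrite !sbracketE; case; rewrite !ffunE; ring. Qed.

Definition schr : lieAlg K :=
  LieAlg sbracket_linl sbracket_linr sbracket_alt sbracket_jacobi.

(* The span of a set of basis vectors of schr. *)
Lemma sspan_closed (B : {set sgen}) :
  (forall i, i \notin B -> (0 : svec) i = 0) /\
  forall (a : K) (u v : svec), (forall i, i \notin B -> u i = 0) ->
    (forall i, i \notin B -> v i = 0) -> forall i, i \notin B -> (a *: u + v) i = 0.
Proof.
split=> [i _|a u v hu hv i iB]; rewrite !ffunE //.
by rewrite hu // hv // scaler0 addr0.
Qed.

Definition sspan (B : {set sgen}) : submod schr :=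
  @Submod K schr (fun x : svec => forall i, i \notin B -> x i = 0) (sspan_closed B).

Definition cartan := sspan [set sH; sZ].
Definition nplus := sspan [set sE; sP].
Definition borel := sspan [set sH; sZ; sE; sP].

Lemma nplus_lie x y : nplus x -> nplus y -> nplus (lie x y).
Proof.
move=> hx hy i hi; rewrite [lie x y]sbracketE ffunE.
have [xH xF xQ] : [/\ x sH = 0, x sF = 0 & x sQ = 0] by split; rewrite ?hx // !inE.
have [yH yF yQ] : [/\ y sH = 0, y sF = 0 & y sQ = 0] by split; rewrite ?hy // !inE.
rewrite !(xH,xF,xQ,yH,yF,yQ); case: i hi; rewrite !inE //= => _; ring.
Qed.

Lemma borel_lie x y : borel x -> borel y -> borel (lie x y).
Proof.
move=> hx hy i hi; rewrite [lie x y]sbracketE ffunE.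
have [xF xQ yF yQ] : [/\ x sF = 0, x sQ = 0, y sF = 0 & y sQ = 0].
  by split; rewrite ?hx ?hy // !inE.
rewrite !(xF,xQ,yF,yQ); case: i hi; rewrite !inE //= => _; ring.
Qed.

Definition U : algType K := env schr.
Definition nplusL : lieAlg K := sub_lie nplus_lie.
Definition borelL : lieAlg K := sub_lie borel_lie.

(* The dual of the Cartan subalgebra, in the coordinates (lambda(h), lambda(z))
   with respect to the basis (h^vee, z^vee). *)
Definition weight : Type := (K^o * K^o)%type.
HB.instance Definition _ := GRing.Lmodule.on weight.

Definition hvee : weight := (1, 0).
Definition zvee : weight := (0, 1).
Definition rho : weight := (3 / 2 : K) *: hvee.

(* lambda, extended by 0 to the other basis vectors. *)
Definition wt_eval (lam : weight) (x : svec) : K := lam.1 * x sH + lam.2 * x sZ.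

Definition refl (lam : weight) : weight := (- lam.1) *: hvee + lam.2 *: zvee.
Definition dot_refl (lam : weight) : weight := refl (lam + rho) - rho.

Lemma dot_reflE lam : (2 : K) != 0 -> dot_refl lam = (- lam.1 - 3, lam.2).
Proof.
move=> two; case: lam => a b; rewrite /dot_refl /refl /rho.
by congr pair; rewrite /= /GRing.scale /=; field.
Qed.

(* Cosets of the root lattice Z h^vee in the dual of the Cartan subalgebra. *)
Definition is_coset (xi : set weight) : Prop :=
  exists lam : weight, forall mu, xi mu <-> exists n : int, mu = lam + hvee *~ n.

Section Verma.
Variable lam : weight.

Definition borel_char (x : borelL) : K^o := wt_eval lam (sm_val x).

Lemma borel_char_linear : linear borel_char.
Proof. by move=> a x y; rewrite /borel_char /wt_eval /= !ffunE /GRing.scale /=; ring. Qed.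

HB.instance Definition _ := GRing.isLinear.Build K borelL K^o _ borel_char borel_char_linear.

Lemma borel_char_lie x y :
  borel_char (lie x y) = borel_char x * borel_char y - borel_char y * borel_char x.
Proof.
rewrite [X in _ = X - _]mulrC subrr.
case: x => x /[dup] /sm_predP hx px; case: y => y /[dup] /sm_predP hy py.
rewrite /borel_char /wt_eval -[sm_val _]/(sbracket x y) sbracketE !ffunE.
have [xF xQ yF yQ] : [/\ x sF = 0, x sQ = 0, y sF = 0 & y sQ = 0].
  by split; rewrite ?hx ?hy // !inE.
by rewrite xF xQ yF yQ; ring.
Qed.

(* C_lambda: the field, with U(b) acting through the character of b that is
   lambda on the Cartan subalgebra and 0 on n_+. *)
Definition Cmod : lmodType (env borelL) :=
  restr (env_lift (LieRep borel_char_lie)) (K^o)^o.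

(* Delta(lambda) = U (x)_{U(b)} C_lambda *)
Definition verma : lmodType U := tens (env_incl borel_lie) Cmod.

(* L(lambda) *)
Definition simple_hw : lmodType U := simple_quotient verma.
End Verma.

(* A U-module viewed as a vector space. *)
Definition vect (M : lmodType U) : lmodType K := restr (in_alg U) M.

Section WeightSpaces.
Variables (lam : weight) (M : lmodType U).

Definition is_wt_vec (v : M) : Prop :=
  forall x : schr, cartan x -> env_gen x *: v = (wt_eval lam x)%:A *: v.

Lemma wt_space_closed :
  is_wt_vec 0 /\
  forall (a : K) (u v : vect M), is_wt_vec u -> is_wt_vec v -> is_wt_vec (a *: u + v).
Proof.
split=> [x _|a u v hu hv x hx]; first by rewrite !scaler0.
have E w : (a *: (w : vect M) : vect M) = (a%:A : U) *: (w : M) by [].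
have aC (y : U) : y * a%:A = a%:A * y by rewrite -scalerAr -scalerAl mulr1 mul1r.
rewrite !E; have F (y : U) : y *: (a%:A *: (u : M)) = a%:A *: (y *: (u : M)).
  by rewrite !scalerA aC.
by rewrite !scalerDr !F hu // hv.
Qed.

(* The weight space M_lambda. *)
Definition wt_space : submod (vect M) := @Submod K (vect M) is_wt_vec wt_space_closed.
End WeightSpaces.

Section WeightFunctor.
Variable lam : weight.

Section Map.
Variables (M N : lmodType U) (f : {linear M -> N}).

Lemma wt_map_proof (v : subm (wt_space lam M)) :
  f (sm_val v) \in sm_pred (wt_space lam N).
Proof.
case: v => v /= /sm_predP hv; apply/sm_predP => x hx.
by rewrite -!linearZ /= hv.
Qed.

Definition wt_map (v : subm (wt_space lam M)) : subm (wt_space lam N) :=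
  Subm (wt_map_proof v).

Lemma wt_map_linear : linear wt_map.
Proof. by move=> a u v; apply: val_inj; exact: (linearP f (a%:A)). Qed.

HB.instance Definition _ := GRing.isLinear.Build K
  (subm (wt_space lam M)) (subm (wt_space lam N)) _ wt_map wt_map_linear.
End Map.

Definition wt_fobj (M : Mod U) : Mod K := subm (wt_space lam M) : lmodType K.
Definition wt_fmap (M N : Mod U) (f : hom M N) : hom (wt_fobj M) (wt_fobj N) := wt_map f.

Lemma wt_fmap_id (M : Mod U) : wt_fmap (idc M) = idc (wt_fobj M).
Proof. by apply: linear_eq => v; apply: val_inj. Qed.
Lemma wt_fmap_comp (M N T : Mod U) (f : hom N T) (g : hom M N) :
  wt_fmap (compc f g) = compc (wt_fmap f) (wt_fmap g).
Proof. by apply: linear_eq => v; apply: val_inj. Qed.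

(* M |-> M_lambda, and f |-> the restriction of f. *)
Definition wt_functor : functor (Mod U) (Mod K) := Functor wt_fmap_id wt_fmap_comp.
End WeightFunctor.

Section CategoryO.
Variable M : lmodType U.

(* M is the (internal) direct sum of its weight spaces. *)
Definition weight_module : Prop :=
  (forall v : M, exists (n : nat) (mu : 'I_n -> weight) (w : 'I_n -> M),
     (forall i, is_wt_vec (mu i) (w i)) /\ v = \sum_(i < n) w i) /\
  (forall (n : nat) (mu : 'I_n -> weight) (w : 'I_n -> M), injective mu ->
     (forall i, is_wt_vec (mu i) (w i)) -> \sum_(i < n) w i = 0 -> forall i, w i = 0).

Definition support : set weight :=
  [set lam | exists v : M, is_wt_vec lam v /\ v <> 0]%classic.

Definition nplus_orbit (v : M) : set (vect M) :=
  [set w | exists u : env nplusL, w = env_incl nplus_lie u *: v]%classic.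

Definition category_O : Prop :=
  [/\ fin_generated M, weight_module & forall v : M, fin_dim (nplus_orbit v)].

End CategoryO.

Section Blocks.
Variable xi : set weight.

(* O[xi] *)
Definition O_xi (M : lmodType U) : Prop :=
  category_O M /\ (support M `<=` xi)%classic.

(* O[xi]_lambda *)
Definition O_block (lam : weight) : lmodType U -> Prop :=
  serre_gen O_xi (verma lam) (verma (dot_refl lam)).

Definition O_xi_cat : category := @full_sub (Mod U) O_xi.
Definition O_block_cat (lam : weight) : category := @full_sub (Mod U) (O_block lam).

(* The direct sum of the subcategories O[xi]_(lam i), and (M_i)_i |-> (+)_i M_i. *)
Definition blocks_cat (lam : nat -> weight) : category :=
  dsum_cat (fun i => O_block_cat (lam i)).
Definition blocks_sum (lam : nat -> weight) : functor (blocks_cat lam) (Mod U) :=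
  dsum_functor (fun i => O_block (lam i)).

Definition block_wt_functor (lam : weight) : functor (O_block_cat lam) (Mod K) :=
  functor_comp (wt_functor lam) (@full_incl (Mod U) (O_block lam)).
End Blocks.
End Schroedinger.

(* Main.v *)
(* When z acts by c != 0, subtracting suitable quadratic expressions in p, q from e, h, f gives an
   sl2-triple E, H, F commuting with p and q, so a module of O[xi] is a module over sl2 tensored
   with a Weyl algebra, on which p acts locally nilpotently and surjectively.  Hence everything is
   controlled by ker p, where E, H, F act as in the category O of sl2 with integral weights; the
   shift by the Weyl algebra turns the half-integral weights -3/2 + n into the H-weights n - 1.

   The Casimir element 4FE + (H + 1)^2 acts on a highest weight vector of weight lambda_n by n^2,
   and its generalised eigenspaces are the blocks; in the i-th block the only highest weights are
   lambda_i and lambda_(-i).  Explicit modules C[q] (x) W, with W a chain of vector spaces linked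
   by raising and lowering maps, realise the Verma modules, and, for a representation (V1, V2, a, b)
   of the quiver (V1, V2 being the primitive vectors of weights lambda_(-i), lambda_i, b = F^i and
   a a multiple of E^i), a module of the block with these primitive vectors; a map out of it is
   determined by, and exists for, any compatible placement of V1 and V2.  This gives fullness,
   faithfulness and essential surjectivity of the functors in (iv) and (v). *)

(* Passing to ker p rests on one lifting argument. A map out of a chain module is tested on highest
   weight vectors alone, because a nonzero kernel or cokernel contains one and the Casimir element
   allows only the degrees i and -i. For the cokernel, such a vector must come from ker p of the
   target; it does because p is onto on every chain module, hence on its image. No PBW theorem is
   invoked: linear independence in a Verma module is read off from the explicit model, which two
   universal properties identify with the induced module. The category O[xi]_lambda is an
   intersection of Serre classes, so it is bounded from both sides: a Serre class cut out by the
   Casimir element and finite dimensional weight spaces contains the two Verma modules, and a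
   highest weight filtration reaches every module of O[xi] with the right generalised eigenvalue.
   Both the relation ab = 0 and the normalisation of a come from one scalar: E^k F^k acts on
   primitive vectors of degree i by a product that is nonzero for k < i and vanishes at k = i. *)
From HB Require Import structures.
From mathcomp Require Import all_boot all_order all_algebra.
From mathcomp Require Import ring zify.
From mathcomp Require Import boolp classical_sets reals.
From mathcomp Require Import complex.

Set Implicit Arguments.
Unset Strict Implicit.
Unset Printing Implicit Defensive.

Import Order.TTheory GRing.Theory Num.Theory.
Local Open Scope ring_scope.

Require Import Defs.

(** * Linear algebra *)

Section LinearExpressions.
Variables (K : pzRingType) (V : lmodType K).

(** Syntax for proof by reflection: a module identity is split into one scalar identity per atom,
    within reach of [ring] and [field]. *)
Inductive lexp := LAtom of nat | LZero | LAdd of lexp & lexp | LOpp of lexp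
  | LScale of K & lexp.

Fixpoint leval (env : seq V) (t : lexp) : V :=
  match t with
  | LAtom n => nth 0 env n
  | LZero => 0
  | LAdd t u => leval env t + leval env u
  | LOpp t => - leval env t
  | LScale a t => a *: leval env t
  end.

Fixpoint lcoef (t : lexp) (n : nat) : K :=
  match t with
  | LAtom m => if Nat.eqb m n then 1 else 0
  | LZero => 0
  | LAdd t u => lcoef t n + lcoef u n
  | LOpp t => - lcoef t n
  | LScale a t => a * lcoef t n
  end.

Lemma leval_coef env t :
  leval env t = \sum_(n < size env) lcoef t n *: nth 0 env n.
Proof.
elim: t => [m||t IHt u IHu|t IHt|a t IHt] /=.
- case: (ltnP m (size env)) => hm.
    rewrite (bigD1 (Ordinal hm)) //= PeanoNat.Nat.eqb_refl scale1r big1 ?addr0 // => j /eqP hj.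
    have /PeanoNat.Nat.eqb_neq -> : m <> j by move=> e; apply: hj; apply: val_inj.
    by rewrite scale0r.
  rewrite nth_default // big1 // => j _.
  have /PeanoNat.Nat.eqb_neq -> : m <> j by move=> e; move: (ltn_ord j); rewrite -e ltnNge hm.
  by rewrite scale0r.
- by rewrite big1 // => j _; rewrite scale0r.
- by rewrite IHt IHu -big_split; apply: eq_bigr => j _; rewrite scalerDl.
- by rewrite IHt -sumrN; apply: eq_bigr => j _; rewrite scaleNr.
- by rewrite IHt scaler_sumr; apply: eq_bigr => j _; rewrite scalerA.
Qed.

Fixpoint lcoef_eq (t u : lexp) (n : nat) : Prop :=
  if n is n'.+1 then lcoef t n' = lcoef u n' /\ lcoef_eq t u n' else True.

Lemma leval_eq env t u : lcoef_eq t u (size env) -> leval env t = leval env u.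
Proof.
move=> h; rewrite !leval_coef; apply: eq_bigr => -[j] /= + _.
elim: (size env) h => //= n IH [h1 h2]; rewrite ltnS leq_eqVlt => /orP[/eqP ->|]; last exact: IH.
by rewrite h1.
Qed.
End LinearExpressions.

Ltac lmem a env := lazymatch env with
  | nil => constr:(false)
  | a :: _ => constr:(true)
  | _ :: ?r => lmem a r
  end.
Ltac lidx a env := lazymatch env with
  | a :: _ => constr:(0%N)
  | _ :: ?r => let n := lidx a r in constr:(n.+1)
  end.
Ltac latoms env t := lazymatch t with
  | (?a + ?b)%R => let env := latoms env a in latoms env b
  | (- ?a)%R => latoms env a
  | (_ *: ?a)%R => latoms env a
  | 0%R => env
  | _ => lazymatch lmem t env with true => env | false => constr:(t :: env) end
  end.
Ltac lreify K env t := lazymatch t with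
  | (?a + ?b)%R => let a := lreify K env a in let b := lreify K env b in constr:(@LAdd K a b)
  | (- ?a)%R => let a := lreify K env a in constr:(@LOpp K a)
  | (?k *: ?a)%R => let a := lreify K env a in constr:(@LScale K k a)
  | 0%R => constr:(@LZero K)
  | _ => let n := lidx t env in constr:(@LAtom K n)
  end.
(* Reduces an equation between linear combinations to the equations between the coefficients. *)
Ltac lmod K V := lazymatch goal with |- ?l = ?r =>
  let env := latoms (@nil V) l in let env := latoms env r in
  let t := lreify K env l in let u := lreify K env r in
  refine (@leval_eq K V env t u _); cbn [size lcoef_eq lcoef Nat.eqb]; repeat split end.

(* The general lemmas linearD, linearN, ... leave the map under coercions
   that differ from one lemma to the next. *)
Section LinearMaps.
Variables (A : pzRingType) (M N : lmodType A) (f : {linear M -> N}).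
Lemma lmap0 : f 0 = 0. Proof. exact: linear0. Qed.
Lemma lmapD u v : f (u + v) = f u + f v. Proof. exact: linearD. Qed.
Lemma lmapN u : f (- u) = - f u. Proof. exact: linearN. Qed.
Lemma lmapZ a u : f (a *: u) = a *: f u. Proof. exact: linearZ. Qed.
End LinearMaps.

Section Span.
Variables (A : pzRingType) (M : lmodType A).

(** Over K this is the linear span, over [U K] the submodule generated by [P]; both occur, on
    [vect M] and on [M]. *)
Inductive lspan (P : M -> Prop) : M -> Prop :=
  | lspan0 : lspan P 0
  | lspanP a u v : P u -> lspan P v -> lspan P (a *: u + v).

Variable P : M -> Prop.

Lemma lspan_incl u : P u -> lspan P u.
Proof. by move=> h; rewrite -[u]addr0 -[u]scale1r; apply: lspanP => //; exact: lspan0. Qed.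

Lemma lspanD u v : lspan P u -> lspan P v -> lspan P (u + v).
Proof.
move=> h hv; elim: h => [|a x y hx _ IH]; first by rewrite add0r.
by rewrite -addrA; apply: lspanP.
Qed.

Lemma lspanZ a u : lspan P u -> lspan P (a *: u).
Proof.
elim=> [|b x y hx _ IH]; first by rewrite scaler0; exact: lspan0.
by rewrite scalerDr scalerA; apply: lspanP.
Qed.

Lemma lspan_sum (I : Type) (r : seq I) (Q : pred I) (F : I -> M) :
  (forall i, Q i -> lspan P (F i)) -> lspan P (\sum_(i <- r | Q i) F i).
Proof. by move=> h; elim/big_ind: _ => //; [exact: lspan0|exact: lspanD]. Qed.

Definition span_submod : submod M :=
  @Submod A M (lspan P)
    (conj (lspan0 P) (fun a u v hu hv => lspanD (lspanZ a hu) hv)).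

Lemma lspan_min (S : submod M) v : (forall u, P u -> S u) -> lspan P v -> S v.
Proof.
move=> h; have [S0 SD] := sm_closed S.
by elim=> [|a x y hx _ IH]; [exact: S0|apply: SD => //; exact: h].
Qed.
End Span.

Lemma lspan_mono (A : pzRingType) (M : lmodType A) (P Q : M -> Prop) v :
  (forall u, P u -> lspan Q u) -> lspan P v -> lspan Q v.
Proof. by move=> h; apply: (@lspan_min _ _ P (span_submod Q)). Qed.

Lemma lspan_map (A : pzRingType) (M N : lmodType A) (f : {linear M -> N}) P Q v :
  (forall u, P u -> lspan Q (f u)) -> lspan P v -> lspan Q (f v).
Proof.
move=> h; elim=> [|a x y hx _ IH]; first by rewrite linear0; exact: lspan0.
by rewrite linearP; apply: lspanD => //; apply: lspanZ; apply: h.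
Qed.

Section Lists.
Variables (A : pzRingType) (M : lmodType A).
Definition listed (s : seq M) : M -> Prop := fun u => u \in s.

Lemma lspan_listedE s v : lspan (listed s) v ->
  exists c : 'I_(size s) -> A, v = \sum_(i < size s) c i *: nth 0 s i.
Proof.
elim=> [|a u w hu _ [c ->]]; first by exists (fun=> 0); rewrite big1 // => i _; rewrite scale0r.
have hi : (index u s < size s)%N by rewrite index_mem.
exists (fun i => (if i == Ordinal hi then a else 0) + c i).
rewrite [RHS](eq_bigr (fun i : 'I_(size s) => (if i == Ordinal hi then a else 0) *: nth 0 s i + c i *: nth 0 s i)); last by move=> i _; rewrite scalerDl.
rewrite big_split /=; congr (_ + _); rewrite (bigD1 (Ordinal hi)) //= eqxx nth_index //.
by rewrite big1 ?addr0 // => i /negPf ->; rewrite scale0r.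
Qed.

Lemma listed_gen n (g : 'I_n -> M) (c : 'I_n -> A) :
  lspan (listed (codom g)) (\sum_(i < n) c i *: g i).
Proof. by apply: lspan_sum => i _; apply/lspanZ/lspan_incl/codom_f. Qed.

Lemma fin_generatedP : fin_generated M <-> exists s, forall v, lspan (listed s) v.
Proof.
split=> [[n [g h]]|[s h]].
  by exists (codom g) => v; have [c ->] := h v; exact: listed_gen.
exists (size s), (fun i => nth 0 s i) => v; exact: lspan_listedE.
Qed.
End Lists.

Section FinDim.
Variable K : fieldType.

Lemma fin_dimP (V : lmodType K) (W : set V) :
  fin_dim W <-> exists s, forall v, W v -> lspan (listed s) v.
Proof.
split=> [[n [g h]]|[s h]].
  by exists (codom g) => v /h [c ->]; exact: listed_gen.
exists (size s), (fun i => nth 0 s i) => v /h; exact: lspan_listedE.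
Qed.

Lemma fin_dim_inj (V V' : lmodType K) (f : {linear V -> V'}) (W : submod V) (s : seq V') :
  injective f -> (forall v, W v -> lspan (listed s) (f v)) ->
  exists2 t, (forall v, v \in t -> W v) & forall v, W v -> lspan (listed t) v.
Proof.
move=> fI; elim: s W => [|x s IH] W hW.
  exists [::] => // v /hW h; have -> : v = 0; last exact: lspan0.
  apply: fI; rewrite linear0; elim: h => // a u w; by rewrite /listed in_nil.
have [W0 WD] := sm_closed W.
have W'cl : (W 0 /\ lspan (listed s) (f 0)) /\ forall a u v,
    (W u /\ lspan (listed s) (f u)) -> (W v /\ lspan (listed s) (f v)) ->
    W (a *: u + v) /\ lspan (listed s) (f (a *: u + v)).
  split; first by rewrite linear0; split=> //; exact: lspan0.
  move=> a u v [hu hu'] [hv hv']; split; first exact: WD.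
  by rewrite linearP; apply: lspanD => //; exact: lspanZ.
have [|t htW ht] := IH (Submod W'cl); first by move=> v [].
have split_ v : lspan (listed (x :: s)) v -> exists a, lspan (listed s) (v - a *: x).
  elim=> [|a u w hu _ [b hb]]; first by exists 0; rewrite scale0r subrr; exact: lspan0.
  move: hu; rewrite /listed in_cons => /orP[/eqP ->|hu].
    by exists (a + b); rewrite scalerDl opprD addrACA subrr add0r.
  exists b; rewrite -addrA; apply: lspanP => //.
have [[w [hw hn]]|h] := pselect (exists w, W w /\ ~ lspan (listed s) (f w)); last first.
  exists t => [v /htW []//|v hv]; apply: ht; split=> //.
  by apply/notP => hn; apply: h; exists v.
have [a ha] := split_ _ (hW _ hw).
have a0 : a != 0.
  by apply/eqP => a0; apply: hn; move: ha; rewrite a0 scale0r subr0.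
exists (w :: t) => [v|v hv].
  by rewrite in_cons => /orP[/eqP -> //|/htW []].
have [b hb] := split_ _ (hW _ hv).
have -> : v = (b / a) *: w + (v - (b / a) *: w) by rewrite addrC subrK.
apply: lspanP; first by rewrite /listed in_cons eqxx.
apply: (@lspan_mono _ _ (listed t)).
  by move=> u hu; apply: lspan_incl; rewrite /listed in_cons [u \in t]hu orbT.
apply: ht; split; first by rewrite addrC -scaleNr; apply: WD.
have -> : f (v - (b / a) *: w) = (f v - b *: x) + (- (b / a)) *: (f w - a *: x).
  by rewrite lmapD lmapN lmapZ; lmod K V'; field.
by apply: lspanD => //; apply: lspanZ.
Qed.

Lemma fin_dim_subm (V : lmodType K) (W : submod V) :
  fin_dim (W : set V) <-> fin_dim [set: subm W]%classic.
Proof.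
split=> /fin_dimP [s hs]; apply/fin_dimP.
  have Tcl : True /\ forall (a : K) (u v : subm W), True -> True -> True by [].
  have [||t _ ht] := @fin_dim_inj (subm W) V (sm_val (S := W)) (Submod Tcl) s.
  - exact: val_inj.
  - by move=> v _; apply: hs; apply/sm_predP/sm_valP.
  by exists t => v _; apply: ht.
exists (map (sm_val (S := W)) s) => v hv.
have pv : v \in sm_pred W by apply/sm_predP.
rewrite -[v]/(sm_val (Subm pv)); apply: (lspan_map (P := listed s)) => [u hu|]; last exact: hs.
by apply/lspan_incl/map_f.
Qed.

(** The coordinate matrix has more rows than columns, hence a nonzero left kernel. *)
Lemma dependent_list (V : lmodType K) (s : seq V) n (x : 'I_n -> V) :
  (size s < n)%N -> (forall i, lspan (listed s) (x i)) ->
  exists2 u : 'I_n -> K, (exists i, u i != 0) & \sum_i u i *: x i = 0.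
Proof.
move=> sn hx; have /choice [c hc] := fun i => lspan_listedE (hx i).
pose A : 'M_(n, size s) := \matrix_(i, j) c i j.
have : kermx A != 0.
  by rewrite -mxrank_eq0 mxrank_ker subn_eq0 -ltnNge (leq_ltn_trans (rank_leq_col A)).
case/rowV0Pn => r /sub_kermxP rA r0.
exists (fun i => r 0 i).
  apply/existsP; apply: contraNT r0; rewrite negb_exists => /forallP h.
  by apply/eqP/rowP => i; rewrite mxE; apply/eqP; rewrite -[_ == _]negbK.
under eq_bigr do rewrite hc scaler_sumr.
rewrite exchange_big /= big1 // => j _.
move/matrixP/(_ 0 j): rA; rewrite !mxE => rA.
under eq_bigr do rewrite scalerA.
rewrite -scaler_suml; under eq_bigr => i _ do rewrite -[c i j]/(c i j).
suff -> : \sum_i r 0 i * c i j = 0 by rewrite scale0r.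
by rewrite -[RHS]rA; apply: eq_bigr => i _; rewrite mxE.
Qed.
End FinDim.

Section Equivalence.
Variables (C D : category) (F : functor C D).
Hypothesis F_full : forall x y (g : hom (F x) (F y)), exists f : hom x y, fmap F f = g.
Hypothesis F_faithful : forall x y (f g : hom x y), fmap F f = fmap F g -> f = g.
Hypothesis F_surj : forall d, exists x (f : hom (F x) d), is_iso f.

(** The inverse sends [d] to a chosen object with a chosen isomorphism [eps d], which becomes the
    counit; morphisms are transported along these isomorphisms. *)
Lemma equivalence_of_full_faithful_surj : is_equivalence F.
Proof.
have /choice [Go hGo] := F_surj.
pose eps d : hom (F (Go d)) d := sval (cid (hGo d)).
pose iota d : hom d (F (Go d)) := sval (cid (svalP (cid (hGo d)))).
have ei d : compc (eps d) (iota d) = idc d := (svalP (cid (svalP (cid (hGo d))))).2.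
have ie d : compc (iota d) (eps d) = idc (F (Go d)) := (svalP (cid (svalP (cid (hGo d))))).1.
pose pre x y (g : hom (F x) (F y)) : hom x y := sval (cid (F_full g)).
have preK x y (g : hom (F x) (F y)) : fmap F (pre x y g) = g := svalP (cid (F_full g)).
pose Gm d d' (g : hom d d') : hom (Go d) (Go d') := pre _ _ (compc (iota d') (compc g (eps d))).
have Gid d : Gm d d (idc d) = idc (Go d).
  by apply: F_faithful; rewrite preK fmap_id comp_idl ie.
have Gcomp d1 d2 d3 (f : hom d2 d3) (g : hom d1 d2) : Gm _ _ (compc f g) = compc (Gm _ _ f) (Gm _ _ g).
  apply: F_faithful; rewrite fmap_comp !preK -!compA; congr compc; congr compc.
  by rewrite [in RHS]compA ei comp_idl.
pose G := Functor Gid Gcomp; exists G; split.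
  exists (fun x => pre (Go (F x)) x (eps (F x))); split=> [x y f|x].
    apply: F_faithful; rewrite /= !fmap_comp !preK compA ei comp_idl //.
  exists (pre x (Go (F x)) (iota (F x))).
  by split; [apply: (@F_faithful (Go (F x)) (Go (F x)))|apply: (@F_faithful x x)];
    rewrite fmap_comp !preK ?ie ?ei fmap_id.
exists eps; split=> [x y f|x].
  by rewrite /= preK compA ei comp_idl.
by exists (iota x); split; [exact: ie|exact: ei].
Qed.
End Equivalence.

Section DsumLift.
Variables (A : pzRingType) (N : nat -> lmodType A).

Definition dinj_fun i (y : N i) : forall j, N j := dfwith (fun j => 0 : N j) y.

Lemma dinj_fun_in i (y : N i) : dinj_fun y i = y.
Proof. exact: dfwith_in. Qed.

Lemma dinj_fun_out i j (y : N i) : i != j -> dinj_fun y j = 0.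
Proof. exact: dfwith_out. Qed.

Lemma dinj_fin i (y : N i) : exists n, forall j, (n <= j)%N -> dinj_fun y j = 0.
Proof. by exists i.+1 => j ij; rewrite dinj_fun_out // ltn_eqF. Qed.

Definition dinj i (y : N i) : dsum N := Dsum (dinj_fin y).

Lemma dinj_linear i : linear (@dinj i).
Proof.
move=> a u v; apply: dsum_eq => j /=; have [e|ij] := eqVneq i j.
  by case: j / e; rewrite !dinj_fun_in.
by rewrite !dinj_fun_out // scaler0 addr0.
Qed.
HB.instance Definition _ i := GRing.isLinear.Build A (N i) (dsum N) _ (@dinj i) (@dinj_linear i).

Lemma dinj_in i (y : N i) : dinj y i = y.
Proof. exact: dfwith_in. Qed.
Lemma dinj_out i j (y : N i) : i != j -> dinj y j = 0.
Proof. exact: dfwith_out. Qed.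

Definition dproj i (x : dsum N) : N i := x i.
Lemma dproj_linear i : linear (dproj i). Proof. by []. Qed.
HB.instance Definition _ i := GRing.isLinear.Build A (dsum N) (N i) _ (dproj i) (@dproj_linear i).

Lemma dsum_sumE n (F : 'I_n -> dsum N) j : (\sum_i F i) j = \sum_i F i j.
Proof. exact: (raddf_sum (dproj j)). Qed.

Lemma dsum_dinj (x : dsum N) n : (forall j, (n <= j)%N -> x j = 0) -> x = \sum_(i < n) dinj (x i).
Proof.
move=> hx; apply: dsum_eq => j; rewrite dsum_sumE; case: (ltnP j n) => jn.
  rewrite (bigD1 (Ordinal jn)) //= dinj_fun_in big1 ?addr0 // => i ij.
  by rewrite dinj_fun_out.
rewrite hx // big1 // => i _; rewrite dinj_out //.
by rewrite ltn_eqF // (leq_trans _ jn).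
Qed.

Lemma dsum_ind (P : dsum N -> Prop) :
  P 0 -> (forall x y, P x -> P y -> P (x + y)) -> (forall i (y : N i), P (dinj y)) ->
  forall x, P x.
Proof.
move=> P0 PD Pi x; have [n /dsum_dinj ->] := ds_fin x.
by elim/big_ind: _ => // i _; apply: Pi.
Qed.

Variables (V : lmodType A) (f : forall i, {linear N i -> V}).

Definition dlift (x : dsum N) : V := \sum_(i < sval (cid (ds_fin x))) f i (x i).

Lemma dliftE (x : dsum N) n : (forall j, (n <= j)%N -> x j = 0) -> dlift x = \sum_(i < n) f i (x i).
Proof.
have widen a b : (a <= b)%N -> (forall j, (a <= j)%N -> x j = 0) ->
    \sum_(i < a) f i (x i) = \sum_(i < b) f i (x i).
  move=> ab ha; rewrite -!(big_mkord xpredT (fun i => f i (x i))) [RHS](big_cat_nat (leq0n a) ab) /=.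
  rewrite [X in _ + X]big1_seq ?addr0 // => i; rewrite mem_index_iota => /andP[_ /andP[ai _]].
  by rewrite ha // linear0.
rewrite /dlift; case: cid => m hm hn /=.
by rewrite (widen _ (maxn m n)) ?leq_maxl // -(widen n) ?leq_maxr.
Qed.

Lemma dlift_linear : linear dlift.
Proof.
move=> a x y; have [n hx] := ds_fin x; have [m hy] := ds_fin y.
have hx' j : (maxn n m <= j)%N -> x j = 0 by rewrite geq_max => /andP[/hx].
have hy' j : (maxn n m <= j)%N -> y j = 0 by rewrite geq_max => /andP[_ /hy].
rewrite !(@dliftE _ (maxn n m)) // => [|j hj].
  by rewrite scaler_sumr -big_split; apply: eq_bigr => i _; rewrite /= linearP.
by have -> : (a *: x + y : dsum N) j = a *: x j + y j by []; rewrite hx' // hy' // scaler0 addr0.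
Qed.
HB.instance Definition _ := GRing.isLinear.Build A (dsum N) V _ dlift dlift_linear.

Lemma dlift_dinj i (y : N i) : dlift (dinj y) = f i y.
Proof.
rewrite (@dliftE _ i.+1) => [|j ij]; last by rewrite dinj_out // ltn_eqF.
rewrite (bigD1 ord_max) //= dinj_fun_in big1 ?addr0 // => j /eqP ji.
rewrite dinj_fun_out ?linear0 //; apply/eqP => e; apply: ji; exact/val_inj.
Qed.
End DsumLift.

Section DsumOperator.
Variables (A : pzRingType) (N : nat -> lmodType A).

Lemma dsum_linear_eq (V : lmodType A) (f g : {linear dsum N -> V}) :
  (forall i (y : N i), f (dinj y) = g (dinj y)) -> f =1 g.
Proof.
move=> h; apply: dsum_ind => [|x y hx hy|//]; first by rewrite !lmap0.
by rewrite !lmapD hx hy.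
Qed.
End DsumOperator.

(** * Modules over enveloping algebras *)

Section EnvelopingModules.
Variables (K : fieldType) (L : lieAlg K).

Lemma env_closure (P : env L -> Prop) :
  (forall x, P (env_gen x)) -> P 1 -> (forall u v, P u -> P v -> P (u + v)) ->
  (forall u v, P u -> P v -> P (u * v)) -> (forall a u, P u -> P (a *: u)) ->
  forall u, P u.
Proof.
move=> Pg P1 PD PM PZ; elim/env_ind; elim=> [x|||t IHt u IHu|t IHt|t IHt u IHu|a t IHt] //.
- exact: Pg.
- have -> : env_pi (EZero L) = 0 :> env L by [].
  by rewrite -[0](scale0r 1); apply: PZ.
- have -> : env_pi (EAdd t u) = env_pi t + env_pi u by apply/esym/env_addE.
  exact: PD.
- have -> : env_pi (EOpp t) = - env_pi t by apply/esym/env_oppE.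
  by rewrite -scaleN1r; apply: PZ.
- have -> : env_pi (EMul t u) = env_pi t * env_pi u by apply/esym/env_mulE.
  exact: PM.
- have -> : env_pi (EScale a t) = a *: env_pi t by apply/esym/env_scaleE.
  exact: PZ.
Qed.

(** Evaluating terms of the enveloping algebra directly on [V] bypasses the algebra of endomorphisms
    of [V] that [env_lift] would need as a target. *)
Record lieModule := LieModule {
  lm_car :> lmodType K;
  lm_act : L -> lm_car -> lm_car;
  lm_linr : forall x, linear (lm_act x);
  lm_linl : forall v, linear (lm_act^~ v);
  lm_lie : forall x y v, lm_act (lie x y) v = lm_act x (lm_act y v) - lm_act y (lm_act x v) }.

Section Action.
Variable V : lieModule.

Fixpoint lm_eval (t : env_term L) (v : V) : V :=
  match t with
  | EGen x => lm_act x v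
  | EZero => 0
  | EOne => v
  | EAdd t u => lm_eval t v + lm_eval u v
  | EOpp t => - lm_eval t v
  | EMul t u => lm_eval t (lm_eval u v)
  | EScale a t => a *: lm_eval t v
  end.

Lemma lm_eval_linear t : linear (lm_eval t).
Proof.
elim: t => [x|||t IHt u IHu|t IHt|t IHt u IHu|b t IHt] a v w /=.
- exact: lm_linr.
- by rewrite scaler0 addr0.
- by [].
- by rewrite IHt IHu scalerDr addrACA.
- by rewrite IHt opprD scalerN.
- by rewrite IHu IHt.
- by rewrite IHt scalerDr !scalerA mulrC.
Qed.

Lemma lm_evalD t u v : lm_eval t (u + v) = lm_eval t u + lm_eval t v.
Proof. by rewrite -[u]scale1r lm_eval_linear !scale1r. Qed.
Lemma lm_evalZ a t u : lm_eval t (a *: u) = a *: lm_eval t u.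
Proof.
have t0 : lm_eval t 0 = 0.
  by have := lm_evalD t 0 0; rewrite addr0 => /eqP; rewrite -subr_eq subrr => /eqP.
by rewrite -[a *: u]addr0 lm_eval_linear t0 !addr0.
Qed.

Lemma lm_eval_eq t u : env_eq t u -> lm_eval t =1 lm_eval u.
Proof.
elim=> {t u} //=.
- by move=> t u _ h w; rewrite h.
- by move=> t u v _ h1 _ h2 w; rewrite h1.
- by move=> t t' u u' _ h1 _ h2 w; rewrite h1 h2.
- by move=> t t' _ h w; rewrite h.
- by move=> t t' u u' _ h1 _ h2 w; rewrite h2 h1.
- by move=> a t t' _ h w; rewrite h.
- by move=> t u v w; rewrite addrA.
- by move=> t u w; rewrite addrC.
- by move=> t w; rewrite add0r.
- by move=> t w; rewrite addNr.
- by move=> t u v w; rewrite lm_evalD.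
- by move=> a b t w; rewrite scalerA.
- by move=> t w; rewrite scale1r.
- by move=> a t u w; rewrite scalerDr.
- by move=> a b t w; rewrite scalerDl.
- by move=> a t u w; rewrite lm_evalZ.
- by move=> x y v; rewrite -[x]scale1r lm_linl !scale1r.
- move=> a x v; have x0 : lm_act 0 v = 0.
    have := lm_linl v 1 0 0; rewrite !scale1r addr0 => /eqP.
    by rewrite -subr_eq subrr eq_sym => /eqP.
  by rewrite -[a *: x]addr0 lm_linl x0 addr0.
- by move=> x y v; exact: lm_lie.
Qed.

Definition lm_mod : Type := V.
HB.instance Definition _ := GRing.Zmodule.on lm_mod.

Definition lm_scale (u : env L) (v : lm_mod) : lm_mod := lm_eval (repr u) v.

Lemma lm_scaleE t v : lm_scale (env_pi t) v = lm_eval t v.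
Proof. by apply: lm_eval_eq; apply/env_piP; rewrite env_reprK. Qed.

Lemma lm_scaleA a b v : lm_scale a (lm_scale b v) = lm_scale (a * b) v.
Proof. by elim/env_ind: a => a; elim/env_ind: b => b; rewrite [_ * _]env_mulE !lm_scaleE. Qed.
Lemma lm_scale1 : left_id 1 lm_scale.
Proof. by move=> v; rewrite lm_scaleE. Qed.
Lemma lm_scaleDr : right_distributive lm_scale +%R.
Proof. move=> a u v; exact: lm_evalD. Qed.
Lemma lm_scaleDl v : {morph lm_scale^~ v : a b / a + b}.
Proof.
by move=> a b; elim/env_ind: a => a; elim/env_ind: b => b; rewrite [_ + _ in LHS]env_addE !lm_scaleE.
Qed.

HB.instance Definition _ := GRing.Zmodule_isLmodule.Build (env L) lm_mod
  lm_scaleA lm_scale1 lm_scaleDr lm_scaleDl.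

Lemma lm_scale_gen x (v : V) : env_gen x *: (v : lm_mod) = lm_act x v.
Proof. exact: lm_scaleE. Qed.

Lemma lm_scale_alg a (v : V) : (a%:A : env L) *: (v : lm_mod) = a *: v.
Proof.
have -> : a%:A = env_pi (EScale a (EOne L)) by apply: env_scaleE.
exact: lm_scaleE.
Qed.
End Action.
End EnvelopingModules.

Section SchroedingerModules.
Variable K : fieldType.
Notation U := (U K).

Definition gen (i : sgen) : U := env_gen (sb K i : schr K).

Lemma svec_sum (x : svec K) : x = \sum_i x i *: sb K i.
Proof.
apply/ffunP => j; rewrite sum_ffunE (bigD1 j) //= !ffunE eqxx big1.
  by rewrite addr0 /GRing.scale /= mulr1.
by move=> i /negPf ij; rewrite !ffunE eq_sym ij /GRing.scale /= mulr0.
Qed.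

Lemma env_gen_sum (x : schr K) : env_gen x = \sum_i (x : svec K) i *: gen i.
Proof.
rewrite {1}[x]svec_sum (linear_sum (@env_gen K (schr K))).
by apply: eq_bigr => i _; rewrite [LHS]linearZ.
Qed.

Lemma U_closure (P : U -> Prop) :
  (forall i, P (gen i)) -> P 1 -> (forall u v, P u -> P v -> P (u + v)) ->
  (forall u v, P u -> P v -> P (u * v)) -> (forall a u, P u -> P (a *: u)) ->
  forall u, P u.
Proof.
move=> Pg P1 PD PM PZ; apply: env_closure => // x; rewrite env_gen_sum.
elim/big_ind: _ => [|//|i _]; last exact: PZ.
by rewrite -[0](scale0r 1); apply: PZ.
Qed.

Section Operators.
Variable M : lmodType U.
Definition op (i : sgen) (v : vect M) : vect M := gen i *: (v : M).

Lemma alg_scaleC a (u : U) (v : M) : u *: (a%:A *: v) = a%:A *: (u *: v).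
Proof. by rewrite !scalerA -scalerAr -scalerAl mulr1 mul1r. Qed.

Lemma vect_scaleE a (v : vect M) : a *: v = (a%:A : U) *: (v : M).
Proof. by []. Qed.
Lemma alg_scale_mul a (u : U) (v : M) : (a *: u) *: v = a%:A *: (u *: v).
Proof. by rewrite scalerA -scalerAl mul1r. Qed.

Lemma op_linear i : linear (op i).
Proof.
move=> a u v; rewrite /op !vect_scaleE.
by rewrite [LHS](@scalerDr _ M) alg_scaleC.
Qed.
HB.instance Definition _ i := GRing.isLinear.Build K (vect M) (vect M) _ (op i) (@op_linear i).
Lemma op0 i : op i 0 = 0. Proof. exact: lmap0. Qed.
Lemma opD i u v : op i (u + v) = op i u + op i v. Proof. exact: lmapD. Qed.
Lemma opN i u : op i (- u) = - op i u. Proof. exact: lmapN. Qed.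
Lemma opZ i a u : op i (a *: u) = a *: op i u. Proof. exact: lmapZ. Qed.
Definition opE := (op0, opD, opN, opZ).

Lemma op_comm i j v : op i (op j v) - op j (op i v) = env_gen (bracket_table K i j : schr K) *: (v : M).
Proof.
have -> : bracket_table K i j = lie (sb K i : schr K) (sb K j).
  rewrite [lie _ _]/(sbracket _ _) /sbracket (bigD1 i) //= (bigD1 j) //= !ffunE !eqxx.
  rewrite mulr1 scale1r [X in _ = _ + X + _]big1 ?addr0 => [|k /negPf kj]; last first.
    by rewrite !ffunE kj mulr0 scale0r.
  by rewrite big1 ?addr0 // => k /negPf ki; rewrite big1 // => l _; rewrite !ffunE ki mul0r scale0r.
by rewrite env_gen_lie scalerBl -!scalerA.
Qed.

Lemma submod_of_ops (S : M -> Prop) : S 0 -> (forall u v, S u -> S v -> S (u + v)) ->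
  (forall a u, S u -> S (a%:A *: u)) -> (forall i u, S u -> S (gen i *: u)) ->
  S 0 /\ forall (a : U) u v, S u -> S v -> S (a *: u + v).
Proof.
move=> S0 SD SZ Sg; split=> // a u v Su; apply: (SD); move: u Su.
elim/U_closure: a => [i||a b ha hb|a b ha hb|b a ha] u Su.
- exact: Sg.
- by rewrite scale1r.
- by rewrite scalerDl; apply: SD; [exact: ha|exact: hb].
- by rewrite -scalerA; apply/ha/hb.
- by rewrite (alg_scale_mul b a u); apply/SZ/ha.
Qed.
End Operators.

Section LinearOfOps.
Variables (M N : lmodType U) (f : {linear vect M -> vect N}).
Hypothesis f_op : forall i v, f (op i v) = op i (f v).

Lemma U_linear_of_ops : exists g : {linear M -> N}, forall v, g v = f v.
Proof.
have fU (u : U) (v : M) : f (u *: v) = u *: (f v : N).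
  move: v; elim/U_closure: u => [i||u w hu hw|u w hu hw|a u hu] v.
  - exact: f_op.
  - by rewrite !scale1r.
  - by rewrite !scalerDl -hu -hw; exact: (lmapD f).
  - by rewrite -!scalerA hu hw.
  - by rewrite (alg_scale_mul a u v) (alg_scale_mul a u (f v : N)) -hu; exact: (lmapZ f a (u *: v)).

have g_lin : linear (f : M -> N).
  by move=> a u v; rewrite -fU; exact: (lmapD f).
by exists (HB.pack_for {linear M -> N} (f : M -> N) (GRing.isLinear.Build U M N _ (f : M -> N) g_lin)).
Qed.
End LinearOfOps.

Section VectMap.
Variables (M N : lmodType U) (f : {linear M -> N}).
Definition vmap (v : vect M) : vect N := f v.
Lemma vmap_linear : linear vmap.
Proof. by move=> a u v; rewrite /vmap !vect_scaleE; exact: linearP. Qed.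
HB.instance Definition _ := GRing.isLinear.Build K (vect M) (vect N) _ vmap vmap_linear.
End VectMap.

End SchroedingerModules.

Section Eigenvectors.
Variables (K : fieldType) (V : lmodType K) (I : eqType) (T1 T2 : {linear V -> V}).
Variables (x1 x2 : I -> K).
Hypothesis x_inj : forall i j, x1 i = x1 j -> x2 i = x2 j -> i = j.

(** The operator T - x j kills [w j] and multiplies every other [w i] by x i - x j, so the remaining
    terms fall under induction; for [i] other than [j], T1 or T2 gives a nonzero factor. Two
    operators appear because a weight has two coordinates, at h and at z. *)
Lemma eigen_separation (S : submod V) (s : seq I) (w : I -> V) :
  (forall v, S v -> S (T1 v)) -> (forall v, S v -> S (T2 v)) ->
  (forall i, T1 (w i) = x1 i *: w i) -> (forall i, T2 (w i) = x2 i *: w i) ->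
  uniq s -> S (\sum_(i <- s) w i) -> forall i, i \in s -> S (w i).
Proof.
have [S0 SD] := sm_closed S; move=> ST1 ST2.
have SZ a v : S v -> S (a *: v) by move=> hv; rewrite -[_ *: _]addr0; apply: SD.
have SA u v : S u -> S v -> S (u + v) by move=> hu hv; rewrite -[u]scale1r; apply: SD.
have SN v : S v -> S (- v) by move=> hv; rewrite -scaleN1r; apply: SZ.
elim: s w => // j s IH w h1 h2 /= /andP[js us]; rewrite big_cons => hS.
have sep (T : {linear V -> V}) x : (forall v, S v -> S (T v)) ->
    (forall i, T (w i) = x i *: w i) -> forall i, i \in s -> S ((x i - x j) *: w i).
  move=> ST hT; apply: IH => // [i|i|].
  - by rewrite lmapZ h1 !scalerA mulrC.
  - by rewrite lmapZ h2 !scalerA mulrC.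
  have -> : \sum_(i <- s) (x i - x j) *: w i
    = T (w j + \sum_(i <- s) w i) + - x j *: (w j + \sum_(i <- s) w i).
    rewrite lmapD hT scaleNr scalerDr opprD addrACA subrr add0r (linear_sum T) scaler_sumr -sumrB.
    by apply: eq_bigr => i _; rewrite hT scalerBl.
  by apply: SA; [exact: ST|exact: SZ].
have Sw i : i \in s -> S (w i).
  move=> hi; have ij : i <> j by move=> e; move: js; rewrite -e hi.
  have [d1|/eqP d1] := eqVneq (x1 i) (x1 j); last first.
    have := SZ (x1 i - x1 j)^-1 _ (sep T1 x1 ST1 h1 i hi).
    by rewrite scalerA mulVf ?scale1r // subr_eq0; apply/eqP.
  have [d2|/eqP d2] := eqVneq (x2 i) (x2 j); first by case: ij; apply: x_inj.
  have := SZ (x2 i - x2 j)^-1 _ (sep T2 x2 ST2 h2 i hi).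
  by rewrite scalerA mulVf ?scale1r // subr_eq0; apply/eqP.
move=> i; rewrite in_cons => /orP[/eqP ->|]; last exact: Sw.
rewrite -[w j](addrK (\sum_(i <- s) w i)); apply: (SA) => //; apply: SN.
rewrite big_seq; apply: (big_ind S) => //.
Qed.
End Eigenvectors.

Section GradedSpaces.
Variables (K : numFieldType).

Definition graded_sum (V : lmodType K) (G : int -> submod V) (v : V) : Prop :=
  exists s w, [/\ uniq s, forall n, G n (w n), forall n, n \notin s -> w n = 0
              & v = \sum_(n <- s) w n].

Section GradedSum.
Variables (V : lmodType K) (G : int -> submod V).

Lemma graded_sumP v : lspan (fun w => exists n, G n w) v -> graded_sum G v.
Proof.
elim=> [|a u v' [n hu] _ [s [w [us hw hs ->]]]].
  by exists [::], (fun=> 0); split=> //; [move=> n; exact: (sm_closed (G n)).1|rewrite big_nil].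
exists (undup (n :: s)), (fun m => (if m == n then a *: u else 0) + w m); split.
- exact: undup_uniq.
- move=> m; case: eqP => [->|_]; first exact: (sm_closed (G n)).2.
  by rewrite add0r.
- by move=> m; rewrite mem_undup in_cons negb_or => /andP[/negPf -> /hs ->]; rewrite addr0.
have [r rE] : exists r, r = undup (n :: s) by exists (undup (n :: s)).
rewrite -rE big_split /=; congr (_ + _).
  rewrite (bigD1_seq n) /=; [|by rewrite rE mem_undup mem_head|by rewrite rE undup_uniq].
  rewrite eqxx big1 ?addr0 //.
  by move=> m /negPf ->.
rewrite rE /=; case: ifP => hn; rewrite (undup_id us) // big_cons hs ?add0r //.
by rewrite hn.
Qed.

Lemma graded_sum_mem v n : graded_sum G v ->
  exists s w, [/\ uniq s, n \in s, forall n, G n (w n) & v = \sum_(n <- s) w n].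
Proof.
move=> [s [w [us hw hs ->]]].
have [ns|ns] := boolP (n \in s); first by exists s, w.
exists (n :: s), w; split; rewrite /= ?ns ?mem_head //.
by rewrite big_cons hs // add0r.
Qed.
End GradedSum.

Section GradedMaps.
Variables (V : lmodType K) (G : int -> submod V) (T : {linear V -> V}) (t : K).
Hypothesis GT : forall n v, G n v -> T v = (n%:~R + t) *: v.

Lemma graded_separation (S : submod V) (s : seq int) (w : int -> V) :
  (forall v, S v -> S (T v)) -> (forall n, G n (w n)) ->
  uniq s -> S (\sum_(n <- s) w n) -> forall n, n \in s -> S (w n).
Proof.
move=> ST hw; apply: (@eigen_separation K V int T T (fun n => n%:~R + t) (fun n => n%:~R + t)) => //.
- by move=> i j /addIr /intr_inj.
- by move=> n; apply: GT.
- by move=> n; apply: GT.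
Qed.

Lemma graded_nonzero (S : submod V) v :
  (forall v, S v -> S (T v)) -> graded_sum G v -> S v -> v <> 0 ->
  exists n w, [/\ G n w, S w & w <> 0].
Proof.
move=> ST [s [w [us hw hs hv]]] Sv v0.
have Sw := graded_separation ST hw us; rewrite -hv in Sw.
have [h|h] := pselect (exists2 n, n \in s & w n <> 0).
  by have [n ns wn] := h; exists n, (w n); split=> //; apply: Sw.
case: v0; rewrite hv big_seq big1 // => n ns; apply/notP => wn; apply: h; by exists n.
Qed.

(** The preimage is the degree [n] component of [v]: the images of the components, less [f v] in
    degree [n], have distinct degrees and add up to zero, so each of them vanishes. *)
Lemma graded_lift (V0 : lmodType K) (G0 : int -> submod V0) (f : {linear V0 -> V}) (d : int) n v :
  (forall n v, G0 n v -> G (n + d) (f v)) -> graded_sum G0 v -> G (n + d) (f v) ->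
  exists2 w, G0 n w & f w = f v.
Proof.
move=> fG /(graded_sum_mem n)[s [w [us ns hw hv]]] hfv; exists (w n) => //.
have S0cl : (0 : V) = 0 /\ forall (a : K) (u v : V), u = 0 -> v = 0 -> a *: u + v = 0.
  by split=> // a u u' -> ->; rewrite scaler0 addr0.
have GT' m u : G (m + d) u -> T u = ((m + d)%:~R + t) *: u by apply: GT.
have fw m : G (m + d) (f (w m) - (if m == n then f v else 0)).
  have [G0' GD] := sm_closed (G (m + d)).
  have -> u : f (w m) - u = (-1) *: u + f (w m) by rewrite scaleN1r addrC.
  by apply: GD; [case: eqP => [->|]|exact: fG].
have := @eigen_separation K V int T T (fun n => (n + d)%:~R + t) (fun n => (n + d)%:~R + t) _
   (Submod S0cl) s (fun m => f (w m) - (if m == n then f v else 0)) _ _ _ _ us _ n ns.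
rewrite /= eqxx => h; apply/eqP; rewrite -subr_eq0; apply/eqP; apply: h => /=.
- by move=> i j /addIr /intr_inj /addIr.
- by move=> ? ->; rewrite lmap0.
- by move=> ? ->; rewrite lmap0.
- by move=> m; apply: (GT' m).
- by move=> m; apply: (GT' m).
rewrite sumrB -(linear_sum f) -hv (bigD1_seq n) //= eqxx big1 ?addr0 ?subrr //.
by move=> m /negPf ->.
Qed.
End GradedMaps.
End GradedSpaces.

(** * Weights and category O *)

Section Commutators.
Variables (K : fieldType) (M : lmodType (U K)).
Implicit Types v : vect M.

Lemma op_commE i j v : op i (op j v) = op j (op i v)
  + \sum_k (bracket_table K i j) k *: op k v.
Proof.
have := op_comm i j v; rewrite (env_gen_sum (bracket_table K i j)) scaler_suml => /eqP.
rewrite subr_eq addrC => /eqP ->; congr (_ + _); apply: eq_bigr => k _.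
exact: alg_scale_mul.
Qed.

Lemma op_ef v : op sE (op sF v) = op sF (op sE v) + op sH v.
Proof.
rewrite op_commE sgen_sum !ffunE /=.
by rewrite !scale0r scale1r !addr0 !add0r.
Qed.
Lemma op_ep v : op sE (op sP v) = op sP (op sE v).
Proof. by rewrite op_commE sgen_sum !ffunE /= !scale0r !addr0. Qed.
Lemma op_eq v : op sE (op sQ v) = op sQ (op sE v) + op sP v.
Proof. by rewrite op_commE sgen_sum !ffunE /= !scale0r scale1r !addr0 !add0r. Qed.
Lemma op_fp v : op sF (op sP v) = op sP (op sF v) + op sQ v.
Proof. by rewrite op_commE sgen_sum !ffunE /= !scale0r scale1r !addr0 !add0r. Qed.
Lemma op_fq v : op sF (op sQ v) = op sQ (op sF v).
Proof. by rewrite op_commE sgen_sum !ffunE /= !scale0r !addr0. Qed.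
Lemma op_pq v : op sP (op sQ v) = op sQ (op sP v) + op sZ v.
Proof. by rewrite op_commE sgen_sum !ffunE /= !scale0r scale1r !add0r. Qed.
Lemma op_z i v : op sZ (op i v) = op i (op sZ v).
Proof. by rewrite op_commE sgen_sum; case: i; rewrite !ffunE /= !scale0r !addr0. Qed.

Definition deg (i : sgen) : int :=
  match i with sE => 2 | sF => -2 | sP => 1 | sQ => -1 | _ => 0 end.

Lemma op_h i v : op sH (op i v) = op i (op sH v) + (deg i)%:~R *: op i v.
Proof.
rewrite op_commE sgen_sum; congr (_ + _).
have sZE (a : K) (x : svec K) k : (a *: x) k = a * x k by rewrite ffunE.
have sNE (x : svec K) k : (- x) k = - x k by rewrite ffunE.
have s0E k : (0 : svec K) k = 0 by rewrite ffunE.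
by case: i; rewrite /bracket_table ?(sZE, sNE, s0E, ffunE) /= ?mulr1 ?mulr0 ?oppr0 ?scale0r ?addr0 ?add0r
  ?mulr1z ?mulrN1z ?mulr0z ?scale0r ?scale1r.
Qed.
End Commutators.

Section Weights.
Variables (K : numFieldType) (c : K).

(* lambda_n, for n in Z: in this indexing r . lambda_n = lambda_(-n). *)
Definition wt (n : int) : weight K := (n%:~R - 3 / 2, c).

Lemma wt_inj : injective wt.
Proof. by move=> m n [] /addIr /intr_inj. Qed.

Lemma dot_refl_wt n : dot_refl (wt n) = wt (- n).
Proof.
rewrite dot_reflE ?pnatr_eq0 // /wt /=.
have -> : - (n%:~R - 3 / 2) - 3 = (- n)%:~R - 3 / 2 :> K by rewrite mulrNz; field.
by [].
Qed.

Section Graded.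
Variable M : lmodType (U K).
Implicit Types v : vect M.

Lemma is_wt_vecE lam v :
  is_wt_vec lam (v : M) <-> op sH v = lam.1 *: v /\ op sZ v = lam.2 *: v.
Proof.
split=> [h|[hH hZ] x hx].
  have ev i : i \in [set sH; sZ] -> op i v = wt_eval lam (sb K i) *: v.
    move=> hi; apply: (h (sb K i)) => j hj; rewrite ffunE; case: eqP => // e.
    by rewrite e hi in hj.
  split; rewrite ev ?inE // /wt_eval !ffunE /= ?mulr1 ?mulr0 ?addr0 ?add0r //.
rewrite env_gen_sum sgen_sum.
have x0 i : i \notin [set sH; sZ] -> (x : svec K) i = 0 := hx i.
rewrite !(x0 sE, x0 sF, x0 sP, x0 sQ) ?inE //.
rewrite !scale0r !add0r scalerDl.
have E a i : (a *: gen K i) *: (v : M) = a *: op i v := alg_scale_mul a _ v.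
rewrite [LHS](f_equal2 +%R (E _ _) (E _ _)) hH hZ.
transitivity (wt_eval lam x *: v); last by [].
by rewrite /wt_eval (@scalerDl K (vect M)) !(@scalerA K (vect M)) [_ * lam.1]mulrC [_ * lam.2]mulrC.
Qed.

Definition gr (n : int) : submod (vect M) := wt_space (wt n) M.

Lemma grE n v : gr n v <-> op sH v = (n%:~R - 3 / 2) *: v /\ op sZ v = c *: v.
Proof. exact: is_wt_vecE. Qed.

Lemma gr_op i n m v : gr n v -> m = n + deg i -> gr m (op i v).
Proof.
move=> /grE[hH hZ] ->; apply/grE; rewrite op_h op_z hH hZ !opZ; split=> //.
by rewrite -scalerDl rmorphD /=; congr (_ *: _); ring.
Qed.

Definition gradable : Prop := forall v, lspan (fun w => exists n, gr n w) v.

(** All words of length [D] in e and p kill [v]. This elementary form of the condition on U(n_+)v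
    passes easily to sums and images. *)
Fixpoint killed (D : nat) v : Prop :=
  if D is D'.+1 then killed D' (op sE v) /\ killed D' (op sP v) else v = 0.

Lemma killedP D a u v : killed D u -> killed D v -> killed D (a *: u + v).
Proof.
elim: D u v => [|D IH] u v /=; first by move=> -> ->; rewrite scaler0 addr0.
by move=> [h1 h2] [h3 h4]; rewrite !opD !opZ; split; apply: IH.
Qed.
Lemma killed0 D : killed D 0.
Proof. by elim: D => //= D IH; rewrite !op0. Qed.
Lemma killed_leq D D' v : (D <= D')%N -> killed D v -> killed D' v.
Proof.
elim: D D' v => [|D IH] [|D'] v //=; first by move=> _ ->; rewrite !op0; split; exact: killed0.
by rewrite ltnS => h [h1 h2]; split; apply: IH.
Qed.

Definition nilp : Prop := forall v, exists D, killed D v.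

(** The images of [v] under words of length less than [D] in e and p. Each vector is listed after
    its own images under e and p; [filtered_orb] relies on this order. *)
Fixpoint orb (D : nat) v : seq (vect M) :=
  if D is D'.+1 then orb D' (op sE v) ++ orb D' (op sP v) ++ [:: v] else [::].

Lemma orb_id D v : v \in orb D.+1 v.
Proof. by rewrite /= !mem_cat inE eqxx !orbT. Qed.

Lemma orb_killed D v i : killed D v -> i = sE \/ i = sP ->
  forall x, x \in orb D v -> lspan (listed (orb D v)) (op i x).
Proof.
move=> + hi; elim: D v => [//|D IH] v /= [hE hP] x.
have mono s u : {subset s <= orb D.+1 v} -> lspan (listed s) u -> lspan (listed (orb D.+1 v)) u.
  by move=> ss; apply: lspan_mono => y hy; apply/lspan_incl/ss.
have sE1 : {subset orb D (op sE v) <= orb D.+1 v} by move=> y hy; rewrite /= !mem_cat hy.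
have sP1 : {subset orb D (op sP v) <= orb D.+1 v} by move=> y hy; rewrite /= !mem_cat hy orbT.
have hd j : killed D (op j v) -> lspan (listed (orb D (op j v))) (op j v).
  case: (D) => [/= ->|D' _]; first exact: lspan0.
  by apply/lspan_incl/orb_id.
rewrite !mem_cat inE => /orP[hx|/orP[hx|/eqP ->]].
- by apply: mono sE1 _; apply: IH.
- by apply: mono sP1 _; apply: IH.
by case: hi => ->; [apply: mono sE1 _|apply: mono sP1 _]; apply: hd.
Qed.

Lemma gradable_z v : gradable -> op sZ v = c *: v.
Proof.
move=> /(_ v); elim=> [|a u w [n /grE[_ hu]] _ hw]; first by rewrite op0 scaler0.
by rewrite opD opZ hu hw scalerDr !scalerA mulrC.
Qed.

Lemma gr_h n v : gr n v -> op sH v = (n%:~R + - (3 / 2)) *: v.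
Proof. by case/grE. Qed.

Lemma sub0_closed (V : lmodType K) : (0 : V) = 0 /\
  forall (a : K) (u v : V), u = 0 -> v = 0 -> a *: u + v = 0.
Proof. by split=> // a u v -> ->; rewrite scaler0 addr0. Qed.

(** The eigenspace of h for [lam.1] is stable under h, so it contains a nonzero homogeneous vector,
    whose degree is the required [n]. *)
Lemma wt_vec_gr lam v : gradable -> v <> 0 -> is_wt_vec lam (v : M) -> exists n, lam = wt n.
Proof.
move=> gM v0 /is_wt_vecE[hH hZ].
have Scl' : op sH 0 = lam.1 *: (0 : vect M) /\ forall a (u w : vect M),
    op sH u = lam.1 *: u -> op sH w = lam.1 *: w -> op sH (a *: u + w) = lam.1 *: (a *: u + w).
  split=> [|a u w hu hw]; first by rewrite op0 scaler0.
  by rewrite opD opZ hu hw scalerDr !scalerA mulrC.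
have [|||n [w [hw Sw w0]]] := graded_nonzero gr_h (S := Submod Scl') _ _ _ v0.
- by move=> u /= hu; rewrite hu opZ hu.
- exact/graded_sumP/gM.
- exact: hH.
exists n; have /grE[hw1 _] := hw.
have zc : op sZ v = c *: v := gradable_z v gM.
have scI (a b : K) (u : vect M) : u <> 0 -> a *: u = b *: u -> a = b.
  move=> u0 /eqP; rewrite -subr_eq0 -scalerBl scaler_eq0 subr_eq0 => /orP[/eqP//|/eqP//].
rewrite /wt [lam]surjective_pairing; congr pair.
  by apply: (scI _ _ w) => //; rewrite -hw1; symmetry; exact: Sw.
by apply: (scI _ _ v) => //; rewrite -hZ.
Qed.

Lemma weight_indep n (mu : 'I_n -> weight K) (w : 'I_n -> M) : injective mu ->
  (forall i, is_wt_vec (mu i) (w i)) -> \sum_(i < n) w i = 0 -> forall i, w i = 0.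
Proof.
move=> muI hw hs i.
apply: (@eigen_separation K (vect M) 'I_n (op sH) (op sZ) (fun i => (mu i).1) (fun i => (mu i).2)
  _ (Submod (sub0_closed (vect M))) (index_enum 'I_n) w) => //=.
- move=> j k h1 h2; apply: muI; rewrite [mu j]surjective_pairing h1 h2; exact/esym/surjective_pairing.
- by move=> v ->; rewrite op0.
- by move=> v ->; rewrite op0.
- by move=> j; have /is_wt_vecE[] := hw j.
- by move=> j; have /is_wt_vecE[] := hw j.
- exact: index_enum_uniq.
- exact: mem_index_enum.
Qed.

End Graded.
End Weights.

Section CategoryO.
Variables (K : numFieldType) (c : K) (M : lmodType (U K)).
Implicit Types v : vect M.
Notation gr := (gr c M).
Notation wt := (wt c).

Lemma sb_nplus i : i = sE \/ i = sP -> (sb K i : schr K) \in sm_pred (nplus K).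
Proof.
move=> hi; apply/sm_predP => j hj; rewrite ffunE; case: eqP => // e.
by move: hj; rewrite e !inE; case: hi => ->.
Qed.

Lemma nplus_orbit_op i v w : i = sE \/ i = sP -> nplus_orbit v w -> nplus_orbit v (op i w).
Proof.
move=> hi [u ->]; exists (env_gen (Subm (sb_nplus hi) : nplusL K) * u).
by rewrite rmorphM -scalerA /= env_lift_gen.
Qed.

Lemma nplus_orbit_sub (S : submod (vect M)) v :
  S v -> (forall w, S w -> S (op sE w) /\ S (op sP w)) -> forall w, nplus_orbit v w -> S w.
Proof.
move=> Sv hS w [u ->]; have [S0 SD] := sm_closed S.
move: v Sv; elim/env_closure: u => [x||a b ha hb|a b ha hb|a b hb] v Sv.
- rewrite /= env_lift_gen /= /sub_incl env_gen_sum sgen_sum.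
  have xN : nplus K (sm_val x) by apply/sm_predP/sm_valP.
  have x0 i : i \notin [set sE; sP] -> (sm_val x : svec K) i = 0 := xN i.
  rewrite !(x0 sH, x0 sF, x0 sQ, x0 sZ) ?inE // !scale0r !add0r addr0 scalerDl.
  have [h1 h2] := hS _ Sv; have h3 := SD (sm_val x sP) _ _ h2 S0; rewrite addr0 in h3.
  have := SD (sm_val x sE) _ _ h1 h3; congr (S _).
  by symmetry; apply: (f_equal2 +%R (alg_scale_mul _ _ _) (alg_scale_mul _ _ _)).
- by rewrite rmorph1 scale1r.
- by have := SD 1 _ _ (ha v Sv) (hb v Sv); rewrite scale1r rmorphD scalerDl.
- by rewrite rmorphM -scalerA; apply/ha/hb.
- have := SD a _ _ (hb v Sv) S0; rewrite addr0 linearZ /=; congr (S _).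
  exact/esym/alg_scale_mul.
Qed.

Lemma orbit_fin_dim D v : killed D v -> fin_dim (nplus_orbit v).
Proof.
move=> hD; apply/fin_dimP; exists (orb D v) => w.
apply: (nplus_orbit_sub (S := span_submod (listed (orb D v)))) => /=.
  by case: D hD => [-> |D _]; [exact: lspan0|apply/lspan_incl/orb_id].
have cl i : i = sE \/ i = sP -> forall w, lspan (listed (orb D v)) w -> lspan (listed (orb D v)) (op i w).
  by move=> hi; move=> u; apply: (lspan_map (f := op i)) => x; apply: orb_killed.
by move=> u hu; split; apply: cl => //; [left|right].
Qed.

(** Some word of length [D] does not kill [v], and each of its letters raises the degree by 1 or
    2. *)
Lemma not_killed_word D n v : gr n v -> ~ killed D v ->
  exists m x, [/\ (n + D%:Z <= m)%R, gr m x, nplus_orbit v x & x <> 0].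
Proof.
move=> hv; have : nplus_orbit v v by exists 1; rewrite rmorph1 scale1r.
elim: D n {1 3 4}v hv => [|D IH] n w hw ow /= hk.
  by exists n, w; split => //; lia.
have step i : i = sE \/ i = sP -> ~ killed D (op i w) ->
    exists m x, [/\ (n + D.+1%:Z <= m)%R, gr m x, nplus_orbit v x & x <> 0].
  move=> hi hk'; have [||m [x [h1 h2 h3 h4]]] := IH (n + deg i) (op i w) _ _ hk'.
  - exact: gr_op hw erefl.
  - exact: nplus_orbit_op.
  exists m, x; split => //; apply: le_trans h1.
  by case: hi => -> /=; rewrite -addrA; apply: lerD => //; lia.
have [h1|h1] := pselect (killed D (op sE w)); last by apply: step h1; left.
by apply: (step sP); [right|move=> h2; apply: hk].
Qed.

(** Otherwise the orbit has nonzero vectors in arbitrarily high degrees. Choosing one more of them,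
    in distinct degrees, than the spanning list is long contradicts the independence of weight
    vectors. *)
Lemma fin_dim_orbit_killed n v : gr n v -> fin_dim (nplus_orbit v) -> exists D, killed D v.
Proof.
move=> hv /fin_dimP [s hs]; apply/notP => hD.
have /choice [f hf] (B : nat) : exists mx : int * vect M,
    [/\ (n + B%:Z <= mx.1)%R, gr mx.1 mx.2, nplus_orbit v mx.2 & mx.2 <> 0].
  have [|m [x h]] := @not_killed_word B n v hv; last by exists (m, x).
  by move=> h; apply: hD; exists B.
(* If d is the degree of [f (B k)], then that of [f (B k.+1)] is at least n + |d - n| + 1 > d, so
   the degrees increase strictly. *)
pose B := fix B k := if k is k'.+1 then `|(f (B k')).1 - n|.+1%N else 0%N.
have Bmono k : ((f (B k)).1 < (f (B k.+1)).1)%R.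
  by have [h _ _ _] := hf (B k.+1); apply: lt_le_trans h; rewrite /=; lia.
have dI : injective (fun i : 'I_(size s).+1 => (f (B i)).1).
  have mono j k : (j < k)%N -> ((f (B j)).1 < (f (B k)).1)%R.
    elim: k => // k IH; rewrite ltnS leq_eqVlt => /orP[/eqP ->//|/IH h]; exact: lt_trans (Bmono k).
  move=> i j /= e; apply: val_inj => /=; case: (ltngtP i j) => // /mono; by rewrite e ltxx.
have [|i|u [i ui] us] := @dependent_list K (vect M) s (size s).+1 (fun i => (f (B i)).2).
- by [].
- by apply: hs; have [] := hf (B i).
have /eqP : u i *: (f (B i)).2 = 0.
  apply: (@weight_indep K M _ (fun i => wt (f (B i)).1) (fun i => u i *: (f (B i)).2) _ _ us i).
    by move=> j k /wt_inj; apply: dI.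
  move=> j; have [_ hx _ _] := hf (B j).
  by have := (sm_closed (gr _)).2 (u j) _ 0 hx (sm_closed _).1; rewrite addr0.
by have [_ _ _ x0] := hf (B i); rewrite scaler_eq0 (negPf ui) => /eqP.
Qed.

Definition xi_c : set (weight K) := [set mu | exists n, mu = wt n]%classic.

(** Directness of the sum of weight spaces is [weight_indep], and the support condition says that
    only the weights [wt n] occur; what is left of membership in O[xi] are three properties that are
    easy to transfer. *)
Lemma O_xiP : O_xi xi_c M <-> [/\ fin_generated M, gradable c M & nilp M].
Proof.
split=> [[[fg [wM _] fo] hs]|[fg gM nM]].
  have gM : gradable c M.
    move=> v; have [n [mu [w [hw ->]]]] := wM v; apply: lspan_sum => i _.
    have [->|/eqP w0] := eqVneq (w i) 0; first exact: lspan0.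
    have [|m hm] := hs (mu i); first by exists (w i).
    by apply: lspan_incl; exists m; rewrite /= -hm.
  split=> // v; have := gM v; elim=> [|a u w [n hu] _ [D hD]]; first by exists 0%N.
  have [D' hD'] := fin_dim_orbit_killed hu (fo u).
  by exists (maxn D' D); apply: killedP; [apply: killed_leq hD'|apply: killed_leq hD];
    rewrite ?leq_maxl ?leq_maxr.
split; last first.
  by move=> lam [v [hv v0]]; have [n ->] := wt_vec_gr gM v0 hv; exists n.
split=> //; last by move=> v; have [D hD] := nM v; exact: orbit_fin_dim hD.
split; last by move=> n mu w muI hw hs; exact: weight_indep muI hw hs.
move=> v; have [s [w [us hw _ hv]]] := graded_sumP (gM v).
exists (size s), (fun i => wt (nth 0 s i)), (fun i => w (nth 0 s i)); split.
  by move=> i; exact: hw.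
by rewrite hv (big_nth 0) big_mkord.
Qed.
End CategoryO.

(** * The sl2-triple commuting with p and q *)

Definition linE (K : pzRingType) (V W : lmodType K) (f : {linear V -> W}) :=
  (lmap0 f, lmapD f, lmapN f, lmapZ f).

Section Casimir.
Variables (K : numFieldType) (V : lmodType K) (E F H : {linear V -> V}).

Definition cas (v : V) : V := 4 *: F (E v) + H (H v) + 2 *: H v + v.

Lemma cas_linear : linear cas.
Proof. by move=> a u v; rewrite /cas !(linE E, linE F, linE H); lmod K V; ring. Qed.

Lemma cas_comm (p : {linear V -> V}) v : (forall v, E (p v) = p (E v)) ->
  (forall v, F (p v) = p (F v)) -> (forall v, H (p v) = p (H v)) -> cas (p v) = p (cas v).
Proof. by move=> Ep Fp Hp; rewrite /cas !(Ep, Fp, Hp, linE p). Qed.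

Hypothesis EF : forall v, E (F v) = F (E v) + H v.
Hypothesis HE : forall v, H (E v) = E (H v) + 2 *: E v.
Hypothesis HF : forall v, H (F v) = F (H v) - 2 *: F v.

Lemma cas_E v : cas (E v) = E (cas v).
Proof. by rewrite /cas !(EF, HE, linE E, linE F, linE H); lmod K V; ring. Qed.
Lemma cas_F v : cas (F v) = F (cas v).
Proof. by rewrite /cas !(EF, HF, linE E, linE F, linE H); lmod K V; ring. Qed.
Lemma cas_H v : cas (H v) = H (cas v).
Proof. by rewrite /cas !(HE, HF, linE E, linE F, linE H); lmod K V; ring. Qed.
End Casimir.

Section Sl2Triple.
Variables (K : numFieldType) (c : K) (M : lmodType (U K)).
Implicit Types v : vect M.
Notation e := (op sE). Notation f := (op sF). Notation h := (op sH).
Notation p := (op sP). Notation q := (op sQ).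

(* When z acts by c != 0, the quadratic elements p^2, q^2 and qp + c/2, suitably scaled, form an
   sl2-triple acting on p, q as e, f, h do; subtracting it leaves a triple commuting with p, q. *)
Definition oE v : vect M := e v - (2 * c)^-1 *: p (p v).
Definition oF v : vect M := f v + (2 * c)^-1 *: q (q v).
Definition oH v : vect M := h v + c^-1 *: q (p v) + 2^-1 *: v.
Definition casimir v : vect M := 4 *: oF (oE v) + oH (oH v) + 2 *: oH v + v.

Lemma oE_linear : linear oE.
Proof. by move=> a u v; rewrite /oE !opE; lmod K (vect M); ring. Qed.
HB.instance Definition _ := GRing.isLinear.Build K (vect M) (vect M) _ oE oE_linear.
Lemma oF_linear : linear oF.
Proof. by move=> a u v; rewrite /oF !opE; lmod K (vect M); ring. Qed.
HB.instance Definition _ := GRing.isLinear.Build K (vect M) (vect M) _ oF oF_linear.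
Lemma oH_linear : linear oH.
Proof. by move=> a u v; rewrite /oH !opE; lmod K (vect M); ring. Qed.
HB.instance Definition _ := GRing.isLinear.Build K (vect M) (vect M) _ oH oH_linear.

Lemma oE0 : oE 0 = 0. Proof. exact: lmap0. Qed.
Lemma oED u v : oE (u + v) = oE u + oE v. Proof. exact: lmapD. Qed.
Lemma oEZ a u : oE (a *: u) = a *: oE u. Proof. exact: lmapZ. Qed.
Lemma oF0 : oF 0 = 0. Proof. exact: lmap0. Qed.
Lemma oFD u v : oF (u + v) = oF u + oF v. Proof. exact: lmapD. Qed.
Lemma oFZ a u : oF (a *: u) = a *: oF u. Proof. exact: lmapZ. Qed.
Lemma oHZ a u : oH (a *: u) = a *: oH u. Proof. exact: lmapZ. Qed.

Lemma casimir_linear : linear casimir.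
Proof. exact: (cas_linear oE oF oH). Qed.
HB.instance Definition _ := GRing.isLinear.Build K (vect M) (vect M) _ casimir casimir_linear.

Hypothesis c0 : c != 0.
Hypothesis zc : forall v, op sZ v = c *: v.

Lemma op_pf v : p (f v) = f (p v) - q v. Proof. by rewrite op_fp addrK. Qed.
Lemma op_qf v : q (f v) = f (q v). Proof. by rewrite op_fq. Qed.
Lemma op_hf v : h (f v) = f (h v) + (-2) *: f v. Proof. exact: op_h. Qed.
Lemma op_hq v : h (q v) = q (h v) - q v. Proof. by rewrite op_h scaleN1r. Qed.
Lemma op_ph v : p (h v) = h (p v) - p v. Proof. by rewrite op_h scale1r addrK. Qed.
Lemma op_eh v : e (h v) = h (e v) - 2 *: e v. Proof. by rewrite op_h addrK. Qed.
(** The rules are oriented towards the order f, q, h, p, e, so that rewriting ends in a PBW normal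
    form whose coefficients [lmod] can compare. *)
Definition nord := (op_pf, op_qf, op_hf, op_hq, op_ph, op_eh, op_ef, op_eq, op_ep, op_pq, zc).

Local Ltac nord_tac := rewrite ?(nord, opE); lmod K (vect M); field; rewrite ?c0 ?pnatr_eq0 //.

Lemma oE_p v : oE (p v) = p (oE v).
Proof. by rewrite /oE; nord_tac. Qed.
Lemma oE_q v : oE (q v) = q (oE v).
Proof. by rewrite /oE; nord_tac. Qed.
Lemma oF_p v : oF (p v) = p (oF v).
Proof. by rewrite /oF; nord_tac. Qed.
Lemma oF_q v : oF (q v) = q (oF v).
Proof. by rewrite /oF; nord_tac. Qed.
Lemma oH_p v : oH (p v) = p (oH v).
Proof. by rewrite /oH; nord_tac. Qed.
Lemma oH_q v : oH (q v) = q (oH v).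
Proof. by rewrite /oH; nord_tac. Qed.
Lemma oEF v : oE (oF v) = oF (oE v) + oH v.
Proof. by rewrite /oE /oF /oH; nord_tac. Qed.
Lemma oHE v : oH (oE v) = oE (oH v) + 2 *: oE v.
Proof. by rewrite /oE /oH; nord_tac. Qed.
Lemma oHF v : oH (oF v) = oF (oH v) - 2 *: oF v.
Proof. by rewrite /oF /oH; nord_tac. Qed.

Lemma casimir_p v : casimir (p v) = p (casimir v).
Proof. exact: (@cas_comm K (vect M) oE oF oH p v oE_p oF_p oH_p). Qed.
Lemma casimir_q v : casimir (q v) = q (casimir v).
Proof. exact: (@cas_comm K (vect M) oE oF oH q v oE_q oF_q oH_q). Qed.
Lemma casimir_E v : casimir (oE v) = oE (casimir v).
Proof. exact: (@cas_E K (vect M) oE oF oH oEF oHE v). Qed.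
Lemma casimir_F v : casimir (oF v) = oF (casimir v).
Proof. exact: (@cas_F K (vect M) oE oF oH oEF oHF v). Qed.
Lemma casimir_H v : casimir (oH v) = oH (casimir v).
Proof. exact: (@cas_H K (vect M) oE oF oH oHE oHF v). Qed.

Lemma op_oE v : e v = oE v + (2 * c)^-1 *: p (p v). Proof. by rewrite /oE subrK. Qed.
Lemma op_oF v : f v = oF v - (2 * c)^-1 *: q (q v). Proof. by rewrite /oF addrK. Qed.
Lemma op_oH v : h v = oH v - c^-1 *: q (p v) - 2^-1 *: v.
Proof. by rewrite /oH; lmod K (vect M); ring. Qed.

Lemma casimir_op i v : casimir (op i v) = op i (casimir v).
Proof.
have cD x y : casimir (x + y) = casimir x + casimir y by apply: lmapD.
have cN x : casimir (- x) = - casimir x by apply: lmapN.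
have cZ a x : casimir (a *: x) = a *: casimir x by apply: lmapZ.
case: i.
- by rewrite !op_oE cD cZ casimir_E !casimir_p.
- by rewrite !op_oH (cD (oH v - c^-1 *: q (p v))) (cD (oH v)) !cN !cZ casimir_H casimir_q casimir_p.
- by rewrite !op_oF cD cN cZ casimir_F !casimir_q.
- exact: casimir_p.
- exact: casimir_q.
- by rewrite !zc cZ.
Qed.

Lemma oE_ker v : p v = 0 -> oE v = e v.
Proof. by move=> pv; rewrite /oE pv op0 scaler0 subr0. Qed.
Lemma p_oE v : p v = 0 -> p (oE v) = 0.
Proof. by move=> pv; rewrite -oE_p pv oE0. Qed.
Lemma p_oF v : p v = 0 -> p (oF v) = 0.
Proof. by move=> pv; rewrite -oF_p pv oF0. Qed.

Lemma oH_gr n v : gr c M n v -> p v = 0 -> oH v = (n%:~R - 1) *: v.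
Proof.
move=> /grE[hv _] pv; rewrite /oH hv pv op0 scaler0 addr0 -scalerDl; congr (_ *: _); field.
by [].
Qed.

Lemma gr_oE n m v : gr c M n v -> m = n + 2 -> gr c M m (oE v).
Proof.
move=> hv em; have g1 := gr_op (i := sE) hv em; have [G0 GD] := sm_closed (gr c M m).
rewrite /oE addrC -scaleNr; apply: GD g1; apply: (gr_op (n := n + 1)); last by rewrite em -addrA.
exact: gr_op hv _.
Qed.
Lemma gr_oF n m v : gr c M n v -> m = n - 2 -> gr c M m (oF v).
Proof.
clear c0; move=> hv em; have g1 := gr_op (i := sF) hv em; have [G0 GD] := sm_closed (gr c M m).
rewrite /oF addrC; apply: GD g1; apply: (gr_op (n := n - 1)); last by rewrite em /= ; lia.
exact: gr_op hv _.
Qed.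

(* On a highest weight vector only (H + 1)^2 contributes. *)
Lemma casimir_hw n v : gr c M n v -> e v = 0 -> p v = 0 -> casimir v = (n%:~R ^+ 2) *: v.
Proof.
move=> hv ev pv; rewrite /casimir (oE_ker pv) ev oF0 scaler0 add0r !(oH_gr hv pv) oHZ (oH_gr hv pv).
by lmod K (vect M); ring.
Qed.
End Sl2Triple.

Section Transfer.
Variables (K : numFieldType) (c : K) (M N : lmodType (U K)) (f : {linear M -> N}).
Implicit Types v : vect M.

Lemma map_op i v : f (op i v) = op i (f v : vect N).
Proof. exact: linearZ. Qed.

Lemma map_gr n v : gr c M n v -> gr c N n (f v : vect N).
Proof. by move=> /grE[hH hZ]; apply/grE; rewrite -!map_op hH hZ; split; exact: (lmapZ (vmap f)). Qed.

Lemma map_killed D v : killed D v -> killed D (f v : vect N).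
Proof.
elim: D v => [v ->|D IH v [h1 h2]] /=; first exact: (lmap0 (vmap f)).
by rewrite -!map_op; split; apply: IH.
Qed.

Lemma map_D u v : f (u + v : vect M) = (f u : vect N) + f v.
Proof. exact: (lmapD (vmap f)). Qed.
Lemma map_N v : f (- v : vect M) = - (f v : vect N).
Proof. exact: (lmapN (vmap f)). Qed.
Lemma map_Z a v : f (a *: v : vect M) = a *: (f v : vect N).
Proof. exact: (lmapZ (vmap f)). Qed.

Lemma map_oE v : f (oE c v) = oE c (f v : vect N).
Proof. by rewrite /oE map_D map_N map_Z !map_op. Qed.
Lemma map_oF v : f (oF c v) = oF c (f v : vect N).
Proof. by rewrite /oF map_D map_Z !map_op. Qed.
Lemma map_oH v : f (oH c v) = oH c (f v : vect N).
Proof. by rewrite /oH map_D map_D !map_Z !map_op. Qed.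
Lemma map_casimir v : f (casimir c v) = casimir c (f v : vect N).
Proof. by rewrite /casimir map_D map_D map_D !map_Z map_oF map_oE !map_oH. Qed.
End Transfer.

Section Submodules.
Variables (K : numFieldType) (c : K) (M : lmodType (U K)) (S : submod M).
Implicit Types v : vect M.

Lemma sub0 : S 0. Proof. exact: (sm_closed S).1. Qed.
Lemma subD u v : S u -> S v -> S (u + v).
Proof. by move=> hu hv; have := (sm_closed S).2 1 u v hu hv; rewrite scale1r. Qed.
Lemma subU (a : U K) (v : M) : S v -> S (a *: v).
Proof. by move=> hv; have := (sm_closed S).2 a v 0 hv sub0; rewrite addr0. Qed.
Lemma subZ (a : K) v : S v -> S (a *: v). Proof. exact: subU. Qed.
Lemma sub_op i v : S v -> S (op i v). Proof. exact: subU. Qed.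
Lemma subN v : S v -> S (- v). Proof. by rewrite -scaleN1r; exact: subZ. Qed.

Definition vsub : submod (vect M) :=
  @Submod K (vect M) S (conj sub0 (fun a u v hu hv => subD (subZ a hu) hv)).

Lemma sub_oF v : S v -> S (oF c v).
Proof. by move=> h; apply: subD; [exact: sub_op|apply/subZ/sub_op/sub_op]. Qed.
End Submodules.

Section Properties.
Variables (K : numFieldType) (c : K).
Implicit Types M N : lmodType (U K).

Lemma gradable_surj M N (f : {linear M -> N}) :
  (forall y, exists x, f x = y) -> gradable c M -> gradable c N.
Proof.
move=> fs gM y; have [x <-] := fs y.
apply: (lspan_map (f := vmap f) (P := fun w => exists n, gr c M n w)); last exact: gM.
by move=> u [n hu]; apply: lspan_incl; exists n; exact: map_gr.
Qed.

Lemma nilp_surj M N (f : {linear M -> N}) :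
  (forall y, exists x, f x = y) -> nilp M -> nilp N.
Proof. by move=> fs nM y; have [x <-] := fs y; have [D hD] := nM x; exists D; exact: map_killed. Qed.

Lemma fg_surj (A : pzRingType) (M N : lmodType A) (f : {linear M -> N}) :
  (forall y, exists x, f x = y) -> fin_generated M -> fin_generated N.
Proof.
move=> fs /fin_generatedP[s hs]; apply/fin_generatedP; exists (map f s) => y.
have [x <-] := fs y; apply: (lspan_map (P := listed s)) (hs x) => u hu.
exact/lspan_incl/map_f.
Qed.

Lemma gr_inj M N (f : {linear M -> N}) n v : injective f -> gr c N n (f v) -> gr c M n v.
Proof.
move=> fI /grE[h1 h2]; apply/grE; split; apply: fI.
  by rewrite map_op h1 [RHS](lmapZ (vmap f)).
by rewrite map_op h2 [RHS](lmapZ (vmap f)).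
Qed.

Lemma image_closed (A : pzRingType) (M N : lmodType A) (f : {linear M -> N}) :
  (exists x, f x = 0) /\ forall a u v, (exists x, f x = u) -> (exists x, f x = v) ->
    exists x, f x = a *: u + v.
Proof.
split; first by exists 0; rewrite linear0.
by move=> a u v [x <-] [y <-]; exists (a *: x + y); rewrite linearP.
Qed.
Definition image_submod (A : pzRingType) (M N : lmodType A) (f : {linear M -> N}) : submod N :=
  Submod (image_closed f).

Lemma kernel_closed (A : pzRingType) (M N : lmodType A) (f : {linear M -> N}) :
  f 0 = 0 /\ forall a u v, f u = 0 -> f v = 0 -> f (a *: u + v) = 0.
Proof. by split=> [|a u v hu hv]; rewrite ?linear0 // linearP hu hv scaler0 addr0. Qed.
Definition kernel_submod (A : pzRingType) (M N : lmodType A) (f : {linear M -> N}) : submod M :=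
  Submod (kernel_closed f).

Lemma O_xi_surj M N (f : {linear M -> N}) :
  (forall y, exists x, f x = y) -> O_xi (xi_c c) M -> O_xi (xi_c c) N.
Proof.
move=> fs /O_xiP[h1 h2 h3]; apply/O_xiP; split.
- exact: fg_surj fs h1.
- exact: gradable_surj fs h2.
- exact: nilp_surj fs h3.
Qed.

Section GeneralizedEigenspaces.
Variables (K' : fieldType) (V : lmodType K') (T : {linear V -> V}).

Definition shifted (a : K') (v : V) : V := T v - a *: v.
Lemma shifted_linear a : linear (shifted a).
Proof. by move=> b u v; rewrite /shifted (lmapD T) (lmapZ T); lmod K' V; ring. Qed.
HB.instance Definition _ a := GRing.isLinear.Build K' V V _ (shifted a) (shifted_linear a).

Definition nilat (a : K') (v : V) := exists k, iter k (shifted a) v = 0.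

Lemma shiftedC a b v : shifted a (shifted b v) = shifted b (shifted a v).
Proof. by rewrite /shifted !(linE T); lmod K' V; ring. Qed.

Lemma iter_shiftedP a k b u v :
  iter k (shifted a) (b *: u + v) = b *: iter k (shifted a) u + iter k (shifted a) v.
Proof. by elim: k => //= k ->; rewrite linearP. Qed.
Lemma iter_shifted0 a k : iter k (shifted a) 0 = 0.
Proof. by elim: k => //= k ->; rewrite linear0. Qed.

Lemma iter_shifted_leq a k k' v : (k <= k')%N -> iter k (shifted a) v = 0 -> iter k' (shifted a) v = 0.
Proof. by move=> /subnK <- h; rewrite iterD h iter_shifted0. Qed.

Lemma nilatP a b u v : nilat a u -> nilat a v -> nilat a (b *: u + v).
Proof.
move=> [k hk] [l hl]; exists (maxn k l); rewrite iter_shiftedP.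
rewrite (iter_shifted_leq (leq_maxl k l)) // (iter_shifted_leq (leq_maxr k l)) //.
by rewrite scaler0 addr0.
Qed.
Lemma nilat0 a : nilat a 0. Proof. by exists 0%N. Qed.

Lemma iter_shiftedC a b k v : iter k (shifted a) (shifted b v) = shifted b (iter k (shifted a) v).
Proof. by elim: k => //= k ->; rewrite shiftedC. Qed.

(** Double induction on the exponents: both (T - a) v and (T - b) v vanish, and their difference is
    a nonzero multiple of [v]. *)
Lemma nilat_inter a b v : a != b -> nilat a v -> nilat b v -> v = 0.
Proof.
move=> ab [k +] [l]; elim: k l v => [//|k IHk] l v; elim: l v => [//|l IHl] v hk hl.
have h1 : shifted a v = 0.
  by apply: (IHk l.+1); [rewrite -iterSr|rewrite iter_shiftedC hl linear0].
have h2 : shifted b v = 0.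
  by apply: IHl; [rewrite iter_shiftedC hk linear0|rewrite -iterSr].
apply/eqP; move/eqP: ab; apply: contra_notT => v0.
have : (a - b) *: v = shifted b v - shifted a v by rewrite /shifted; lmod K' V; ring.
rewrite h1 h2 subr0 => /eqP; rewrite scaler_eq0 (negPf v0) orbF subr_eq0 => /eqP //.
Qed.

(** If u solves (T - b) u = (T - a) v, which has a smaller exponent, then (T - b) (v - u) = (a - b)
    v. *)
Lemma nilat_shift_surj a b v : a != b -> nilat a v -> exists2 u, nilat a u & shifted b u = v.
Proof.
move=> ab [k]; elim: k v => [v /= ->|k IH v].
  by exists 0; [exact: nilat0|rewrite linear0].
rewrite iterSr => hk; have [u hu eu] := IH _ hk.
have nv : nilat a v by exists k.+1; rewrite iterSr.
have ab' : a - b != 0 by rewrite subr_eq0.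
exists ((a - b)^-1 *: (v - u)).
  have := nilatP (- (a - b)^-1) hu (nilatP (a - b)^-1 nv (nilat0 a)).
  congr (nilat a _); lmod K' V; ring.
have -> : shifted b ((a - b)^-1 *: (v - u)) = (a - b)^-1 *: (shifted b v - shifted b u).
  by rewrite !(linE (shifted b)).
rewrite eu /shifted; lmod K' V; field => //.
Qed.

Lemma nilat_eigen a b v : T v = b *: v -> nilat a v -> v <> 0 -> b = a.
Proof.
move=> Tv na v0; have [//|ba] := eqVneq b a.
case: v0; apply: (nilat_inter ba) na; exists 1%N.
by rewrite /= /shifted Tv subrr.
Qed.

Lemma nilat_unshift a v : nilat a (shifted a v) -> nilat a v.
Proof. by move=> [k hk]; exists k.+1; rewrite iterSr. Qed.

End GeneralizedEigenspaces.
End Properties.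

Section CapSub.
Variables (A : pzRingType) (M : lmodType A) (S T : submod M).
Lemma cap_closed : (S 0 /\ T 0) /\ forall (a : A) u v, S u /\ T u -> S v /\ T v ->
  S (a *: u + v) /\ T (a *: u + v).
Proof.
have [S0 SD] := sm_closed S; have [T0 TD] := sm_closed T.
by split=> // a u v [? ?] [? ?]; split; [apply: SD|apply: TD].
Qed.
Definition cap_submod : submod M := Submod cap_closed.
End CapSub.

Section HighestWeight.
Variables (K : numFieldType) (c : K) (M : lmodType (U K)).
Implicit Types v : vect M.

Definition hw (n : int) v := [/\ gr c M n v, op sE v = 0 & op sP v = 0].

(** Apply e or p as long as the result is nonzero. This ends in fewer than [D] steps, the degree
    never drops, and the last vector is killed by both. *)
Lemma reach (S : submod M) D n v : gr c M n v -> v <> 0 -> killed D v -> S v ->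
  exists m x, [/\ (n <= m)%R, hw m x, x <> 0 & S x].
Proof.
elim: D n v => [//|D IH] n v hv v0 /= [h1 h2] Sv.
have step i : i = sE \/ i = sP -> killed D (op i v) -> op i v <> 0 ->
    exists m x, [/\ (n <= m)%R, hw m x, x <> 0 & S x].
  move=> hi hk hn; have [|m [x [h3 h4 h5 h6]]] := IH _ _ (gr_op hv erefl) hn hk; first exact: sub_op.
  by exists m, x; split => //; apply: le_trans h3; case: hi => -> /=; lia.
have [h3|h3] := pselect (op sE v = 0); last by apply: step h3; [left|].
have [h4|h4] := pselect (op sP v = 0); last by apply: step h4; [right|].
by exists n, v.
Qed.

Lemma sub_has_hw (S : submod M) v : gradable c M -> nilp M -> S v -> v <> 0 ->
  exists m x, [/\ hw m x, x <> 0 & S x].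
Proof.
move=> gM nM Sv v0.
have [|n [w [h1 h2 h3]]] := graded_nonzero (@gr_h _ c M) (S := vsub S) _ (graded_sumP (gM v)) Sv v0.
  by move=> u; exact: sub_op.
have [D hD] := nM w; have [m [x [_ h4 h5 h6]]] := reach h1 h3 hD h2.
by exists m, x.
Qed.

Definition casM (i : int) := forall v, nilat (@casimir K c M) (i%:~R ^+ 2) v.

Hypothesis c0 : c != 0.

Lemma hw_degree i n v : hw n v -> v <> 0 -> nilat (@casimir K c M) (i%:~R ^+ 2) v -> n = i \/ n = - i.
Proof.
move=> [h1 h2 h3] v0 hi.
have /eqP := nilat_eigen (casimir_hw h1 h2 h3) hi v0.
rewrite eqf_sqr => /orP[] /eqP.
  by move/intr_inj => ->; left.
by rewrite -mulrNz => /intr_inj ->; right.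
Qed.

(** On ker p the operators E and e agree, so climbing with E alone ends in a highest weight vector.
    Unlike [reach], this records which power of E was applied. *)
Lemma reach_oE D n v : gradable c M -> gr c M n v -> v <> 0 -> op sP v = 0 -> killed D v ->
  exists j, hw (n + j%:Z * 2) (iter j (@oE K c M) v) /\ iter j (@oE K c M) v <> 0.
Proof.
move=> gM; have zc v' := gradable_z v' gM.
elim: D n v => [//|D IH] n v hv v0 pv /= [h1 _].
have [ev|ev] := pselect (op sE v = 0); first by exists 0%N; rewrite mul0r addr0.
rewrite -(oE_ker c pv) in ev h1.
have [|j [h2 h3]] := IH _ _ (gr_oE hv erefl) ev _ h1; first exact: p_oE.
exists j.+1; rewrite iterSr; split => //; move: h2; congr (hw _ _); lia.
Qed.

(** If [x0] represents [x], then p x0 lies in [N]; as p maps [N] onto itself, an element of [N]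
    corrects [x0] to a vector of ker p. *)
Lemma quotient_lift (N : submod M) d (x : quom N) : gradable c M ->
  (forall u, N u -> exists2 y, N y & op sP y = u) ->
  gr c (quom N) d x -> op sP (x : vect (quom N)) = 0 ->
  exists v, [/\ gr c M d v, op sP v = 0 & quom_pi N v = x].
Proof.
move=> gM pN; elim/quom_ind: x => x0 hx px.
have [||x hxd ex] := @graded_lift K _ (gr c (quom N)) _ _ (@gr_h _ c _) _ (gr c M)
  (vmap (quom_pi N)) 0 d x0 _ (graded_sumP (gM x0)); rewrite ?addr0 //.
  by move=> n v; rewrite addr0; exact: map_gr.
have Npx : N (op sP x).
  have : quom_pi N (op sP x) = quom_pi N 0.
    rewrite linear0; apply: etrans px; rewrite (map_op (quom_pi N) sP x).
    by congr (op sP _); exact: ex.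
  by move/quom_piP; rewrite subr0.
have [y Ny py] := pN _ Npx.
have [s [w [us hw hs hy]]] := graded_sumP (gM y).
have Nw := graded_separation (@gr_h _ c M) (S := vsub N) (fun v => @sub_op K M N sH v) hw us.
rewrite -hy in Nw.
(* The correction must have degree [d] and stay in [N], hence the grading by the intersections of
   [N] with the weight spaces. *)
have gs : graded_sum (fun n => cap_submod (gr c M n) (vsub N)) y.
  exists s, (fun n => if n \in s then w n else 0); split => //.
  - move=> n; case: ifP => hn; first by split; [|exact: Nw].
    exact: (sm_closed _).1.
  - by move=> n /negPf ->.
  - by rewrite hy; apply: eq_big_seq => n ->.
have [||u [gu Nu] pu] := @graded_lift K _ (gr c M) _ _ (@gr_h _ c _) _ _ (op sP) 1 d y _ gs.
- by move=> n v [h _]; apply: gr_op h erefl.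
- by rewrite /= py; apply: gr_op hxd erefl.
exists (x - u); split.
- rewrite addrC -scaleN1r; exact: (sm_closed (gr c M d)).2.
- have pu' : op sP u = op sP x by rewrite -py; exact: pu.
  by rewrite opD opN pu' subrr.
have -> : quom_pi N (x - u) = quom_pi N x.
  by apply/quom_piP; rewrite addrAC subrr add0r; exact: subN.
exact: ex.
Qed.
End HighestWeight.

(** * Chain modules *)

Section ModuleOfOperators.
Variables (K : fieldType) (V : lmodType K) (o : sgen -> {linear V -> V}).
Hypothesis o_comm : forall i j v,
  o i (o j v) - o j (o i v) = \sum_k (bracket_table K i j) k *: o k v.

Definition act (x : schr K) (v : V) : V := \sum_i (x : svec K) i *: o i v.

Lemma act_linr x : linear (act x).
Proof.
move=> a u v; rewrite /act scaler_sumr -big_split; apply: eq_bigr => i _ /=.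
by rewrite !(linE (o i)); lmod K V; ring.
Qed.

Lemma act_linl v : linear (act^~ v).
Proof.
move=> a x y; rewrite /act scaler_sumr -big_split; apply: eq_bigr => i _ /=.
by rewrite !ffunE scalerDl scalerA.
Qed.

Lemma act_lie x y v : act (lie x y) v = act x (act y v) - act y (act x v).
Proof.
have actZ a z : act (a *: z) v = a *: act z v.
  by rewrite /act scaler_sumr; apply: eq_bigr => i _; rewrite ffunE scalerA.
have act_sum (I : finType) (F : I -> schr K) : act (\sum_i F i) v = \sum_i act (F i) v.
  rewrite /act exchange_big; apply: eq_bigr => k _ /=.
  by rewrite -scaler_suml sum_ffunE.
have ae (a b : schr K) : act a (act b v) = \sum_i \sum_j ((a : svec K) i * (b : svec K) j) *: o i (o j v).
  rewrite {1}/act; apply: eq_bigr => i _; rewrite /act (linear_sum (o i)) scaler_sumr.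
  by apply: eq_bigr => j _; rewrite (lmapZ (o i)) scalerA.
rewrite [lie x y]/(sbracket x y) act_sum !ae [X in _ = _ - X]exchange_big -sumrB.
apply: eq_bigr => i _; rewrite act_sum -sumrB; apply: eq_bigr => j _.
by rewrite actZ [act (bracket_table K i j) v]/act -o_comm scalerBr [(y : svec K) j * _]mulrC.
Qed.

Definition ops_module : lieModule (schr K) := LieModule act_linr act_linl act_lie.
Definition opsU : lmodType (U K) := lm_mod ops_module.

Lemma opsU_op i (v : V) : op i (v : vect opsU) = o i v.
Proof.
rewrite [LHS](lm_scale_gen (sb K i : schr K) (v : ops_module)) /=.
rewrite /act (bigD1 i) //= !ffunE eqxx scale1r big1 ?addr0 // => j /negPf ij.
by rewrite !ffunE ij scale0r.
Qed.

(** Scalars act on [vect opsU] through the algebra [U K], so they agree with those of [V] only by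
    this equation. *)
Lemma opsU_scale a (v : V) : a *: (v : vect opsU) = a *: v :> V.
Proof. exact: (lm_scale_alg a (v : ops_module)). Qed.
End ModuleOfOperators.

Section FromSl2Weyl.
Variables (K : numFieldType) (c : K) (V : lmodType K) (E F H p q : {linear V -> V}).
Hypothesis c0 : c != 0.
Hypothesis EF : forall v, E (F v) = F (E v) + H v.
Hypothesis HE : forall v, H (E v) = E (H v) + 2 *: E v.
Hypothesis HF : forall v, H (F v) = F (H v) - 2 *: F v.
Hypothesis pq : forall v, p (q v) = q (p v) + c *: v.
Hypothesis pE : forall v, p (E v) = E (p v).
Hypothesis pF : forall v, p (F v) = F (p v).
Hypothesis pH : forall v, p (H v) = H (p v).
Hypothesis qE : forall v, q (E v) = E (q v).
Hypothesis qF : forall v, q (F v) = F (q v).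
Hypothesis qH : forall v, q (H v) = H (q v).

(* The inverse of the passage from e, f, h to oE, oF, oH. *)
Definition sw_fun (i : sgen) (v : V) : V :=
  match i with
  | sE => E v + (2 * c)^-1 *: p (p v)
  | sF => F v - (2 * c)^-1 *: q (q v)
  | sH => H v - c^-1 *: q (p v) - 2^-1 *: v
  | sP => p v | sQ => q v | sZ => c *: v
  end.

Let lE := (linE E, linE F, linE H, linE p, linE q).

Lemma sw_linear i : linear (sw_fun i).
Proof. by case: i => a u v; rewrite /= ?lE; lmod K V; ring. Qed.
HB.instance Definition _ i := GRing.isLinear.Build K V V _ (sw_fun i) (@sw_linear i).

Lemma bracket_tableN i j : bracket_table K j i = - bracket_table K i j.
Proof. by case: i; case: j; rewrite /= ?opprK ?oppr0. Qed.

Lemma sw_comm i j v : sw_fun i (sw_fun j v) - sw_fun j (sw_fun i v)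
  = \sum_k (bracket_table K i j) k *: sw_fun k v.
Proof.
have sZE (a : K) (x : svec K) k : (a *: x) k = a * x k by rewrite ffunE.
have sNE (x : svec K) k : (- x) k = - x k by rewrite ffunE.
have s0E k : (0 : svec K) k = 0 by rewrite ffunE.
(* Both sides are antisymmetric in [i] and [j], which leaves fifteen brackets. *)
suff lt_case i' j' : (sgen_code i' < sgen_code j')%N -> sw_fun i' (sw_fun j' v) - sw_fun j' (sw_fun i' v)
    = \sum_k (bracket_table K i' j') k *: sw_fun k v.
  case: (ltngtP (sgen_code i) (sgen_code j)) => [/lt_case //| |/val_inj/(can_inj sgen_codeK) ->].
    move/lt_case => h; rewrite -opprB h (bracket_tableN i j) -sumrN.
    by apply: eq_bigr => k _; rewrite sNE scaleNr opprK.
  by rewrite subrr big1 // => k _; have := bracket_tableN j j; case: (j) => // ->; rewrite ?sNE ?s0E ?oppr0 scale0r.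
(* All constants are expressed through (2c)^-1, so that [ring] needs the single relation [ee]. *)
rewrite sgen_sum; have ee : (2 * c)^-1 * c * 2 = 1 by field.
have e3 : 2^-1 = (2 * c)^-1 * c :> K by field.
have e4 : c^-1 * c = 1 :> K by field.
have e5 : c^-1 = 2 * (2 * c)^-1 :> K by field.
rewrite /sw_fun e5 e3.
case: i'; case: j' => //= _.
all: rewrite /bracket_table ?(sZE, sNE, s0E, ffunE) /=.
all: rewrite ?(EF, HE, HF, pq, pE, pF, pH, qE, qF, qH, lE).
all: (lmod K V). all: (first [ring: ee|by field]).
Qed.
End FromSl2Weyl.

Section Polynomials.
Variables (K : numFieldType) (c : K) (Y : lmodType K).
(** This is C[q] tensored with [Y], the component of index m being the coefficient of q^m. Below,
    [polQ] is multiplication by q and [polP] is c d/dq. *)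
Definition pol := dsum (fun _ : nat => Y).
HB.instance Definition _ := GRing.Lmodule.on pol.
Implicit Types x : pol.

Lemma polP_fin x : exists n, forall i, (n <= i)%N -> (c * i.+1%:R) *: x i.+1 = 0.
Proof. by have [n hn] := ds_fin x; exists n => i hi; rewrite hn ?scaler0 // ltnW. Qed.
Definition polP x : pol := Dsum (polP_fin x).
Lemma polQ_fin x : exists n, forall i, (n <= i)%N -> (if i is i'.+1 then x i' else 0) = 0.
Proof. by have [n hn] := ds_fin x; exists n.+1 => -[|i] // hi; rewrite hn. Qed.
Definition polQ x : pol := Dsum (polQ_fin x).

Lemma polP_linear : linear polP.
Proof. by move=> a x y; apply: dsum_eq => i /=; lmod K Y; ring. Qed.
HB.instance Definition _ := GRing.isLinear.Build K pol pol _ polP polP_linear.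
Lemma polQ_linear : linear polQ.
Proof. by move=> a x y; apply: dsum_eq => -[|i] //=; rewrite scaler0 addr0. Qed.
HB.instance Definition _ := GRing.isLinear.Build K pol pol _ polQ polQ_linear.

Definition polM (f : {linear Y -> Y}) : {linear pol -> pol} := dsum_map (fun=> f).

Lemma pol_pq x : polP (polQ x) = polQ (polP x) + c *: x.
Proof.
apply: dsum_eq => -[|i]; first by rewrite /= add0r mulr1.
have -> : (polQ (polP x) + c *: x) i.+1 = (c * i.+1%:R) *: x i.+1 + c *: x i.+1 by [].
by rewrite /= -[i.+2]addn1 natrD; lmod K Y; ring.
Qed.
Lemma pol_pM f x : polP (polM f x) = polM f (polP x).
Proof. by apply: dsum_eq => i /=; rewrite lmapZ. Qed.
Lemma pol_qM f x : polQ (polM f x) = polM f (polQ x).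
Proof. by apply: dsum_eq => -[|i] //=; rewrite lmap0. Qed.

Lemma dinj_polQ m (y : Y) : dinj (N := fun=> Y) (i := m.+1) y = polQ (dinj (N := fun=> Y) (i := m) y).
Proof.
apply: dsum_eq => -[|i] /=; first by rewrite dinj_fun_out.
have [<-|mi] := eqVneq m i; first by rewrite !dinj_fun_in.
by rewrite !dinj_fun_out.
Qed.
Lemma polP_dinj0 (y : Y) : polP (dinj (N := fun=> Y) (i := 0%N) y) = 0.
Proof. by apply: dsum_eq => i /=; rewrite dinj_fun_out ?scaler0. Qed.
Lemma polM_dinj f m (y : Y) :
  polM f (dinj (N := fun=> Y) (i := m) y) = dinj (N := fun=> Y) (i := m) (f y).
Proof.
apply: dsum_eq => i /=; have [<-|mi] := eqVneq m i; first by rewrite !dinj_fun_in.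
by rewrite !dinj_fun_out // lmap0.
Qed.
Lemma polP_ker x : c != 0 -> polP x = 0 -> x = dinj (N := fun=> Y) (i := 0%N) (x 0%N).
Proof.
move=> c0 h; apply: dsum_eq => -[|i]; first by rewrite dinj_in.
rewrite dinj_out //; have : polP x i = 0 by rewrite h.
by move/eqP; rewrite /= scaler_eq0 mulf_eq0 (negPf c0) pnatr_eq0 => /eqP.
Qed.
Lemma polP_surj x : c != 0 -> exists y, polP y = x.
Proof.
move=> c0.
have yfin : exists n, forall i, (n <= i)%N -> (if i is j.+1 then (c * j.+1%:R)^-1 *: x j else 0) = 0.
  by have [n hn] := ds_fin x; exists n.+1 => -[|i] // hi; rewrite hn ?scaler0.
exists (Dsum yfin); apply: dsum_eq => i /=.
by rewrite scalerA mulfV ?scale1r // mulf_neq0 // pnatr_eq0.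
Qed.
End Polynomials.

(* Data for a weight sl2-module with one-step raising and lowering maps;
   (H + 1) has eigenvalue [ch_top - 2 k] on [ch_sp k]. *)
Record chain (K : numFieldType) := Chain {
  ch_top : int;
  ch_sp : nat -> lmodType K;
  ch_F : forall k, {linear ch_sp k -> ch_sp k.+1};
  ch_E : forall k, {linear ch_sp k.+1 -> ch_sp k};
  ch_EF0 : forall x : ch_sp 0, ch_E 0 (ch_F 0 x) = (ch_top%:~R - 1) *: x;
  ch_EF : forall k (x : ch_sp k.+1), ch_E k.+1 (ch_F k.+1 x)
    = ch_F k (ch_E k x) + (ch_top%:~R - 1 - 2 * k.+1%:R) *: x }.

Section ChainModule.
Variables (K : numFieldType) (C : chain K).
Notation N := (ch_sp C).
Definition chm := dsum N.
HB.instance Definition _ := GRing.Lmodule.on chm.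
Implicit Types x : chm.

Definition chF_fun x (k : nat) : N k := match k with 0 => 0 | k'.+1 => ch_F C k' (x k') end.
Lemma chF_fin x : exists n, forall i, (n <= i)%N -> chF_fun x i = 0.
Proof. by have [n hn] := ds_fin x; exists n.+1 => -[|i] // hi /=; rewrite hn ?lmap0. Qed.
Definition chF x : chm := Dsum (chF_fin x).
Lemma chE_fin x : exists n, forall i, (n <= i)%N -> ch_E C i (x i.+1) = 0.
Proof. by have [n hn] := ds_fin x; exists n => i hi; rewrite hn ?lmap0 // ltnW. Qed.
Definition chE x : chm := Dsum (chE_fin x).
Lemma chH_fin x : exists n, forall i, (n <= i)%N -> ((ch_top C)%:~R - 1 - 2 * i%:R) *: x i = 0.
Proof. by have [n hn] := ds_fin x; exists n => i hi; rewrite hn ?scaler0. Qed.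
Definition chH x : chm := Dsum (chH_fin x).

Lemma chF_linear : linear chF.
Proof. by move=> a x y; apply: dsum_eq => -[|i] /=; rewrite ?scaler0 ?addr0 // linearP. Qed.
HB.instance Definition _ := GRing.isLinear.Build K chm chm _ chF chF_linear.
Lemma chE_linear : linear chE.
Proof. by move=> a x y; apply: dsum_eq => i /=; rewrite linearP. Qed.
HB.instance Definition _ := GRing.isLinear.Build K chm chm _ chE chE_linear.
Lemma chH_linear : linear chH.
Proof. by move=> a x y; apply: dsum_eq => i /=; lmod K (N i); ring. Qed.
HB.instance Definition _ := GRing.isLinear.Build K chm chm _ chH chH_linear.

Lemma ch_relEF x : chE (chF x) = chF (chE x) + chH x.
Proof.
apply: dsum_eq => -[|i] /=; first by rewrite ch_EF0 add0r mulr0 subr0.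
by rewrite ch_EF.
Qed.
Lemma ch_relHE x : chH (chE x) = chE (chH x) + 2 *: chE x.
Proof.
apply: dsum_eq => i.
have -> : (chE (chH x) + 2 *: chE x : chm) i = ch_E C i (chH x i.+1) + 2 *: ch_E C i (x i.+1) by [].
by rewrite /= lmapZ -(natr1 i); lmod K (N i); ring.
Qed.
Lemma ch_relHF x : chH (chF x) = chF (chH x) - 2 *: chF x.
Proof.
apply: dsum_eq => -[|i].
  by have -> : (chF (chH x) - 2 *: chF x : chm) 0%N = 0 - 2 *: 0 by [];
     rewrite /= !scaler0 subr0.
have -> : (chF (chH x) - 2 *: chF x : chm) i.+1 = ch_F C i (chH x i) - 2 *: ch_F C i (x i) by [].
by rewrite /= lmapZ -(natr1 i); lmod K (N i.+1); ring.
Qed.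

Definition cinj k (y : N k) : chm := dinj y.

Let P := pol chm.
Lemma pol_EF (x : P) : polM chE (polM chF x) = polM chF (polM chE x) + polM chH x.
Proof. by apply: dsum_eq => i; exact: ch_relEF. Qed.
Lemma pol_HE (x : P) : polM chH (polM chE x) = polM chE (polM chH x) + 2 *: polM chE x.
Proof. by apply: dsum_eq => i; exact: ch_relHE. Qed.
Lemma pol_HF (x : P) : polM chH (polM chF x) = polM chF (polM chH x) - 2 *: polM chF x.
Proof. by apply: dsum_eq => i; exact: ch_relHF. Qed.

Variable c : K.
Hypothesis c0 : c != 0.

Let chain_comm := @sw_comm K c P (polM chE) (polM chF) (polM chH) (@polP K c chm) (@polQ K chm) c0
  pol_EF pol_HE pol_HF (@pol_pq K c chm) (@pol_pM K c chm chE) (@pol_pM K c chm chF)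
  (@pol_pM K c chm chH) (@pol_qM K chm chE) (@pol_qM K chm chF) (@pol_qM K chm chH).

Definition chainU : lmodType (U K) := opsU chain_comm.

(* The vector q^m w, for w of sl2-weight [ch_top C - 1 - 2 k]. *)
Definition mono (m k : nat) (w : N k) : vect chainU := dinj (N := fun=> chm) (i := m) (cinj w).
End ChainModule.

Section ChainModuleFacts.
Variables (K : numFieldType) (C : chain K) (c : K) (c0 : c != 0).
Notation N := (ch_sp C).
Notation X := (chainU C c0).
Notation P := (pol (chm C)).
Implicit Types x : vect X.

Lemma X_scale a x : a *: x = a *: (x : P) :> P.
Proof. exact: opsU_scale. Qed.

Lemma X_p x : op sP x = polP c (x : P). Proof. exact: opsU_op. Qed.
Lemma X_q x : op sQ x = polQ (x : P). Proof. exact: opsU_op. Qed.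
Lemma X_z x : op sZ x = c *: x.
Proof. by rewrite X_scale; exact: opsU_op. Qed.

Lemma X_oE x : oE c x = polM (@chE K C) (x : P).
Proof.
rewrite /oE X_scale X_p X_p; have -> : op sE x = sw_fun c (polM (@chE K C)) (polM (@chF K C)) (polM (@chH K C))
  (@polP K c _) (@polQ K _) sE (x : P) by exact: opsU_op.
exact: addrK.
Qed.
Lemma X_oF x : oF c x = polM (@chF K C) (x : P).
Proof.
rewrite /oF X_scale X_q X_q; have -> : op sF x = sw_fun c (polM (@chE K C)) (polM (@chF K C)) (polM (@chH K C))
  (@polP K c _) (@polQ K _) sF (x : P) by exact: opsU_op.
exact: subrK.
Qed.
Lemma X_oH x : oH c x = polM (@chH K C) (x : P).
Proof.
rewrite /oH !X_scale X_p X_q; have -> : op sH x = sw_fun c (polM (@chE K C)) (polM (@chF K C)) (polM (@chH K C))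
  (@polP K c _) (@polQ K _) sH (x : P) by exact: opsU_op.
have h (a b d : P) : a - b - d + b + d = a by rewrite addrAC !subrK.
exact: h.
Qed.

Notation mon m w := (mono c0 m w).

Lemma mono_linear m k : linear (@mono K C c c0 m k).
Proof.
move=> a u v; have -> (y z : vect X) : a *: y + z = a *: (y : P) + (z : P) by rewrite X_scale.
by rewrite /mono /cinj !linearP.
Qed.
HB.instance Definition _ m k := GRing.isLinear.Build K (N k) (vect X) _ (@mono K C c c0 m k) (@mono_linear m k).

Lemma mono_q m k (w : N k) : op sQ (mon m w) = mon m.+1 w.
Proof. by rewrite X_q -dinj_polQ. Qed.
Lemma mono_p k (w : N k) : op sP (mon 0 w) = 0.
Proof. by rewrite X_p; exact: polP_dinj0. Qed.

Lemma cinj_F k (w : N k) : chF (cinj w) = cinj (ch_F C k w).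
Proof.
apply: dsum_eq => -[|j] /=; first by rewrite dinj_fun_out.
have [e|kj] := eqVneq k j; first by case: j / e; rewrite !dinj_fun_in.
by rewrite !dinj_fun_out // lmap0.
Qed.
Lemma cinj_E k (w : N k.+1) : chE (cinj w) = cinj (ch_E C k w).
Proof.
apply: dsum_eq => j /=.
have [e|kj] := eqVneq k j; first by case: j / e; rewrite !dinj_fun_in.
by rewrite !dinj_fun_out // lmap0.
Qed.
Lemma cinj_E0 (w : N 0) : chE (cinj w) = 0.
Proof. by apply: dsum_eq => j /=; rewrite dinj_fun_out // lmap0. Qed.
Lemma cinj_H k (w : N k) : chH (cinj w) = ((ch_top C)%:~R - 1 - 2 * k%:R) *: cinj w.
Proof.
apply: dsum_eq => j.
have -> a (z : chm C) : (a *: z) j = a *: z j by [].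
rewrite /=; have [e|kj] := eqVneq k j; first by case: j / e; rewrite !dinj_fun_in.
by rewrite !dinj_fun_out // !scaler0.
Qed.

Lemma mono_F m k (w : N k) : oF c (mon m w) = mon m (ch_F C k w).
Proof. by rewrite X_oF [LHS]polM_dinj /= cinj_F. Qed.
Lemma mono_E m k (w : N k.+1) : oE c (mon m w) = mon m (ch_E C k w).
Proof. by rewrite X_oE [LHS]polM_dinj /= cinj_E. Qed.
Lemma mono_E0 m (w : N 0) : oE c (mon m w) = 0.
Proof. by rewrite X_oE [LHS]polM_dinj /= cinj_E0 linear0. Qed.
Lemma mono_H m k (w : N k) : oH c (mon m w) = ((ch_top C)%:~R - 1 - 2 * k%:R) *: mon m w.
Proof. by rewrite X_oH [LHS]polM_dinj /= cinj_H X_scale linearZ. Qed.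

Lemma X_ind (Q : vect X -> Prop) : Q 0 -> (forall x y, Q x -> Q y -> Q (x + y)) ->
  (forall m k (w : N k), Q (mon m w)) -> forall x, Q x.
Proof.
move=> Q0 QD Qm x; apply: (dsum_ind (P := Q)) => [//|u v|m y]; first exact: QD.
apply: (dsum_ind (P := fun y => Q (dinj (N := fun=> chm C) (i := m) y))) => [|u v hu hv|k w].
  by rewrite linear0.
by rewrite linearD; apply: (QD).
exact: Qm.
Qed.

Lemma mono_gr m k (w : N k) n : n = ch_top C - 2 * k%:Z - m%:Z -> gr c X n (mon m w).
Proof.
elim: m n => [|m IH] n ->; last first.
  rewrite -mono_q; apply: gr_op; first exact: (IH _ erefl).
  by rewrite /=; lia.
apply/grE; split; last exact: X_z.
rewrite (op_oH c) mono_H mono_p op0 scaler0 subr0 -scalerBl; congr (_ *: _).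
by rewrite !rmorphB rmorphM /=; field.
Qed.

Lemma X_gradable : gradable c X.
Proof.
apply: X_ind => [|x y hx hy|m k w]; [exact: lspan0|exact: lspanD|].
by apply: lspan_incl; eexists; exact: mono_gr erefl.
Qed.
End ChainModuleFacts.

Section ChainModuleMaps.
Variables (K : numFieldType) (C : chain K) (c : K) (c0 : c != 0).
Notation N := (ch_sp C).
Notation X := (chainU C c0).
Notation P := (pol (chm C)).
Notation mon m w := (mono c0 m w).
Notation top := (ch_top C).

Section Lift.
Variables (M : lmodType (U K)) (t : forall k, {linear N k -> vect M}).
Hypothesis zc : forall v : vect M, op sZ v = c *: v.
Hypothesis t_p : forall k w, op sP (t k w) = 0.
Hypothesis t_E0 : forall w, oE c (t 0 w) = 0.
Hypothesis t_E : forall k w, oE c (t k.+1 w) = t k (ch_E C k w).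
Hypothesis t_F : forall k w, oF c (t k w) = t k.+1 (ch_F C k w).
Hypothesis t_H : forall k w, oH c (t k w) = (top%:~R - 1 - 2 * k%:R) *: t k w.

Fixpoint q_pow (m : nat) : {linear vect M -> vect M} :=
  if m is m'.+1 then op sQ \o q_pow m' else idfun.

Definition lift_fun (x : vect X) : vect M :=
  dlift (N := fun=> chm C) (fun m => q_pow m \o dlift t) (x : P).

Lemma lift_linear : linear lift_fun.
Proof. by move=> a u v; rewrite -[in RHS]linearP; congr lift_fun; rewrite X_scale. Qed.
HB.instance Definition _ := GRing.isLinear.Build K (vect X) (vect M) _ lift_fun lift_linear.

Lemma lift0 : lift_fun 0 = 0. Proof. exact: lmap0. Qed.
Lemma liftD x y : lift_fun (x + y) = lift_fun x + lift_fun y. Proof. exact: lmapD. Qed.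
Lemma liftN x : lift_fun (- x) = - lift_fun x. Proof. exact: lmapN. Qed.
Lemma liftZ a x : lift_fun (a *: x) = a *: lift_fun x. Proof. exact: lmapZ. Qed.

Lemma lift_mono m k (w : N k) : lift_fun (mon m w) = q_pow m (t k w).
Proof. by rewrite /lift_fun /mono dlift_dinj /= dlift_dinj. Qed.

Lemma lift_q x : lift_fun (op sQ x) = op sQ (lift_fun x).
Proof.
elim/X_ind: x => [|x y hx hy|m k w]; first by rewrite !(lift0, op0).
  by rewrite opD !liftD hx hy opD.
by rewrite mono_q !lift_mono.
Qed.

(** A commutation with [o] is checked at exponent 0 of q and then propagated along multiplication by
    q. *)
Lemma lift_comm (o : forall M : lmodType (U K), vect M -> vect M) :
  (forall M, linear (o M)) ->
  (forall k w, lift_fun (o X (mon 0 w)) = o M (t k w)) ->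
  (forall x, lift_fun (o X x) = o M (lift_fun x) ->
     lift_fun (o X (op sQ x)) = o M (op sQ (lift_fun x))) ->
  forall x, lift_fun (o X x) = o M (lift_fun x).
Proof.
move=> oL h0 hS x; have oD M' u v : o M' (u + v) = o M' u + o M' v.
  by rewrite -[u]scale1r oL !scale1r.
have o0 M' : o M' 0 = 0 by have := oD M' 0 0; rewrite addr0 => /eqP; rewrite -subr_eq subrr eq_sym => /eqP.
elim/X_ind: x => [|x y hx hy|m k w]; first by rewrite o0 lift0 o0.
  by rewrite oD !liftD hx hy oD.
elim: m => [|m IH]; first by rewrite lift_mono h0.
by rewrite -mono_q hS // lift_q.
Qed.

Lemma lift_p x : lift_fun (op sP x) = op sP (lift_fun x).
Proof.
apply: (lift_comm (o := fun M => @op K M sP)) => [M'|k w|y hy]; first exact: op_linear.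
  by rewrite mono_p lift0 t_p.
by rewrite !op_pq X_z zc liftD liftZ lift_q hy.
Qed.
Lemma lift_E x : lift_fun (oE c x) = oE c (lift_fun x).
Proof.
apply: (lift_comm (o := fun M => @oE K c M)) => [M'|[|k] w|y hy]; first exact: oE_linear.
- by rewrite mono_E0 lift0 t_E0.
- by rewrite mono_E lift_mono t_E.
- by rewrite (oE_q c0 (@X_z _ C c c0)) (oE_q c0 zc) lift_q hy.
Qed.
Lemma lift_F x : lift_fun (oF c x) = oF c (lift_fun x).
Proof.
apply: (lift_comm (o := fun M => @oF K c M)) => [M'|k w|y hy]; first exact: oF_linear.
- by rewrite mono_F lift_mono t_F.
- by rewrite (oF_q c) (oF_q c) lift_q hy.
Qed.
Lemma lift_H x : lift_fun (oH c x) = oH c (lift_fun x).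
Proof.
apply: (lift_comm (o := fun M => @oH K c M)) => [M'|k w|y hy]; first exact: oH_linear.
- by rewrite mono_H liftZ lift_mono t_H.
- by rewrite (oH_q c0 (@X_z _ C c c0)) (oH_q c0 zc) lift_q hy.
Qed.

(** Universal property of the chain module. The maps [t] place the chain in ker p, compatibly with
    E, F and H; then q^m w has to go to q^m t(w), and [p, q] = c takes care of p. *)
Lemma chain_lift : exists g : {linear X -> M}, forall k w, g (mon 0 w) = t k w.
Proof.
have lift_op i v : lift_fun (op i v) = op i (lift_fun v); last first.
  have [g hg] := @U_linear_of_ops K X M lift_fun lift_op.
  by exists g => k w; rewrite hg; exact: lift_mono.
case: i.
- by rewrite !(op_oE c) liftD liftZ lift_E !lift_p.
- by rewrite !(op_oH c) (liftD (oH c v - _)) (liftD (oH c v)) !liftN !liftZ lift_H lift_q lift_p.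
- by rewrite !(op_oF c) liftD liftN liftZ lift_F !lift_q.
- exact: lift_p.
- exact: lift_q.
- by rewrite X_z zc liftZ.
Qed.
End Lift.

(** The monomials span in degrees at most [top]. With the grading cut off above [top], a nonzero [x]
    would yield a nonzero vector that has degree [n] and also a degree at most [top]. *)
Lemma X_top n (x : vect X) : gr c X n x -> (top < n)%R -> x = 0.
Proof.
move=> hx hn; apply/notP => x0.
pose G m := if (m <= top)%R then gr c X m else submod0 (vect X).
have Gx : graded_sum G x.
  apply: graded_sumP; elim/X_ind: x {hx x0} => [|x y hx hy|m k w]; [exact: lspan0|exact: lspanD|].
  apply: lspan_incl; exists (top - 2 * k%:Z - m%:Z); rewrite /G ifT; first exact: mono_gr.
  lia.
have GT m v : G m v -> op sH v = (m%:~R + - (3 / 2)) *: v.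
  by rewrite /G; case: ifP => _; [exact: gr_h|move=> /= ->; rewrite op0 scaler0].
have [|m [w [h1 h2 h3]]] := graded_nonzero GT (S := gr c X n) _ Gx hx x0.
  by move=> v hv; apply: gr_op hv _; rewrite addr0.
move: h1; rewrite /G; case: ifP => [mt /gr_h h1|_ /h3//].
have : (m%:~R + - (3 / 2)) *: w = (n%:~R + - (3 / 2)) *: w by rewrite -h1 (gr_h h2).
move/eqP; rewrite -subr_eq0 -scalerBl scaler_eq0 subr_eq0 => /orP[/eqP /addIr /intr_inj mn|/eqP//].
by move: mt; rewrite mn leNgt hn.
Qed.

Lemma X_nilp : nilp X.
Proof.
move=> x; have kl D n v : gr c X n v -> (top < n + D%:Z)%R -> killed D v.
  elim: D n v => [|D IH] n v hv hn; first by rewrite addr0 in hn; exact: X_top hv hn.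
  by split; [apply: (IH (n + 2))|apply: (IH (n + 1))]; try (exact: gr_op hv _); lia.
elim/X_ind: x => [|x y [D hD] [D' hD']|m k w]; first by exists 0%N.
  exists (maxn D D'); rewrite -[x]scale1r; apply: killedP;
    [apply: killed_leq hD|apply: killed_leq hD']; by rewrite ?leq_maxl ?leq_maxr.
exists (2 * k + m).+1; apply: (kl _ _ _ (mono_gr c0 w erefl)); lia.
Qed.

(** The kernel of c d/dq consists of the constants in q, and among these the H-eigenvalue, fixed by
    the degree, singles out one chain space. *)
Lemma X_ker d (x : vect X) : gr c X d x -> op sP x = 0 -> x <> 0 ->
  exists k (w : N k), d = top - 2 * k%:Z /\ x = mon 0 w.
Proof.
move=> hx px x0; rewrite X_p in px; have ex := polP_ker c0 px.
set y := (x : P) 0%N in ex.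
have hy k : (top%:~R - 1 - 2 * k%:R - (d%:~R - 1)) *: y k = 0.
  have : oH c x = (d%:~R - 1) *: x by apply: oH_gr => //; rewrite X_p.
  rewrite X_oH X_scale => /(congr1 (fun z : P => z 0%N k)) /= e.
  by rewrite scalerBl e subrr.
have [[k yk]|h] := pselect (exists k, y k <> 0); last first.
  case: x0; rewrite ex; suff -> : y = 0 by rewrite linear0.
  by apply: dsum_eq => k; apply/notP => yk; apply: h; exists k.
have inj j : y j <> 0 -> d = top - 2 * j%:Z.
  move=> yj; have /eqP := hy j; rewrite scaler_eq0 => /orP[|/eqP//].
  rewrite subr_eq0 => /eqP e; apply: (@intr_inj K).
  by rewrite rmorphB rmorphM /= -[LHS](subrK 1) -e; ring.
exists k, (y k); split; first exact: inj.
rewrite ex /mono; congr dinj; apply: dsum_eq => j.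
have [e|kj] := eqVneq k j; first by case: j / e; rewrite dinj_in.
rewrite dinj_out //; apply/notP => yj; move: (inj _ yk) (inj _ yj) => -> e.
by move/eqP: kj; apply; lia.
Qed.

Lemma X_p_surj (x : vect X) : exists y, op sP y = x.
Proof. by have [y hy] := polP_surj (x : P) c0; exists y; rewrite X_p. Qed.

(** Beyond index [B] each chain space is the image under F of the previous one, and q raises the
    exponent, so the constants in q of index at most [B] generate the module. *)
Lemma X_generated (S : submod X) (B : nat) :
  (forall k, (B <= k)%N -> forall w, exists w', ch_F C k w' = w) ->
  (forall k (w : N k), (k <= B)%N -> S (mon 0 w)) -> forall x, S x.
Proof.
move=> hF hS; have S0k k (w : N k) : S (mon 0 w).
  case: (leqP k B) => kB; first exact: hS.
  elim: k kB w => // k IH kB w; have [w' <-] := hF k kB w.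
  rewrite -mono_F; apply: sub_oF; move: kB; rewrite leq_eqVlt ltnS => /orP[/eqP [e]|h]; last exact: IH.
  by apply: hS; rewrite -e.
apply: X_ind => [|x y|m k w]; [exact: sub0|exact: subD|].
by elim: m => // m IH; rewrite -mono_q; exact: sub_op.
Qed.

Lemma X_fg B : (forall k, (B <= k)%N -> forall w, exists w', ch_F C k w' = w) ->
  (forall k, (k <= B)%N -> fin_dim [set: N k]%classic) -> fin_generated X.
Proof.
move=> hF hd; apply/fin_generatedP.
have /choice [s hs] k : exists s : seq (vect X), (k <= B)%N ->
    forall w : N k, lspan (listed s) (mon 0 w).
  have [kB|//] := boolP (k <= B)%N; last by exists [::].
  have /fin_dimP [s hs] := hd k kB; exists (map (@mono K C c c0 0 k) s) => _ w.
  apply: (lspan_map (f := @mono K C c c0 0 k) (P := listed s)); last exact: hs.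
  by move=> u hu; apply/lspan_incl/map_f.
exists (flatten [seq s k | k <- iota 0 B.+1]) => x.
apply: (X_generated (S := span_submod _) hF) => k w kB.
elim: (hs k kB w) => [|a u v hu _ IH]; first exact: lspan0.
apply: lspanD => //; apply: (lspanZ (a%:A : U K)); apply: lspan_incl.
by apply/flattenP; exists (s k) => //; apply: map_f; rewrite mem_iota.
Qed.

Lemma X_O_xi B : (forall k, (B <= k)%N -> forall w, exists w', ch_F C k w' = w) ->
  (forall k, (k <= B)%N -> fin_dim [set: N k]%classic) -> O_xi (xi_c c) X.
Proof. by move=> h1 h2; apply/O_xiP; split; [exact: X_fg h1 h2|exact: X_gradable|exact: X_nilp]. Qed.
End ChainModuleMaps.

(** * Verma modules *)

Section TensorProduct.
Variables (A B : pzRingType) (phi : {rmorphism B -> A}) (M : lmodType B).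
Notation "a ** m" := (pure_tensor phi (M := M) a m) (at level 40).

Lemma pure_tensor_balanced a b m : (a * phi b) ** m = a ** (b *: m).
Proof. by apply/tens_piP/TEbalanced. Qed.
Lemma pure_tensor_scale a b m : a *: (b ** m) = (a * b) ** m.
Proof. exact: tens_scaleE. Qed.

Lemma tensor_ind (P : tens phi M -> Prop) : (forall a m, P (a ** m)) -> P 0 ->
  (forall x y, P x -> P y -> P (x + y)) -> (forall x, P x -> P (- x)) -> forall x, P x.
Proof.
move=> Pp P0 PD PN; elim/tens_ind; elim=> [a m||t ht u hu|t ht].
- exact: Pp.
- exact: P0.
- have -> : tens_pi phi (TAdd t u) = tens_pi phi t + tens_pi phi u by rewrite [RHS]tens_addE.
  exact: PD.
- have -> : tens_pi phi (TOpp t) = - tens_pi phi t by rewrite [RHS]tens_oppE.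
  exact: PN.
Qed.

Variables (N : lmodType A) (g : M -> N).
Hypothesis gD : forall u v, g (u + v) = g u + g v.
Hypothesis gZ : forall b u, g (b *: u) = phi b *: g u.

Fixpoint tensor_eval (t : tens_term A M) : N :=
  match t with
  | TPure a m => a *: g m
  | TZero => 0
  | TAdd t u => tensor_eval t + tensor_eval u
  | TOpp t => - tensor_eval t
  end.

Lemma tensor_eval_eq t u : tens_eq phi t u -> tensor_eval t = tensor_eval u.
Proof.
elim=> //=.
- by move=> ? ? ? _ -> _ ->.
- by move=> ? ? ? ? _ -> _ ->.
- by move=> ? ? _ ->.
- by move=> *; rewrite addrA.
- by move=> *; rewrite addrC.
- by move=> *; rewrite add0r.
- by move=> *; rewrite addNr.
- by move=> a a' m; rewrite scalerDl.
- by move=> a m m'; rewrite gD scalerDr.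
- by move=> a b m; rewrite gZ scalerA.
Qed.

Definition tensor_lift (x : tens phi M) : N := tensor_eval (repr x).

Lemma tensor_lift_pi t : tensor_lift (tens_pi phi t) = tensor_eval t.
Proof. by apply: tensor_eval_eq; apply/tens_piP; rewrite tens_reprK. Qed.

Lemma tensor_lift_linear : linear tensor_lift.
Proof.
move=> a; elim/tens_ind=> t; elim/tens_ind=> u.
rewrite [a *: _]tens_scaleE [_ + _ in LHS]tens_addE !tensor_lift_pi /=; congr (_ + _).
elim: t => /= [b m||t -> v ->|t ->].
- by rewrite scalerA.
- by rewrite scaler0.
- by rewrite scalerDr.
- by rewrite scalerN.
Qed.
HB.instance Definition _ := GRing.isLinear.Build A (tens phi M) N _ tensor_lift tensor_lift_linear.

Lemma tensor_lift_pure a m : tensor_lift (a ** m) = a *: g m.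
Proof. exact: tensor_lift_pi. Qed.
End TensorProduct.

Section VermaModules.
Variables (K : numFieldType) (lam : weight K).
Notation V := (verma lam).
Notation phi := (env_incl (@borel_lie K)).
Notation chi := (env_lift (LieRep (borel_char_lie lam))).

Definition vgen : V := pure_tensor phi 1 (1 : Cmod lam).

Lemma Cmod_scale b (m : Cmod lam) : b *: m = chi b * m.
Proof. by []. Qed.

Lemma chi_alg (m : K) : chi m%:A = m.
Proof. by rewrite linearZ rmorph1 /= /GRing.scale /= mulr1. Qed.

Lemma pureE a (m : K) : pure_tensor phi a (m : Cmod lam) = (m *: a) *: vgen.
Proof.
rewrite [RHS]pure_tensor_scale mulr1.
have -> : m *: a = a * phi m%:A by rewrite linearZ rmorph1 -scalerAr mulr1.
by rewrite [RHS]pure_tensor_balanced Cmod_scale chi_alg mulr1.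
Qed.

Lemma vgen_generates (x : V) : exists u, x = u *: vgen.
Proof.
elim/tensor_ind: x => [a m||x y [u ->] [v ->]|x [u ->]].
- by exists (m *: a); exact: pureE.
- by exists 0; rewrite scale0r.
- by exists (u + v); rewrite scalerDl.
- by exists (- u); rewrite scaleNr.
Qed.

Lemma sb_borel i : i \in [set sH; sZ; sE; sP] -> (sb K i : schr K) \in sm_pred (borel K).
Proof.
move=> hi; apply/sm_predP => j hj; rewrite ffunE; case: eqP => // e.
by move: hj; rewrite e hi.
Qed.

Lemma vgen_op i : i \in [set sH; sZ; sE; sP] ->
  op i (vgen : vect V) = wt_eval lam (sb K i) *: (vgen : vect V).
Proof.
move=> hi; have e : gen K i = 1 * phi (env_gen (Subm (sb_borel hi) : borelL K)).
  by rewrite mul1r /= env_lift_gen.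
have -> : op i (vgen : vect V) = pure_tensor phi (gen K i) (1 : Cmod lam).
  by rewrite [LHS]pure_tensor_scale mulr1.
rewrite e pure_tensor_balanced Cmod_scale env_lift_gen mulr1.
by rewrite pureE.
Qed.

Lemma vgen_hw : [/\ is_wt_vec lam vgen, op sE (vgen : vect V) = 0 & op sP (vgen : vect V) = 0].
Proof.
split; [apply/is_wt_vecE; split|..]; rewrite vgen_op ?inE // /wt_eval !ffunE /=;
  by rewrite ?mulr1 ?mulr0 ?addr0 ?add0r ?scale0r.
Qed.

Section VermaLift.
Variables (M : lmodType (U K)) (x : vect M).
Hypotheses (x_wt : is_wt_vec lam (x : M)) (xE : op sE x = 0) (xP : op sP x = 0).

Lemma borel_action b : phi b *: (x : M) = (chi b)%:A *: (x : M).
Proof.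
elim/env_closure: b => [y||a b ha hb|a b ha hb|a b hb].
- rewrite /= !env_lift_gen /= /sub_incl env_gen_sum sgen_sum.
  have yB : borel K (sm_val y) by apply/sm_predP/sm_valP.
  have y0 i : i \notin [set sH; sZ; sE; sP] -> (sm_val y : svec K) i = 0 := yB i.
  rewrite !(y0 sF, y0 sQ) ?inE // !scale0r !add0r !scalerDl.
  have E a i : (a *: gen K i) *: (x : M) = a *: op i x := alg_scale_mul a _ x.
  have /is_wt_vecE[hH hZ] := x_wt.
  rewrite (E _ sE) (E _ sH) (E _ sP) (E _ sZ) xE xP hH hZ.
  transitivity ((lam.1 * (sm_val y : svec K) sH) *: x + (lam.2 * (sm_val y : svec K) sZ) *: x);
    last by [].
  by lmod K (vect M); ring.
- by rewrite !rmorph1 !scale1r.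
- by rewrite !rmorphD !scalerDl ha hb.
- by rewrite !rmorphM /= -!scalerA hb alg_scaleC ha !scalerA -!scalerAl !mul1r mulrC -scalerA.
- rewrite !linearZ /= alg_scale_mul hb scalerA -scalerAl mul1r scalerA //.
Qed.

Lemma verma_lift : exists f : {linear V -> M}, f vgen = x.
Proof.
pose g (m : Cmod lam) : M := ((m : K)%:A : U K) *: (x : M).
have gD u v : g (u + v) = g u + g v by rewrite /g scalerDl scalerDl.
have gZ b u : g (b *: u) = phi b *: g u.
  by rewrite /g alg_scaleC borel_action Cmod_scale scalerA -scalerAl mul1r scalerA mulrC.
exists (HB.pack_for {linear V -> M} (@tensor_lift _ _ phi _ _ g : V -> M)
  (GRing.isLinear.Build (U K) V M _ (@tensor_lift _ _ phi _ _ g : V -> M) (tensor_lift_linear gD gZ))).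
by rewrite /= (tensor_lift_pure gD gZ) /g !scale1r.
Qed.
End VermaLift.
End VermaModules.

Lemma z_central (K : fieldType) (M : lmodType (U K)) (u : U K) (v : M) :
  gen K sZ *: (u *: v) = u *: (gen K sZ *: v).
Proof.
elim/U_closure: u v => [i||a b ha hb|a b ha hb|a b hb] v.
- exact: (op_z i v).
- by rewrite !scale1r.
- by rewrite !scalerDl scalerDr ha hb.
- by rewrite -!scalerA ha hb.
- by rewrite (alg_scale_mul a b v) (alg_scale_mul a b (gen K sZ *: v)) -hb alg_scaleC.
Qed.

Section Strings.
Variables (K : numFieldType) (c : K) (M : lmodType (U K)).
Hypothesis c0 : c != 0.
Hypothesis zc : forall v : vect M, op sZ v = c *: v.
Implicit Types v : vect M.
Notation Fi k v := (iter k (@oF K c M) v).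

Lemma eig_closed a : nilat (@casimir K c M) a 0 /\
  forall (u : U K) (v w : M), nilat (@casimir K c M) a v -> nilat (@casimir K c M) a w ->
    nilat (@casimir K c M) a (u *: v + w).
Proof.
have nP b u v : nilat (@casimir K c M) a u -> nilat (@casimir K c M) a v ->
  nilat (@casimir K c M) a (b *: u + v) by exact: nilatP.
apply: submod_of_ops => [|u v hu hv|b u hu|i u [k hk]].
- exact: nilat0.
- by have := nP 1 u v hu hv; rewrite scale1r.
- by have := nP b u 0 hu (nilat0 _ _); rewrite addr0.
exists k; have -> (x : vect M) : iter k (shifted (@casimir K c M) a) (op i x)
    = op i (iter k (shifted (@casimir K c M) a) x).
  elim: k {hk} => //= k ->; rewrite /shifted /= casimir_op //.
  by rewrite [RHS]opD opN opZ.
by rewrite hk op0.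
Qed.
Definition eig_submod a : submod M := @Submod (U K) M (nilat (@casimir K c M) a) (eig_closed a).

Lemma oF_iter_p k v : op sP v = 0 -> op sP (Fi k v) = 0.
Proof. by move=> h; elim: k => //= k; exact: p_oF. Qed.
Lemma oE_iter_p k v : op sP v = 0 -> op sP (iter k (@oE K c M) v) = 0.
Proof. by move=> h; elim: k => //= k; exact: p_oE. Qed.
Lemma oF_iter_gr k n m v : gr c M n v -> m = n - 2 * k%:Z -> gr c M m (Fi k v).
Proof.
clear zc c0; move=> hv; elim: k m => [|k IH] m ->; first by rewrite subr0.
apply: (gr_oF (n := n - 2 * k%:Z)); [exact: IH|lia].
Qed.
Lemma oE_iter_gr k n m v : gr c M n v -> m = n + 2 * k%:Z -> gr c M m (iter k (@oE K c M) v).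
Proof.
clear zc c0; move=> hv; elim: k m => [|k IH] m ->; first by rewrite addr0.
apply: (gr_oE (n := n + 2 * k%:Z)); [exact: IH|lia].
Qed.
Lemma oF_iterZ k a v : Fi k (a *: v) = a *: Fi k v.
Proof. by elim: k => //= k ->; rewrite oFZ. Qed.
Lemma oF_iterD k u v : Fi k (u + v) = Fi k u + Fi k v.
Proof. by elim: k => //= k ->; rewrite oFD. Qed.
Lemma oF_iter0 k : Fi k 0 = 0.
Proof. by elim: k => //= k ->; rewrite oF0. Qed.

Lemma oH_oF_iter n k v : gr c M n v -> op sP v = 0 ->
  oH c (Fi k v) = (n%:~R - 1 - 2 * k%:R) *: Fi k v.
Proof.
move=> hv pv; rewrite (oH_gr (oF_iter_gr (k := k) hv erefl) (oF_iter_p _ pv)).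
by congr (_ *: _); rewrite rmorphB rmorphM /=; ring.
Qed.

(** The sl2 formula for [E, F^(k+1)] at H-weight n - 1. The term with E v is kept, since v will also
    be a primitive vector of degree -i that E does not kill. *)
Lemma oE_oF_iter n k v : gr c M n v -> op sP v = 0 ->
  oE c (Fi k.+1 v) = Fi k.+1 (oE c v) + (k.+1%:R * (n%:~R - 1 - k%:R)) *: Fi k v.
Proof.
move=> hv pv; elim: k => [|k IH].
  rewrite /= (oEF c0 zc) (oH_gr hv pv); congr (_ + _ *: _); rewrite mul1r subr0 //.
rewrite iterS (oEF c0 zc) IH (oH_oF_iter k.+1 hv pv) oFD oFZ -!iterS.
by rewrite -!natr1; lmod K (vect M); ring.
Qed.

Lemma hw_oE n v : hw c n v -> oE c v = 0.
Proof. by move=> [_ ev pv]; rewrite oE_ker. Qed.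
End Strings.

Section VermaChain.
Variables (K : numFieldType) (c : K) (c0 : c != 0) (n : int).

Definition scalmap (V : lmodType K) (a : K) (v : V) : V := a *: v.
Lemma scalmap_linear V a : linear (@scalmap V a).
Proof. by move=> b u v; rewrite /scalmap; lmod K V; ring. Qed.
HB.instance Definition _ V a := GRing.isLinear.Build K V V _ (@scalmap V a) (@scalmap_linear V a).

Lemma verma_chain_EF k (x : K^o) :
  scalmap (k.+2%:R * (n%:~R - 1 - k.+1%:R)) x
  = scalmap (k.+1%:R * (n%:~R - 1 - k%:R)) x + (n%:~R - 1 - 2 * k.+1%:R) *: x.
Proof. by rewrite /scalmap -!natr1; lmod K (K^o : lmodType K); ring. Qed.
Lemma verma_chain_EF0 (x : K^o) :
  scalmap (1%:R * (n%:~R - 1 - 0%:R)) x = (n%:~R - 1) *: x.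
Proof. by rewrite /scalmap mul1r subr0. Qed.

(** The sl2 Verma module of highest H-weight n - 1 in the basis F^k v: F shifts the basis, and E has
    the coefficients of [oE_oF_iter]. *)
Definition verma_chain : chain K :=
  @Chain K n (fun=> K^o) (fun=> idfun) (fun k => scalmap (k.+1%:R * (n%:~R - 1 - k%:R)))
    verma_chain_EF0 verma_chain_EF.

Notation X := (chainU verma_chain c0).
Notation V := (verma (wt c n)).
Notation v0 := (vgen (wt c n) : vect V).
Notation x0 := (mono c0 0 (1 : ch_sp verma_chain 0)).

Lemma verma_z (v : vect V) : op sZ v = c *: v.
Proof.
have [u ->] := vgen_generates v; have [/is_wt_vecE[_ h] _ _] := vgen_hw (wt c n).
apply: etrans (alg_scaleC c u (v0 : V)).
by apply: (etrans (z_central u (v0 : V))); congr (u *: _); exact: h.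
Qed.

Lemma vgen_gr : hw c n v0.
Proof. by have [h1 h2 h3] := vgen_hw (wt c n). Qed.

Lemma verma_chain_hw : hw c n x0.
Proof.
split; first by apply: mono_gr; rewrite mulr0 !subr0.
  by rewrite (op_oE c) mono_E0 mono_p op0 scaler0 addr0.
exact: mono_p.
Qed.

(** This plays the part of the PBW theorem: it gives the Verma module the basis q^m F^k v. The two
    maps come from the universal properties of the two sides and are mutually inverse because they
    match the generators. *)
Lemma verma_iso : exists (f : {linear V -> X}) (g : {linear X -> V}),
  [/\ f v0 = x0, forall v, g (f v) = v & forall x, f (g x) = x].
Proof.
have [h1 h2 h3] := verma_chain_hw.
have [f hf] := verma_lift h1 h2 h3.
pose t_fun k (a : K^o) : vect V := a *: iter k (@oF K c V) v0.
have t_lin k : linear (t_fun k) by move=> a u v; rewrite /t_fun scalerDl scalerA.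
pose t k : {linear ch_sp verma_chain k -> vect V} :=
  HB.pack_for {linear K^o -> vect V} (t_fun k) (GRing.isLinear.Build K K^o (vect V) _ (t_fun k) (t_lin k)).
have [g1 g2 g3] := vgen_gr.
have [||||||g hg] := @chain_lift K verma_chain c c0 V t.
- exact: verma_z.
- by move=> k w; rewrite /= /t_fun opZ oF_iter_p ?scaler0 //; exact: verma_z.
- by move=> w; rewrite /= /t_fun oEZ /= (hw_oE vgen_gr) scaler0.
- move=> k w; rewrite /= /t_fun oEZ (oE_oF_iter c0 verma_z k g1 g3) (hw_oE vgen_gr) oF_iter0 add0r.
  by rewrite /scalmap scalerA mulrC.
- by move=> k w; rewrite /= /t_fun oFZ.
- move=> k w; rewrite /= /t_fun oHZ (oH_oF_iter c0 verma_z k g1 g3) !scalerA; congr (_ *: _).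
  by rewrite mulrC.
have gx0 : g x0 = v0 by rewrite hg /= /t_fun scale1r.
exists f, g; split => //.
- by move=> v; have [u ->] := vgen_generates v; rewrite !linearZ /= hf gx0.
have cl : f (g 0) = 0 /\ forall (a : U K) u v, f (g u) = u -> f (g v) = v ->
    f (g (a *: u + v)) = a *: u + v.
  by split=> [|a u v hu hv]; rewrite ?linear0 // !linearP hu hv.
apply: (@X_generated K verma_chain c c0 (Submod cl) 0) => [k _ w|k w]; first by exists w.
rewrite leqn0 => /eqP k0; move: k0 w => -> w /=.
have -> : mono c0 0 w = (w : K) *: (x0 : vect X).
  rewrite -[RHS](lmapZ (@mono K verma_chain c c0 0 0) (w : K)); congr (mono _ _ _).
  by rewrite /GRing.scale /= mulr1.
by rewrite (map_Z g) (map_Z f) gx0 hf.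
Qed.

Lemma verma_O_xi : O_xi (xi_c c) V.
Proof.
have [f [g [_ gf _]]] := verma_iso.
apply: (O_xi_surj (f := g)) => [v|]; first by exists (f v).
apply: (@X_O_xi K verma_chain c c0 0) => k _; first by move=> w; exists w.
by apply/fin_dimP; exists [:: 1 : K^o] => v _; rewrite -[v]mulr1; apply/lspanZ/lspan_incl; rewrite /listed inE.
Qed.

Lemma verma_cas : casM c V n.
Proof.
move=> v; have [u ->] := vgen_generates v; have [h1 h2 h3] := vgen_gr.
apply: (subU (S := eig_submod c0 verma_z _)); exists 1%N.
by rewrite /= /shifted /= (casimir_hw h1 h2 h3) subrr.
Qed.
End VermaChain.

Section Corestriction.
Variables (A : pzRingType) (M N : lmodType A) (S : submod N) (f : {linear M -> N}).
Hypothesis fS : forall x, S (f x).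
Lemma sub_corestr_proof x : f x \in sm_pred S. Proof. exact/sm_predP. Qed.
Definition sub_corestr (x : M) : subm S := Subm (sub_corestr_proof x).
Lemma sub_corestr_linear : linear sub_corestr.
Proof. by move=> a u v; apply: val_inj; exact: linearP. Qed.
HB.instance Definition _ := GRing.isLinear.Build A M (subm S) _ sub_corestr sub_corestr_linear.
End Corestriction.

Section VermaStructure.
Variables (K : numFieldType) (c : K) (c0 : c != 0).
Notation V n := (verma (wt c n)).
Notation v0 n := (vgen (wt c n) : vect (V n)).
Notation Fi n k v := (iter k (@oF K c (V n)) v).

Lemma verma_gradable n : gradable c (V n).
Proof. by have /O_xiP[] := verma_O_xi c0 n. Qed.
Lemma verma_nilp n : nilp (V n).
Proof. by have /O_xiP[] := verma_O_xi c0 n. Qed.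

Lemma vgen_sub n (S : submod (V n)) : S (v0 n) -> forall v, S v.
Proof. by move=> h v; have [u ->] := vgen_generates v; exact: subU. Qed.

Lemma verma_top n d (x : vect (V n)) : gr c (V n) d x -> (n < d)%R -> x = 0.
Proof.
move=> hx nd; have [f [g [_ gf _]]] := verma_iso c0 n.
rewrite -[x]gf; have -> : f x = 0; last by rewrite linear0.
exact: (X_top (map_gr f hx) nd).
Qed.

Lemma verma_ker n d (x : vect (V n)) : gr c (V n) d x -> op sP x = 0 -> x <> 0 ->
  exists k (a : K), d = n - 2 * k%:Z /\ x = a *: Fi n k (v0 n).
Proof.
move=> hx px x0; have [f [g [fv gf _]]] := verma_iso c0 n.
have [||k [w [dk fx]]] := X_ker (map_gr f hx).
- by rewrite -(map_op f) px linear0.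
- by move=> h; apply: x0; rewrite -[x]gf h linear0.
exists k, w; split => //; rewrite -[x]gf -[RHS]gf; congr (g _).
rewrite map_Z [f x]fx.
have -> : f (Fi n k (v0 n)) = mono c0 0 (1 : ch_sp (verma_chain K n) k).
  by elim: k {dk fx w} => [|k IH]; [exact: fv|rewrite iterS map_oF IH mono_F].
rewrite -[RHS](lmapZ (@mono K (verma_chain K n) c c0 0 k) (w : K)); congr (mono _ _ _).
by rewrite /GRing.scale /= mulr1.
Qed.

Lemma oF_vgen_neq0 n k : Fi n k (v0 n) <> 0.
Proof.
have [f [g [fv _ _]]] := verma_iso c0 n => h.
have e : f (Fi n k (v0 n)) = mono c0 0 (1 : ch_sp (verma_chain K n) k).
  by elim: k {h} => [|k IH]; [exact: fv|rewrite iterS map_oF IH mono_F].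
have : mono c0 0 (1 : ch_sp (verma_chain K n) k) = 0 by rewrite -e h linear0.
move=> /(congr1 (fun z : pol (chm (verma_chain K n)) => z 0%N k)).
rewrite /mono /cinj; have -> (y : chm (verma_chain K n)) : dinj (N := fun=> chm (verma_chain K n)) (i := 0) y 0%N = y.
  exact: dinj_in.
by rewrite dinj_in => /eqP; rewrite (negPf (oner_neq0 K)).
Qed.

Lemma vgen_neq0 n : v0 n <> 0. Proof. exact: (@oF_vgen_neq0 n 0). Qed.

Lemma verma_p_surj n (x : vect (V n)) : exists y, op sP y = x.
Proof.
have [f [g [_ gf _]]] := verma_iso c0 n; have [y hy] := X_p_surj (f x : vect (chainU (verma_chain K n) c0)).
by exists (g y); rewrite -(map_op g) hy gf.
Qed.

Lemma verma_hw_degree n d (x : vect (V n)) : hw c d x -> x <> 0 -> d = n \/ d = - n.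
Proof. by move=> hx x0; apply: (hw_degree hx x0); exact: verma_cas. Qed.

(** A nonzero submodule contains a highest weight vector, which lies in ker p and so is a multiple
    of F^k v. The Casimir element forces n - 2k to be n or -n, whence k = 0 or k = n. *)
Lemma verma_sub_hw n (S : submod (V n)) v : S v -> v <> 0 ->
  S (v0 n) \/ (exists k : nat, n = k.+1%:Z /\ S (Fi n k.+1 (v0 n))).
Proof.
move=> Sv vn0; have [m [x [hx x0 Sx]]] := sub_has_hw (@verma_gradable n) (@verma_nilp n) Sv vn0.
have [gx _ px] := hx; have [k [a [mk xk]]] := verma_ker gx px x0.
have a0 : a != 0 by apply/eqP => a0; apply: x0; rewrite xk a0 scale0r.
have Sk : S (Fi n k (v0 n)).
  have -> : Fi n k (v0 n) = a^-1 *: x by rewrite xk scalerA mulVf // scale1r.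
  exact: subZ.
case: k mk {xk} Sk => [|k] mk Sk; first by left.
by right; exists k; split => //; have [] := verma_hw_degree hx x0; lia.
Qed.

Lemma verma_simple n : (n <= 0)%R -> simple (V n).
Proof.
move=> n0; split; first by exists (v0 n); exact: vgen_neq0.
move=> S; have [[v [Sv vn0]]|h] := pselect (exists v, S v /\ v <> 0); last first.
  by left=> v Sv; apply/notP => vn0; apply: h; exists v.
right; apply: vgen_sub; have [//|[k [nk _]]] := verma_sub_hw Sv vn0.
by exfalso; move: n0; rewrite nk; lia.
Qed.

(** In degree n, E F^k v equals k (n - k) F^(k-1) v, which vanishes at n = k. *)
Lemma oF_vgen_hw (k : nat) : hw c (- k%:Z) (Fi k%:Z k (v0 k%:Z)).
Proof.
have [g1 g2 g3] := vgen_gr c k%:Z; have zc := verma_z (c := c) (n := k%:Z).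
have pF := oF_iter_p c0 zc k g3.
split => //; first by apply: (oF_iter_gr g1); lia.
rewrite -(oE_ker c pF); case: k g1 g2 g3 zc pF => [|k] g1 g2 g3 zc pF; first by rewrite oE_ker.
rewrite (oE_oF_iter c0 zc k g1 g3) (hw_oE (vgen_gr c _)) oF_iter0 add0r.
have -> : (k.+1%:Z)%:~R - 1 - k%:R = 0 :> K by rewrite -[_%:~R]/(k.+1%:R) -natr1; ring.
by rewrite mulr0 scale0r.
Qed.
End VermaStructure.

Section QuotientMap.
Variables (A : pzRingType) (M : lmodType A) (S : submod M).

Lemma quom_pi_eq0 v : quom_pi S v = 0 <-> S v.
Proof. by rewrite -[v in S v]subr0; apply: (iff_trans _ (quom_piP S v 0)); rewrite linear0. Qed.

Lemma quom_pi_surj (x : quom S) : exists v, quom_pi S v = x.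
Proof. by elim/quom_ind: x => v; exists v. Qed.
End QuotientMap.

Section VermaSequence.
Variables (K : numFieldType) (c : K) (c0 : c != 0).
Notation V n := (verma (wt c n)).
Notation v0 n := (vgen (wt c n) : vect (V n)).

Lemma verma_quotient_hw n (S : submod (V n)) (x : vect (quom S)) m :
  (forall u, S u -> exists2 y, S y & op sP y = u) ->
  hw c m x -> x <> 0 -> exists2 k : nat, m = n - 2 * k%:Z & exists a : K,
    x = quom_pi S (a *: iter k (@oF K c (V n)) (v0 n) : vect (V n)) :> quom S.
Proof.
move=> pS [hx ex px] x0.
have [v [gv pv vx]] := quotient_lift (verma_gradable c0 (n := n)) pS hx px.
have vn0 : v <> 0 by move=> v0'; apply: x0; rewrite -vx v0' linear0.
by have [k [a [mk vk]]] := verma_ker c0 gv pv vn0; exists k => //; exists a; rewrite -vk vx.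
Qed.

Variable i : nat.
Hypothesis i0 : (0 < i)%N.
Let n : int := i%:Z.

Lemma verma_emb_ex : exists f : {linear V (- n) -> V n},
  f (v0 (- n)) = iter i (@oF K c (V n)) (v0 n).
Proof. by have [h1 h2 h3] := oF_vgen_hw c0 i; apply: verma_lift. Qed.

Variable f : {linear V (- n) -> V n}.
Hypothesis fv : f (v0 (- n)) = iter i (@oF K c (V n)) (v0 n).
Notation N := (image_submod f).

Lemma verma_emb_inj : injective f.
Proof.
have [_ /(_ (kernel_submod f))[h|h]] := verma_simple c0 (n := - n) ltac:(lia).
  move=> x y e; apply/eqP; rewrite -subr_eq0; apply/eqP/h.
  by rewrite /= linearB e subrr.
have := h (v0 (- n)); rewrite /= fv => /(oF_vgen_neq0 c0) [].
Qed.

(** All degrees in the source are at most -n, hence below n; so the degree [n] component of an [x]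
    whose image is congruent to the generator is zero. *)
Lemma emb_top x (S : submod (V n)) : quom_pi S (f x) = quom_pi S (v0 n) -> S (v0 n).
Proof.
move=> e; pose g : {linear V (- n) -> quom S} := quom_pi S \o f.
have ge : g x = quom_pi S (v0 n) by [].
have gg : gr c (quom S) (n + 0) (vmap g x).
  by rewrite addr0 [vmap g x]ge; apply: (map_gr (quom_pi S)); have [] := vgen_gr c n.
have [m v||w gw wx] := @graded_lift K _ (gr c (quom S)) _ _ (@gr_h _ c _) _ (gr c (V (- n)))
  (vmap g) 0 n x _ _ gg.
- by rewrite addr0; exact: map_gr.
- exact/graded_sumP/(verma_gradable c0).
have w0 : w = 0 by apply: (verma_top c0 gw); rewrite /n; lia.
by apply/quom_pi_eq0; rewrite -ge -[g x]/(vmap g x) -wx w0; exact: (linear0 g).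
Qed.

Lemma emb_proper : ~ N (v0 n).
Proof.
move=> [x fx]; have : submod0 (V n) (v0 n) by apply: (@emb_top x); rewrite fx.
exact: (vgen_neq0 c0).
Qed.

Lemma emb_p_surj u : N u -> exists2 y, N y & op sP y = u.
Proof.
move=> [x <-]; have [y hy] := verma_p_surj c0 x.
by exists (f y); [exists y|rewrite -(map_op f) hy].
Qed.

(** A highest weight vector in a nonzero submodule is the class of a multiple of F^k v. The Casimir
    element leaves k = 0, where the submodule is everything, and k = i, where the class is zero. *)
Lemma emb_quotient_simple : simple (quom N).
Proof.
split; first by exists (quom_pi N (v0 n)) => /quom_pi_eq0; exact: emb_proper.
move=> S; have [[v [Sv vn0]]|h] := pselect (exists v, S v /\ v <> 0); last first.
  by left=> v Sv; apply/notP => vn0; apply: h; exists v.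
have gQ : gradable c (quom N) := gradable_surj (@quom_pi_surj _ _ N) (verma_gradable c0 (n := n)).
have nQ : nilp (quom N) := nilp_surj (@quom_pi_surj _ _ N) (verma_nilp c0 (n := n)).
have [m [x [hx x0 Sx]]] := sub_has_hw gQ nQ Sv vn0.
have [k mk [a xk]] := verma_quotient_hw emb_p_surj hx x0.
right; case: k mk xk => [|k] mk xk.
  have a0 : a != 0 by apply/eqP => a0; apply: x0; rewrite xk a0 scale0r linear0.
  have Sv0 : S (quom_pi N (v0 n)).
    have -> : quom_pi N (v0 n) = a^-1 *: x :> vect (quom N).
      by rewrite xk /= (map_Z (quom_pi N)) scalerA mulVf // scale1r.
    exact: subZ.
  by move=> y; have [w <-] := quom_pi_surj y; have [u ->] := vgen_generates w; rewrite linearZ; exact: subU.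
exfalso; have nilx : nilat (@casimir K c (quom N)) (n%:~R ^+ 2) x.
  have [y <-] := quom_pi_surj x; have [j hj] := verma_cas c0 y; exists j.
  have <- : quom_pi N (iter j (shifted (@casimir K c (V n)) (n%:~R ^+ 2)) y)
     = iter j (shifted (@casimir K c (quom N)) (n%:~R ^+ 2)) (quom_pi N y).
    elim: j {hj} => //= j IH; rewrite -IH /shifted /=.
    by rewrite map_D map_N map_Z map_casimir.
  by rewrite hj linear0.
have mn := hw_degree hx x0 nilx.
have ki : k.+1 = i by move: mn mk; rewrite /n; lia.
apply: x0; rewrite xk ki; apply/quom_pi_eq0; apply: (subZ (S := N)).
by exists (v0 (- n)).
Qed.

(** The image of [S] in the simple quotient is zero or everything. In the second case the generator
    lies in [S] up to the image of [f], hence in [S] by [emb_top]. *)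
Lemma sub_emb (S : submod (V n)) : ~ S (v0 n) -> forall v, S v -> N v.
Proof.
move=> Sv0 v Sv.
have Tcl : (exists2 s, S s & quom_pi N s = 0) /\ forall (a : U K) x y,
    (exists2 s, S s & quom_pi N s = x) -> (exists2 s, S s & quom_pi N s = y) ->
    exists2 s, S s & quom_pi N s = a *: x + y.
  split; first by exists 0; [exact: sub0|rewrite linear0].
  move=> a x y [s Ss <-] [t St <-]; exists (a *: s + t); last by rewrite linearP.
  exact: (sm_closed S).2.
have [_ /(_ (Submod Tcl))[h|h]] := emb_quotient_simple.
  by apply/quom_pi_eq0/h; exists v.
have [s Ss /quom_piP[x fx]] := h (quom_pi N (v0 n)).
case: Sv0; apply: (@emb_top (- x)); apply/quom_piP.
by rewrite linearN fx opprB addrC addKr; apply: (subN (S := S)).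
Qed.

Lemma verma_sub_cases (S : submod (V n)) : (forall v, S v -> v = 0) \/ (forall v, S v) \/
  (forall v, S v <-> N v).
Proof.
have [/vgen_sub h|Sv0] := pselect (S (v0 n)); first by right; left.
have SN := sub_emb Sv0.
have Tcl : S (f 0) /\ forall (a : U K) x y, S (f x) -> S (f y) -> S (f (a *: x + y)).
  by split=> [|a x y hx hy]; rewrite ?linear0; [exact: sub0|rewrite linearP; exact: (sm_closed S).2].
have [_ /(_ (Submod Tcl))[h|h]] := verma_simple c0 (n := - n) ltac:(lia).
  by left=> v Sv; have [x fx] := SN v Sv; rewrite -fx (h x) ?linear0 //= fx.
by right; right => v; split=> [/SN //|[x <-]]; exact: h.
Qed.

(** [simple_quotient] divides by a chosen submodule with simple quotient; uniqueness identifies the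
    choice with the image of [f]. *)
Lemma simple_quotient_emb (S : submod (V n)) : simple (quom S) -> forall v, S v <-> N v.
Proof.
move=> [[x x0] hS].
have Sv0 : ~ S (v0 n).
  move=> /vgen_sub h; apply: x0; have [v <-] := quom_pi_surj x.
  exact/quom_pi_eq0/h.
have [h|[h|//]] := verma_sub_cases S; last by case: Sv0; exact: h.
have Tcl : (exists2 s, N s & quom_pi S s = 0) /\ forall (a : U K) x y,
    (exists2 s, N s & quom_pi S s = x) -> (exists2 s, N s & quom_pi S s = y) ->
    exists2 s, N s & quom_pi S s = a *: x + y.
  split; first by exists 0; [exact: sub0|rewrite linear0].
  move=> a y z [s Ss <-] [t St <-]; exists (a *: s + t); last by rewrite linearP.
  exact: (sm_closed N).2.
have [hz|hz] := hS (Submod Tcl).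
  move=> v; split; first by move/h => ->; exact: sub0.
  by move=> Nv; apply/quom_pi_eq0/hz; exists v.
by have [s [y <-] fy] := hz (quom_pi S (v0 n)); case: Sv0; exact: emb_top fy.
Qed.

Lemma verma_not_simple : ~ simple (V n).
Proof.
move=> [_ /(_ N)[h|h]]; last by apply: emb_proper.
apply: (oF_vgen_neq0 c0 (n := n) (k := i)); rewrite -fv; apply: h; by exists (v0 (- n)).
Qed.

Lemma verma_exact : exists g : {linear V n -> simple_hw (wt c n)},
  short_exact f g /\ ~ split_epi g.
Proof.
set S0 := xget (submod0 (V n)) [set S : submod (V n) | simple (quom S)]%classic.
have S0N : forall v, S0 v <-> N v.
  apply: simple_quotient_emb.
  by have := @xgetPex _ (submod0 (V n)) [set S : submod (V n) | simple (quom S)]%classic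
    (ex_intro _ N emb_quotient_simple).
exists (quom_pi S0 : {linear V n -> quom S0}); split.
  split; [exact: verma_emb_inj|move=> y|exact: quom_pi_surj].
  by rewrite quom_pi_eq0; exact: S0N.
move=> [s hs].
have gv0 : quom_pi S0 (v0 n) <> 0 by move/quom_pi_eq0/S0N; exact: emb_proper.
(* A section gives an endomorphism of the Verma module. By degree it multiplies the generator by
   some [a], nonzero because the class of the generator is; yet it kills F^i of the generator, whose
   class is zero. *)
pose t : {linear V n -> V n} := s \o quom_pi S0.
have [g1 g2 g3] := vgen_gr c n.
have tv0 : t (v0 n) <> 0 by move=> h; apply: gv0; rewrite -(hs (quom_pi S0 (v0 n))) [s _]h linear0.
have [|k [a [hk tk]]] := verma_ker c0 (map_gr t g1) _ tv0.
  by rewrite -(map_op t) g3 linear0.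
have k0 : k = 0%N by move: hk; lia.
rewrite k0 /= in tk.
have tF j : t (iter j (@oF K c (V n)) (v0 n)) = a *: iter j (@oF K c (V n)) (v0 n) :> vect (V n).
  by elim: j => [|j IH]; [exact: tk|rewrite !iterS map_oF [t _]IH oFZ].
have := tF i; have -> : t (iter i (@oF K c (V n)) (v0 n)) = 0.
  rewrite /t /= (_ : quom_pi S0 _ = 0) ?linear0 //; apply/quom_pi_eq0/S0N.
  by exists (v0 (- n)).
move/esym/eqP; rewrite scaler_eq0 => /orP[/eqP a0|/eqP]; last exact: (oF_vgen_neq0 c0).
by apply: tv0; apply: (etrans tk); rewrite a0 scale0r.
Qed.
End VermaSequence.

(** * The Serre subcategory generated by two Verma modules *)

Lemma lspan_map_lift (A : pzRingType) (M N : lmodType A) (f : {linear M -> N}) (s : seq M) y :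
  lspan (listed (map f s)) y -> exists2 x, lspan (listed s) x & f x = y.
Proof.
elim=> [|a u v + _ [x hx <-]]; first by exists 0; [exact: lspan0|rewrite linear0].
by move=> /mapP[z zs ->]; exists (a *: z + x); [apply: lspanP|rewrite linearP].
Qed.

Section SerreClass.
Variables (K : numFieldType) (c : K) (c0 : c != 0).
Implicit Types M N : lmodType (U K).
Notation cas M := (@casimir K c M).

Lemma map_shifted M N (f : {linear M -> N}) a k (v : vect M) :
  f (iter k (shifted (cas M) a) v) = iter k (shifted (cas N) a) (f v : vect N).
Proof.
by elim: k => //= k IH; rewrite -IH /shifted /= map_D map_N map_Z map_casimir.
Qed.

Lemma casM_surj M N (f : {linear M -> N}) i :
  (forall y, exists x, f x = y) -> casM c M i -> casM c N i.
Proof.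
by move=> fs hM y; have [x <-] := fs y; have [k hk] := hM x; exists k; rewrite -map_shifted hk linear0.
Qed.

Lemma casM_inj M N (f : {linear M -> N}) i : injective f -> casM c N i -> casM c M i.
Proof.
by move=> fI hN x; have [k hk] := hN (f x); exists k; apply: fI; rewrite map_shifted hk linear0.
Qed.

Lemma casM_ext M1 M2 M3 (f : {linear M1 -> M2}) (g : {linear M2 -> M3}) i :
  short_exact f g -> casM c M1 i -> casM c M3 i -> casM c M2 i.
Proof.
move=> [_ ex _] h1 h3 v; have [k hk] := h3 (g v).
have /ex[x fx] : g (iter k (shifted (cas M2) (i%:~R ^+ 2)) v) = 0 by rewrite map_shifted.
have [l hl] := h1 x; exists (l + k)%N; rewrite iterD -fx -map_shifted hl; exact: linear0.
Qed.

Definition fin_gr M := forall n, fin_dim (gr c M n : set (vect M)).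

Lemma fin_gr_inj M N (f : {linear M -> N}) : injective f -> fin_gr N -> fin_gr M.
Proof.
move=> fI hN n; have /fin_dimP[s hs] := hN n; apply/fin_dimP.
have [|v hv|t _ ht] := @fin_dim_inj K (vect M) (vect N) (vmap f) (gr c M n) s.
- exact: fI.
- exact/hs/map_gr.
by exists t.
Qed.

Lemma gr_lift M N (g : {linear M -> N}) n (y : vect N) : gradable c M ->
  (exists x, g x = y) -> gr c N n y -> exists2 x : vect M, gr c M n x & g x = y.
Proof.
move=> gM [x <-] hy.
have [m v||w gw wx] := @graded_lift K _ (gr c N) _ _ (@gr_h _ c _) _ (gr c M) (vmap g) 0 n x _
  (graded_sumP (gM x)); rewrite ?addr0; try exact: map_gr.
  exact: hy.
by exists w.
Qed.

Lemma fin_gr_surj M N (g : {linear M -> N}) : gradable c M ->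
  (forall y, exists x, g x = y) -> fin_gr M -> fin_gr N.
Proof.
move=> gM gs hM n; have /fin_dimP[s hs] := hM n; apply/fin_dimP.
exists (map (vmap g) s) => y hy; have [x gx <-] := gr_lift gM (gs y) hy.
apply: (lspan_map (f := vmap g) (P := listed s)); last exact: hs.
by move=> u hu; apply/lspan_incl/map_f.
Qed.

Lemma fin_gr_ext M1 M2 M3 (f : {linear M1 -> M2}) (g : {linear M2 -> M3}) : gradable c M2 ->
  short_exact f g -> fin_gr M1 -> fin_gr M3 -> fin_gr M2.
Proof.
move=> gM [fI ex gs] h1 h3 n; have /fin_dimP[s1 hs1] := h1 n; have /fin_dimP[s3 hs3] := h3 n.
(* The vectors of [s3] may lie outside degree [n]; they are exchanged for vectors of degree [n],
   which have homogeneous lifts. *)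
have [|t3 ht3 h3'] := @fin_dim_inj K (vect M3) (vect M3) idfun (gr c M3 n) s3 _ hs3; first by [].
have [t2 [ht2 et2]] : exists t2, (forall x, x \in t2 -> gr c M2 n x) /\ map (vmap g) t2 = t3.
  elim: t3 ht3 {h3'} => [|y t IH] ht; first by exists [::].
  have [|t2 [h4 h5]] := IH; first by move=> z hz; apply: ht; rewrite in_cons hz orbT.
  have [|x gx xy] := gr_lift gM (gs y) (n := n); first by apply: ht; rewrite mem_head.
  exists (x :: t2); split=> [z|]; last by rewrite /= h5 [vmap g x]xy.
  by rewrite in_cons => /orP[/eqP -> //|/h4].
apply/fin_dimP; exists (t2 ++ map (vmap f) s1) => v hv.
have := h3' _ (map_gr g hv); rewrite -et2 => hgv.
have [u hu gu] := lspan_map_lift hgv.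
have gru : gr c M2 n u by apply: (lspan_min (S := gr c M2 n)) hu => x; exact: ht2.
have /ex[x fx] : g (v - u : vect M2) = 0 by rewrite map_D map_N -[g u]/(vmap g u) gu; exact: subrr.
have gx : gr c M1 n x.
  apply: (gr_inj fI); rewrite fx addrC -scaleN1r; exact: (sm_closed (gr c M2 n)).2.
have -> : v = u + vmap f x by rewrite [vmap f x]fx addrC subrK.
apply: lspanD; first by apply: (lspan_mono _ hu) => y hy; apply: lspan_incl; rewrite /listed mem_cat hy.
apply: (lspan_map (f := vmap f) (P := listed s1)) (hs1 x gx) => y hy.
by apply: lspan_incl; rewrite /listed mem_cat map_f ?orbT.
Qed.

(** A Serre class containing both Verma modules. Finite dimensional weight spaces are included
    because they too pass to subobjects, quotients and extensions; they make the functors of (iv)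
    and (v) take finite dimensional values. *)
Definition block_class (i : int) M : Prop := [/\ O_xi (xi_c c) M, casM c M i & fin_gr M].

Lemma block_class_serre i : is_serre (O_xi (xi_c c)) (block_class i).
Proof.
split=> [M []//|M1 M2 M3 f g T1 T2 T3 fg]; have [fI ex gs] := fg.
have /O_xiP[_ gM2 _] := T2.
split=> [[_ h1 h2]|[[_ h1 h2] [_ h3 h4]]].
  split; split => //.
  - exact: casM_inj fI h1.
  - exact: fin_gr_inj fI h2.
  - exact: casM_surj gs h1.
  - exact: fin_gr_surj gM2 gs h2.
split => //; first exact: casM_ext fg h1 h3.
exact: fin_gr_ext gM2 fg h2 h4.
Qed.

Lemma verma_fin_gr n : fin_gr (verma (wt c n)).
Proof.
have [f [g [_ gf _]]] := verma_iso c0 n.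
apply: (fin_gr_inj (f := f)) => [|d]; first exact: can_inj gf.
set C := verma_chain K n; pose X := chainU C c0.
pose mon m k : vect X := mono c0 m (1 : ch_sp C k).
pose Sd d' : submod (vect X) :=
  span_submod (fun v => exists m k : nat, d' = n - 2 * k%:Z - m%:Z /\ v = mon m k).
pose G d' := cap_submod (gr c X d') (Sd d').
have GX (x : vect X) : graded_sum G x.
  apply: graded_sumP; elim/X_ind: x => [|x y hx hy|m k w]; [exact: lspan0|exact: lspanD|].
  have -> : mono c0 m w = (w : K) *: mon m k.
    rewrite -[RHS](lmapZ (@mono K C c c0 m k) (w : K)); congr (mono _ _ _).
    by rewrite /GRing.scale /= mulr1.
  apply/lspanZ/lspan_incl; exists (n - 2 * k%:Z - m%:Z); split; first exact: mono_gr.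
  by apply: lspan_incl; exists m, k.
(* Monomials of degree d satisfy 2k + m = n - d, so both exponents are at most |n - d|, that is,
   less than [B]. *)
apply/fin_dimP; have [B BE] : exists B : nat, B = `|n - d|%N.+1 by eexists.
exists (flatten [seq [seq mon m k | m <- iota 0 B] | k <- iota 0 B]) => x hx.
have [m v||y [_ hy] /= <-] := @graded_lift K _ (gr c X) _ _ (@gr_h _ c _) _ G idfun 0 d x _ (GX x) _.
- by rewrite addr0 => -[].
- by rewrite addr0.
apply: lspan_mono hy => u [m [k [dk ->]]]; apply: lspan_incl.
apply/flattenP; exists [seq mon m k | m <- iota 0 B].
  by apply: map_f; rewrite mem_iota BE; lia.
by apply: map_f; rewrite mem_iota BE; lia.
Qed.

Lemma O_block_class i M : O_block (xi_c c) (wt c i) M -> block_class i M.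
Proof.
move=> h; apply: h; first exact: block_class_serre.
  by split; [exact: verma_O_xi|exact: verma_cas|exact: verma_fin_gr].
rewrite dot_refl_wt; split; [exact: verma_O_xi| |exact: verma_fin_gr].
by have := verma_cas c0 (n := - i); rewrite /casM mulrNz sqrrN.
Qed.

End SerreClass.

Section HighestWeightFiltration.
Variables (K : numFieldType) (c : K) (M : lmodType (U K)).

(** Modulo the submodule generated by its predecessors, each member is zero or a highest weight
    vector; the list encodes a filtration whose subquotients are quotients of Verma modules. *)
Definition filtered (s : seq M) := forall s1 x s2, s = s1 ++ x :: s2 ->
  [/\ exists n, gr c M n x, lspan (listed s1) (op sE x : M) & lspan (listed s1) (op sP x : M)].

Lemma filtered_rcons s x n : filtered s -> gr c M n x -> lspan (listed s) (op sE x : M) ->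
  lspan (listed s) (op sP x : M) -> filtered (rcons s x).
Proof.
move=> hs gx ex px s1 y s2; case/lastP: s2 => [|s2 z].
  by rewrite cats1 => /rcons_inj[<- <-]; split => //; exists n.
by rewrite -rcons_cons -rcons_cat => /rcons_inj[e _]; apply: hs e.
Qed.

Lemma lspan_listed_sub (s t : seq M) x : {subset s <= t} -> lspan (listed s) x -> lspan (listed t) x.
Proof. by move=> st; apply: lspan_mono => y /st hy; exact: lspan_incl. Qed.

Lemma filtered_orb s D n (v : vect M) : filtered s -> gr c M n v -> killed D v ->
  filtered (s ++ (orb D v : seq M)).
Proof.
elim: D s n v => [|D IH] s n v hs gv /=; first by rewrite cats0.
move=> [kE kP].
have h1 := IH s _ _ hs (gr_op (i := sE) gv erefl) kE.
have h2 := IH _ _ _ h1 (gr_op (i := sP) gv erefl) kP.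
have last_in j : killed D (op j v) -> lspan (listed (orb D (op j v) : seq M)) (op j v : M).
  case: (D) => [/= ->|D' _]; first exact: lspan0.
  by apply/lspan_incl/orb_id.
rewrite -!catA in h2 *; rewrite !catA cats1 -!catA.
apply: filtered_rcons h2 gv _ _.
  by apply: lspan_listed_sub (last_in _ kE) => y hy; rewrite !mem_cat hy orbT.
by apply: lspan_listed_sub (last_in _ kP) => y hy; rewrite !mem_cat hy !orbT.
Qed.

(** Generators are split into weight components, and each component is preceded by its images under
    words in e and p. *)
Lemma filtered_gen : fin_generated M -> gradable c M -> nilp M ->
  exists s, filtered s /\ forall v, lspan (listed s) v.
Proof.
move=> /fin_generatedP[g hg] gM nM.
have [l [hl lg]] : exists l : seq M, (forall x, x \in l -> exists n, gr c M n x) /\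
    forall v, v \in g -> lspan (listed l) (v : M).
  elim: g {hg} => [|v g [l [h1 h2]]]; first by exists [::].
  have [s [w [_ hw _ hv]]] := graded_sumP (gM v).
  exists ((map w s : seq M) ++ l); split=> [x|x].
    by rewrite mem_cat => /orP[/mapP[n _ ->]|/h1 //]; exists n.
  rewrite in_cons => /orP[/eqP ->|/h2 h]; last first.
    by apply: lspan_listed_sub h => y hy; rewrite mem_cat hy orbT.
  rewrite hv big_seq; apply: (lspan_sum (M := M)) => n ns; apply: lspan_incl.
  by rewrite /listed mem_cat map_f.
have [s [fs hs]] : exists s, filtered s /\ forall x, x \in l -> lspan (listed s) (x : M).
  elim: l hl {lg} => [|x l IH] hl; first by exists [::]; split => // -[].
  have [|s [h1 h2]] := IH; first by move=> y hy; apply: hl; rewrite in_cons hy orbT.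
  have [|n gx] := hl x; first exact: mem_head.
  have [D hD] := nM x.
  exists (s ++ (orb D.+1 x : seq M)); split; first by apply: filtered_orb gx (killed_leq (leqnSn D) hD).
  move=> y; rewrite in_cons => /orP[/eqP ->|/h2 h].
    by apply: lspan_incl; rewrite /listed mem_cat orb_id orbT.
  by apply: lspan_listed_sub h => z hz; rewrite mem_cat hz.
exists s; split => // v; apply: lspan_mono (hg v) => u /lg; apply: lspan_mono => x; exact: hs.
Qed.
End HighestWeightFiltration.

Section BlockCriterion.
Variables (K : numFieldType) (c : K) (c0 : c != 0) (i : nat).
Implicit Types M N : lmodType (U K).
Notation T := (O_xi (xi_c c)).
Notation V n := (verma (wt c n)).

(** Submodules of a Verma module are known explicitly: zero, everything, or the embedded Verma
    module. So each is a quotient of a Verma module and finitely generated, without a Noetherian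
    argument. *)
Lemma verma_sub_O_xi n (S : submod (V n)) : T (subm S).
Proof.
have from (N : lmodType (U K)) (g : {linear N -> V n}) : T N -> (forall x, S (g x)) ->
    (forall v, S v -> exists x, g x = v) -> T (subm S).
  move=> TN gS Sg; apply: (O_xi_surj (f := sub_corestr gS)) TN => -[v vS].
  by have [|x gx] := Sg v; [exact/sm_predP|exists x; apply: val_inj].
have zero : (forall v, S v -> v = 0) -> T (subm S).
  move=> h; apply: (from _ (\0 : {linear V n -> V n})) (verma_O_xi c0 n) _ _ => [x|v /h ->] /=.
    exact: sub0.
  by exists 0.
have all : (forall v, S v) -> T (subm S).
  by move=> h; apply: (from _ (idfun : {linear V n -> V n})) (verma_O_xi c0 n) _ _ => // v _; exists v.
case: (leP n 0) => n0.
  by have [_ /(_ S)[]] := verma_simple c0 n0.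
case: n n0 S from zero all => [[//|j] _|//] S from zero all.
have [f fv] := verma_emb_ex c0 j.+1.
have [|[|h]] := verma_sub_cases c0 (isT : 0 < j.+1)%N fv S => //.
apply: (from _ f) (verma_O_xi c0 _) _ _ => [x|v /h //].
by apply/h; exists x.
Qed.

Variable S : lmodType (U K) -> Prop.
Hypothesis Sserre : is_serre T S.
Hypotheses (S1 : S (V i)) (S2 : S (V (- i%:Z))).

(** A zero module is the kernel of the identity of a Verma module, and Serre classes are closed
    under kernels. *)
Lemma serre_zero M : T M -> (forall v : M, v = 0) -> S M.
Proof.
move=> TM hM; have TV := verma_O_xi c0 i.
have ex : short_exact (\0 : {linear M -> V i}) (idfun : {linear V i -> V i}).
  split => [x y _|y|y]; first by rewrite (hM x) (hM y).
    by split=> [/= ->|[x /= <-]//]; exists 0.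
  by exists y.
by have [/(_ S1)[]] := Sserre.2 _ _ _ _ _ TM TV TV ex.
Qed.

(** The submodule generated by [x] is a quotient of a Verma module of the block. Closure of [S]
    applies to exact sequences within O[xi], so the kernel must be placed there by
    [verma_sub_O_xi]. *)
Lemma serre_hw M n (x : vect M) (N : submod M) : hw c n x -> n = i \/ n = - i%:Z ->
  (forall v, N v <-> exists u : U K, v = u *: (x : M)) -> S (subm N) /\ T (subm N).
Proof.
move=> [gx ex px] hn hN; have [f fv] := verma_lift gx ex px.
have fN v : N (f v).
  by have [u ->] := vgen_generates v; rewrite linearZ /= fv; apply/hN; exists u.
pose g := sub_corestr fN.
have gs y : exists v, g v = y.
  case: y => v vN; have /hN[u vu] : N v by exact/sm_predP.
  by exists (u *: vgen (wt c n)); apply: val_inj; rewrite /= linearZ /= fv.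
have SV : S (V n) by case: hn => ->.
have TN : T (subm N) := O_xi_surj gs (verma_O_xi c0 n).
split => //.
have se : short_exact (sm_val (S := kernel_submod g)) g.
  split=> [|y|//]; first exact: val_inj.
  split=> [gy|[[x' xk] <-]]; last by have /sm_predP := xk.
  have yk : y \in sm_pred (kernel_submod g) by apply/sm_predP.
  by exists (Subm yk).
by have [/(_ SV)[]] := Sserre.2 _ _ _ _ _ (verma_sub_O_xi (kernel_submod g)) (verma_O_xi c0 n) TN se.
Qed.

(** Splitting off the submodule generated by the first member leaves a quotient with a shorter
    filtered list. The list [s] carries the length through the induction while [M] changes. *)
Lemma serre_filtered (s : seq nat) : forall M (l : seq M), size l = size s ->
  filtered c l -> (forall v, lspan (listed l) v) -> T M -> casM c M i -> S M.
Proof.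
elim: s => [|j s IH] M [|x l] //.
  move=> _ _ hM TM _; apply: serre_zero TM _ => v; elim: (hM v) => // a u w; by rewrite /listed in_nil.
move=> [sl] fl hl TM cM; have nil0 y : lspan (listed [::]) y -> y = 0 :> M by elim=> // a u w; rewrite /listed in_nil.
have [[n gx] /nil0 ex /nil0 px] := fl [::] x l erefl.
(* A zero member counts as a highest weight vector in every degree, so its degree is reset to
   [i]. *)
have [m [hwx hm]] : exists m, hw c m (x : vect M) /\ (m = i \/ m = - i%:Z).
  have [x0|x0] := eqVneq x 0; last first.
    by exists n; split => //; apply: (hw_degree (And3 gx ex px)); [exact/eqP|exact: cM].
  by exists i; split; [split => //; rewrite x0; exact: (sm_closed _).1|left].
have Ncl : (exists u : U K, (0 : M) = u *: x) /\ forall (a : U K) v w,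
    (exists u : U K, v = u *: x) -> (exists u : U K, w = u *: x) -> exists u : U K, a *: v + w = u *: x.
  split; first by exists 0; rewrite scale0r.
  by move=> a v w [u ->] [u' ->]; exists (a * u + u'); rewrite scalerDl scalerA.
pose N : submod M := Submod Ncl.
have [SN TN] : S (subm N) /\ T (subm N) by apply: serre_hw hwx hm _.
have TQ : T (quom N) := O_xi_surj (@quom_pi_surj _ _ N) TM.
have px0 : quom_pi N x = 0 by apply/quom_pi_eq0; exists 1; rewrite scale1r.
have proj t y : lspan (listed (x :: t)) y -> lspan (listed (map (quom_pi N) t)) (quom_pi N y).
  apply: (lspan_map (f := quom_pi N)) => u; rewrite /listed in_cons => /orP[/eqP ->|hu].
    by rewrite /= px0; exact: lspan0.
  exact/lspan_incl/map_f.
have SQ : S (quom N).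
  apply: (IH _ (map (quom_pi N) l)) TQ _ => [||v|].
  - by rewrite size_map.
  - move=> s1 y s2 e.
    have [t1 [z [t2 [el e1 e2]]]] : exists t1 z t2,
        [/\ l = t1 ++ z :: t2, map (quom_pi N) t1 = s1 & quom_pi N z = y].
      have hs : (size s1 < size l)%N by rewrite -(size_map (quom_pi N)) e size_cat /= -addSnnS leq_addr.
      exists (take (size s1) l), (nth 0 l (size s1)), (drop (size s1).+1 l); split.
      - by rewrite -drop_nth // cat_take_drop.
      - by rewrite map_take e take_size_cat.
      - by rewrite -(nth_map 0 0) // e nth_cat ltnn subnn.
    have [[d gz] ez pz] := fl (x :: t1) z t2 (congr1 (cons x) el).
    rewrite -e1 -e2; split; first by exists d; exact: map_gr.
    + by rewrite -map_op; exact: proj.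
    + by rewrite -map_op; exact: proj.
  - by have [w <-] := quom_pi_surj v; exact: proj.
  - exact: casM_surj (@quom_pi_surj _ _ N) cM.
have se : short_exact (sm_val (S := N)) (quom_pi N).
  split=> [|y|y]; [exact: val_inj| |exact: quom_pi_surj].
  split=> [/quom_pi_eq0 Ny|[[v vN] <-]]; last by apply/quom_pi_eq0; exact/sm_predP.
  have yN : y \in sm_pred N by apply/sm_predP.
  by exists (Subm yN).
by have [_] := Sserre.2 _ _ _ _ _ TN TM TQ se; apply.
Qed.
End BlockCriterion.

(** Left to right, [block_class] is one of the Serre classes being intersected. Right to left, the
    filtration builds [M] by extensions inside any such class. *)
Lemma O_blockP (K : numFieldType) (c : K) (c0 : c != 0) (i : nat) (M : lmodType (U K)) :
  O_block (xi_c c) (wt c i) M <-> O_xi (xi_c c) M /\ casM c M i.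
Proof.
split=> [/(O_block_class c0)[]//|[TM cM] S hS S1 S2]; rewrite dot_refl_wt in S2.
have /O_xiP[h1 h2 h3] := TM; have [l [fl hl]] := filtered_gen h1 h2 h3.
apply: (serre_filtered c0 hS S1 S2 (s := nseq (size l) 0%N)) fl hl TM cM.
by rewrite size_nseq.
Qed.

Lemma linear_inverse (A : pzRingType) (M N : lmodType A) (f : {linear M -> N}) :
  injective f -> (forall y, exists x, f x = y) ->
  exists g : {linear N -> M}, (forall x, g (f x) = x) /\ (forall y, f (g y) = y).
Proof.
move=> fI /choice[g gK]; have gL : linear g.
  by move=> a u v; apply: fI; rewrite linearP !gK.
exists (HB.pack_for {linear N -> M} g (GRing.isLinear.Build A N M _ g gL)).
by split=> [x|y] /=; [apply: fI; rewrite gK|exact: gK].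
Qed.

Lemma mod_iso (A : pzRingType) (M N : lmodType A) (f : {linear M -> N}) :
  injective f -> (forall y, exists x, f x = y) -> @is_iso (Mod A) M N f.
Proof.
move=> fI fs; have [g [gf fg]] := linear_inverse fI fs.
by exists g; split; apply: linear_eq.
Qed.

(** * Decomposition by generalised eigenspaces of the Casimir element *)

Section PolynomialsInCasimir.
Variables (K : fieldType) (V : lmodType K) (T : {linear V -> V}).
Fixpoint shifts (s : seq K) (v : V) : V := if s is a :: s' then shifts s' (shifted T a v) else v.
Lemma shifts_linear s : linear (shifts s).
Proof. by elim: s => [|a s IH] b u v //=; rewrite linearP IH. Qed.
HB.instance Definition _ s := GRing.isLinear.Build K V V _ (shifts s) (shifts_linear s).
Lemma shifts_shiftedC s a v : shifts s (shifted T a v) = shifted T a (shifts s v).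
Proof. by elim: s v => //= b s IH v; rewrite -IH shiftedC. Qed.
Lemma shiftsC s t v : shifts s (shifts t v) = shifts t (shifts s v).
Proof. by elim: s v => //= a s IH v; rewrite -IH (shifts_shiftedC t). Qed.
Lemma shifts_cat s t v : shifts (s ++ t) v = shifts t (shifts s v).
Proof. by elim: s v => /=. Qed.

Lemma nilat_iter a b k v : nilat T a v -> nilat T a (iter k (shifted T b) v).
Proof. by move=> [l hl]; exists l; elim: k => //= k IH; rewrite iter_shiftedC IH linear0. Qed.

(** A power of T - x n kills the last summand; by induction it kills the others too, and these then
    vanish by [nilat_inter]. *)
Lemma nilat_indep (x : nat -> K) n (w : nat -> V) : injective x ->
  (forall i, nilat T (x i) (w i)) -> \sum_(i < n) w i = 0 -> forall i, (i < n)%N -> w i = 0.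
Proof.
move=> xI; elim: n w => // n IH w hw; rewrite big_ord_recr /= => hs.
have [k hk] := hw n.
have wn i : (i < n)%N -> w i = 0.
  move=> iN; have := IH (fun i => iter k (shifted T (x n)) (w i)) _ _ i iN => h.
  apply: (nilat_inter (a := x i) (b := x n) (T := T)); last 1 first.
  - exists k; apply: h => [j|]; first exact: nilat_iter.
    have iterD_ a b : iter k (shifted T (x n)) (a + b) = iter k (shifted T (x n)) a + iter k (shifted T (x n)) b.
      by rewrite -[a]scale1r iter_shiftedP !scale1r.
    transitivity (iter k (shifted T (x n)) (\sum_(i < n) w i + w n)); last by rewrite hs iter_shifted0.
    rewrite iterD_ hk addr0; elim: (index_enum _) => [|j r IHr]; first by rewrite !big_nil iter_shifted0.
    by rewrite !big_cons iterD_ IHr.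
  - by apply/eqP => /xI e; rewrite e ltnn in iN.
  - exact: hw.
move=> i; rewrite ltnS leq_eqVlt => /orP[/eqP ->|/wn //].
by move: hs; rewrite big1 ?add0r // => j _; exact: wn.
Qed.
End PolynomialsInCasimir.

Section BlockDecomposition.
Variables (K : numFieldType) (c : K) (c0 : c != 0).
Implicit Types M N : lmodType (U K).
Notation cas M := (@casimir K c M).
Definition sq (i : nat) : K := i%:Z%:~R ^+ 2.

Lemma sq_inj : injective sq.
Proof.
clear c0; move=> i j /eqP; rewrite eqf_sqr => /orP[/eqP /intr_inj []//|/eqP].
by rewrite -mulrNz => /intr_inj; lia.
Qed.

Lemma casimir_gr M n (v : vect M) : (forall v : vect M, op sZ v = c *: v) ->
  gr c M n v -> gr c M n (casimir c v).
Proof.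
move=> zc /grE[h1 h2]; apply/grE; rewrite -!(casimir_op c0 zc) h1 h2.
by split; exact: (lmapZ (@casimir K c M)).
Qed.

(** If the products for s and t kill e v and p v, then both together send [v] to a vector of degree
    [n] killed by e and p, and one more factor, for n^2, finishes. The index |n| appears because
    [sq] takes natural numbers. *)
Lemma killed_shifts M D n (v : vect M) : gradable c M -> gr c M n v -> killed D v ->
  exists s, shifts (cas M) (map sq s) v = 0.
Proof.
move=> gM; have zc (x : vect M) := gradable_z x gM.
have sop i a (x : vect M) : shifted (cas M) a (op i x) = op i (shifted (cas M) a x).
  by rewrite /shifted /= casimir_op // [RHS]opD opN opZ.
have Sop i s (x : vect M) : shifts (cas M) s (op i x) = op i (shifts (cas M) s x).
  by elim: s x => //= a s IH x; rewrite sop IH.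
have sgr s m (x : vect M) : gr c M m x -> gr c M m (shifts (cas M) s x).
  elim: s x => //= a s IH x hx; apply: IH; rewrite /shifted addrC -scaleNr.
  apply: (sm_closed (gr c M m)).2 => //; exact: casimir_gr.
elim: D n v => [|D IH] n v gv /=; first by exists [::].
move=> [/(IH _ _ (gr_op gv erefl))[s hs] /(IH _ _ (gr_op gv erefl))[t ht]].
exists (s ++ t ++ [:: `|n|%N]); rewrite !map_cat !shifts_cat /=.
set x := shifts _ _ _.
have gx : gr c M n x by apply/sgr/sgr.
have ex : op sE x = 0 by rewrite /x -!Sop hs linear0.
have px : op sP x = 0 by rewrite /x shiftsC -!Sop ht linear0.
have e : sq `|n|%N = n%:~R ^+ 2 by case: (n) => m //; rewrite /sq NegzE abszN mulrNz sqrrN.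
by rewrite /shifted /= (casimir_hw gx ex px) e subrr.
Qed.

Section Decompose.
Variable M : lmodType (U K).
Hypothesis TM : O_xi (xi_c c) M.

Let gM : gradable c M. Proof. by have /O_xiP[] := TM. Qed.
Let nM : nilp M. Proof. by have /O_xiP[] := TM. Qed.
Let zc (v : vect M) : op sZ v = c *: v. Proof. exact: gradable_z. Qed.

Definition comp (i : nat) : lmodType (U K) := subm (eig_submod c0 zc (sq i)).
Definition theta : dsum comp -> M := dlift (fun i => sm_val (S := eig_submod c0 zc (sq i))).
HB.instance Definition _ := GRing.Linear.copy theta (dlift (fun i => sm_val (S := eig_submod c0 zc (sq i)))).

Lemma theta0 : theta 0 = 0. Proof. exact: linear0. Qed.
Lemma thetaD x y : theta (x + y) = theta x + theta y. Proof. exact: linearD. Qed.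
Lemma thetaB x y : theta (x - y) = theta x - theta y. Proof. exact: linearB. Qed.

Lemma comp_nilat i (y : comp i) : nilat (cas M) (sq i) (sm_val y).
Proof. by case: y => y /= /sm_predP. Qed.

Lemma theta_dinj i (y : comp i) : theta (dinj y) = sm_val y.
Proof. exact: dlift_dinj. Qed.

Lemma theta_inj : injective theta.
Proof.
move=> x y e; apply/eqP; rewrite -subr_eq0; apply/eqP; have {e} : theta (x - y) = 0 by rewrite thetaB e subrr.
move: (x - y) => {x y} x; have [n hn] := ds_fin x.
rewrite /theta (dliftE _ hn) => hs; apply: dsum_eq => i; case: (ltnP i n) => [iN|/hn //].
apply: val_inj.
exact: (nilat_indep (V := vect M) (w := fun i => sm_val (x i)) sq_inj (fun i => comp_nilat (x i)) hs).
Qed.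

(** Induction on the factors. If (T - a) v = theta x, choose u so that (T - a) (theta u) agrees with
    theta x up to generalised a-eigenvectors; this is possible because T - a is onto on the other
    eigenspaces. Then v - theta u is a generalised a-eigenvector. *)
Lemma theta_surj (y : M) : exists x, theta x = y.
Proof.
have all_in s (v : vect M) : shifts (cas M) (map sq s) v = 0 -> exists x, theta x = v.
  elim: s v => [|a s IH] v /=; first by move=> ->; exists 0; exact: theta0.
  move=> /IH[x hx].
  have [u hu] : exists u, nilat (cas M) (sq a) ((theta x : vect M) - shifted (cas M) (sq a) (theta u : vect M)).
    elim/dsum_ind: x {hx} => [|x x' [u hu] [u' hu']|i z].
    - exists 0; rewrite theta0 (lmap0 (shifted _ _)) subr0; exact: nilat0.
    - exists (u + u'); have := nilatP 1 hu hu'; rewrite scale1r; congr (nilat _ _ _).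
      rewrite !thetaD. rewrite (lmapD (shifted (cas M) (sq a)) (theta u) (theta u')). by rewrite [in RHS]opprD [LHS]addrACA.
    have [e|ia] := eqVneq i a.
      exists 0; rewrite theta0 (lmap0 (shifted _ _)) subr0 theta_dinj -e; exact: comp_nilat.
    have [|w hw ew] := @nilat_shift_surj K (vect M) (cas M) (sq i) (sq a) (sm_val z) _ (comp_nilat z).
      by apply/eqP => /sq_inj /eqP; rewrite (negPf ia).
    have ws : w \in sm_pred (eig_submod c0 zc (sq i)) by apply/sm_predP.
    exists (dinj (N := comp) (Subm ws)); rewrite !theta_dinj.
    by rewrite [shifted _ _ _]ew subrr; exact: nilat0.
  have hv : nilat (cas M) (sq a) (v - (theta u : vect M)).
    by apply: nilat_unshift; rewrite (lmapD (shifted _ _)) (lmapN (shifted _ _)) /= -hx.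
  have vs : v - (theta u : vect M) \in sm_pred (eig_submod c0 zc (sq a)) by apply/sm_predP.
  exists (dinj (N := comp) (Subm vs) + u); rewrite thetaD theta_dinj; exact: (subrK (theta u : vect M)).
have [s [w [_ hw _ ->]]] := graded_sumP (gM y).
apply: (big_ind (fun v : vect M => exists x, theta x = v)) => [|u v [x <-] [x' <-]|n _].
- by exists 0; exact: theta0.
- by exists (x + x'); exact: thetaD.
have [D hD] := nM (w n); have [t ht] := killed_shifts gM (hw n) hD.
exact: all_in ht.
Qed.

(** As a quotient of [M], and not merely a submodule, the component inherits finite generation. *)
Lemma comp_surj i : exists g : {linear M -> comp i}, forall y, exists x, g x = y.
Proof.
have [t [h1 h2]] := linear_inverse theta_inj theta_surj.
exists (dproj i \o t) => y; exists (theta (dinj y)); rewrite /= h1; exact: dinj_in.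
Qed.

Lemma comp_block (i : nat) : O_block (xi_c c) (wt c i) (comp i).
Proof.
have [g gs] := comp_surj i; apply/(O_blockP c0); split; first exact: O_xi_surj gs TM.
move=> y; have [k hk] := comp_nilat y; exists k; apply: val_inj.
by rewrite /= map_shifted.
Qed.

Lemma comp_zero : exists n, forall i, (n <= i)%N -> forall y : comp i, y = 0.
Proof.
have [t [h1 h2]] := linear_inverse theta_inj theta_surj.
have /O_xiP[/fin_generatedP[s hs] _ _] := TM.
have [n hn] : exists n, forall x, x \in s -> forall i, (n <= i)%N -> t x i = 0.
  elim: s {hs} => [|x s [n hn]]; first by exists 0%N.
  have [m hm] := ds_fin (t x); exists (maxn m n) => y; rewrite in_cons => /orP[/eqP ->|ys] i.
    by rewrite geq_max => /andP[/hm].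
  by rewrite geq_max => /andP[_]; exact: hn.
exists n => i ni y; have -> : y = dproj i (t (theta (dinj y))) by rewrite h1; exact/esym/dinj_in.
elim: (hs (theta (dinj y))) => [|a u v us _ IH]; first exact: (linear0 (dproj i \o t)).
have -> : dproj i (t (a *: u + v)) = a *: dproj i (t u) + dproj i (t v).
  exact: (linearP (dproj i \o t)).
by rewrite IH [dproj i _]hn // scaler0 addr0.
Qed.
End Decompose.
End BlockDecomposition.

Lemma zero_obj_eq0 (A : pzRingType) (T : lmodType A -> Prop) (M : @full_sub (Mod A) T) :
  is_zero_obj M -> forall v : (sval M : lmodType A), v = 0.
Proof.
move=> /(_ M)[[f hf] _] v; have h1 := hf (mod_id (sval M)).
have h2 := hf (\0 : {linear (sval M : lmodType A) -> (sval M : lmodType A)}).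
have e : mod_id (sval M : lmodType A) = \0 by rewrite h1 h2.
by have := congr1 (fun g : {linear _ -> _} => g v) e.
Qed.

Lemma zero_objP (A : pzRingType) (T : lmodType A -> Prop) (M : @full_sub (Mod A) T) :
  (forall v : (sval M : lmodType A), v = 0) -> is_zero_obj M.
Proof.
move=> h N; split.
  exists (\0 : {linear (sval M : lmodType A) -> (sval N : lmodType A)}) => g.
  by apply: linear_eq => v; rewrite (h v) !linear0.
exists (\0 : {linear (sval N : lmodType A) -> (sval M : lmodType A)}) => g.
by apply: linear_eq => v; rewrite [LHS]h [RHS]h.
Qed.

Section Blocks.
Variables (K : numFieldType) (c : K) (c0 : c != 0).
Notation xi := (xi_c c).
Notation B := (blocks_cat xi (fun i : nat => wt c i)).

Lemma dsum_O_xi (M : nat -> lmodType (U K)) n : (forall i, O_xi xi (M i)) ->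
  (forall i, (n <= i)%N -> forall v : M i, v = 0) -> O_xi xi (dsum M).
Proof.
move=> TM M0; apply/O_xiP; split.
- have /choice[s hs] i : exists s : seq (dsum M), forall v : M i, lspan (listed s) (dinj v).
    have /O_xiP[/fin_generatedP[s hs] _ _] := TM i.
    exists (map (@dinj _ M i) s) => v; apply: (lspan_map (P := listed s)) (hs v) => u hu.
    exact/lspan_incl/map_f.
  apply/fin_generatedP; exists (flatten [seq s i | i <- iota 0 n]).
  elim/dsum_ind => [|x y|i v]; [exact: lspan0|exact: lspanD|].
  case: (ltnP i n) => [iN|/M0 /(_ v) ->]; last by rewrite linear0; exact: lspan0.
  apply: lspan_mono (hs i v) => u hu; apply: lspan_incl; apply/flattenP.
  by exists (s i) => //; apply: map_f; rewrite mem_iota.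
- elim/dsum_ind => [|x y|i v]; [exact: lspan0|exact: lspanD|].
  have /O_xiP[_ gM _] := TM i.
  apply: (lspan_map (f := vmap (@dinj _ M i)) (P := fun w => exists n, gr c _ n w)) (gM v).
  by move=> u [d hd]; apply: lspan_incl; exists d; exact: map_gr.
- elim/dsum_ind => [|x y [D hD] [D' hD']|i v]; first by exists 0%N.
    exists (maxn D D'); have := killedP 1 (killed_leq (leq_maxl D D') hD) (killed_leq (leq_maxr D D') hD').
    by rewrite scale1r.
  have /O_xiP[_ _ nM] := TM i; have [D hD] := nM v.
  by exists D; exact: map_killed.
Qed.

Lemma blocks_sum_O_xi (M : B) : O_xi xi (blocks_sum xi (fun i : nat => wt c i) M).
Proof.
case: M => M [n hn]; apply: (@dsum_O_xi (fun i => sval (M i)) n) => [i|i ni v].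
  by have /(O_blockP c0)[] := svalP (M i).
exact: zero_obj_eq0 (hn i ni) v.
Qed.

Lemma cross_zero (i j : nat) (M N : lmodType (U K)) (f : {linear M -> N}) :
  casM c M i -> casM c N j -> i != j -> forall v, f v = 0.
Proof.
move=> cM cN ij v; have [k hk] := cM v.
apply: (nilat_inter (V := vect N) (T := @casimir K c N) (a := sq K i) (b := sq K j)).
- by apply/eqP => /(@sq_inj K) e; rewrite e eqxx in ij.
- by exists k; have := map_shifted c f (sq K i) k v; rewrite hk linear0 => /esym.
- exact: cN.
Qed.

(** Maps between distinct blocks vanish by [cross_zero], so every map of direct sums is diagonal;
    essential surjectivity is the isomorphism [theta]. *)
Lemma block_decomposition :
  is_equivalence (corestrict blocks_sum_O_xi : functor B (O_xi_cat xi)).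
Proof.
apply: equivalence_of_full_faithful_surj.
- move=> M N g.
  pose f i : {linear (sval (sval M i) : lmodType (U K)) -> (sval (sval N i) : lmodType (U K))} :=
    dproj i \o (g : {linear dsum (fun i => sval (sval M i)) -> dsum (fun i => sval (sval N i))})
      \o @dinj _ (fun i => sval (sval M i)) i.
  exists f; apply: linear_eq; apply: dsum_linear_eq => i y; apply: dsum_eq => j /=.
  have [e|ij] := eqVneq i j.
    by case: j / e; rewrite dinj_fun_in.
  rewrite dinj_fun_out // [LHS](linear0 (f j)); symmetry.
  have /(O_blockP c0)[_ cM] := svalP (sval M i).
  have /(O_blockP c0)[_ cN] := svalP (sval N j).
  exact: (cross_zero (dproj j \o (g : {linear dsum (fun i => sval (sval M i)) ->
    dsum (fun i => sval (sval N i))}) \o @dinj _ (fun i => sval (sval M i)) i) cM cN ij y).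
- move=> M N f g fg; apply: functional_extensionality_dep => i; apply: linear_eq => v.
  have := congr1 (fun h : {linear dsum (fun i => sval (sval M i)) -> dsum (fun i => sval (sval N i))} =>
    h (dinj (N := fun i => sval (sval M i)) (i := i) v) i) fg.
  by rewrite /= dinj_fun_in.
- move=> [M TM]; have [n hn] := comp_zero c0 TM.
  pose D i : O_block_cat xi (wt c i%:Z) := exist _ (comp c0 TM i) (@comp_block K c c0 M TM i).
  have Dz : exists n, forall i, (n <= i)%N -> is_zero_obj (D i).
    by exists n => i ni; apply: zero_objP; exact: hn.
  exists (exist _ D Dz : B), (@theta K c c0 M TM : {linear dsum (comp c0 TM) -> M}).
  exact: (mod_iso (@theta_inj _ _ c0 M TM) (@theta_surj K c c0 M TM)).
Qed.
End Blocks.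

(** * Modules built from quiver representations *)

Section QuiverChain.
Variables (K : numFieldType) (i : nat) (V2 V1 : lmodType K).
Variables (a : {linear V1 -> V2}) (b : {linear V2 -> V1}).
Hypothesis ab0 : forall v, a (b v) = 0.
(** For i = 0 the space V1 starts the chain, and there FE, which is b a, must vanish. *)
Hypothesis ba0 : i = 0%N -> forall v, b (a v) = 0.

(* t = (k < i): the k-th space of the chain is V2 above the middle and V1 from k = i on; a and b
   are the raising and lowering maps across the middle. *)
Definition qW (t : bool) : lmodType K := if t then V2 else V1.

Definition qF (t t' : bool) : {linear qW t -> qW t'} :=
  match t, t' with
  | true, true => idfun
  | true, false => b
  | false, false => idfun
  | false, true => \0
  end.

(* E F^(k+1) v = (qe k) F^k v when E v = 0 and H v = (i - 1) v. *)
Definition qe (k : nat) : K := k.+1%:R * (i%:R - 1 - k%:R).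

(** The summand [b (a v)] is the action of FE on the first copy of V1. There the Casimir element is
    i^2 + 4ba, and (ba)^2 = 0 because ab = 0. *)
Definition qba (k : nat) (v : V1) : V1 := b (a v) + qe k *: v.
Lemma qba_linear k : linear (qba k).
Proof. by move=> x u v; rewrite /qba !(linE a, linE b); lmod K V1; ring. Qed.
HB.instance Definition _ k := GRing.isLinear.Build K V1 V1 _ (qba k) (qba_linear k).

Definition qE (k : nat) (t' t : bool) : {linear qW t' -> qW t} :=
  match t', t with
  | true, true => scalmap (qe k)
  | false, true => a
  | false, false => qba k
  | true, false => \0
  end.

(** The tests k < i occur in the types of the spaces; replacing them by free booleans, with their
    mutual relations as hypotheses, allows case analysis. *)
Lemma q_EF0_bool (t0 t1 : bool) (x : qW t0) : (t1 -> t0) -> (~~ t0 -> i = 0%N) ->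
  (t0 -> ~~ t1 -> i = 1%N) -> qE 0 t1 t0 (qF t0 t1 x) = (i%:R - 1) *: x.
Proof.
case: t0 t1 x => [] [] x //= h1 h2 h3; try by have := h1 isT.
- by rewrite /scalmap /qe mul1r subr0.
- by rewrite ab0 (h3 isT isT) subrr scale0r.
- by rewrite /qba ba0 ?h2 // add0r /qe mul1r subr0 (h2 isT).
Qed.

Lemma q_EF0 (x : qW (0 < i)%N) :
  qE 0 (1 < i)%N (0 < i)%N (qF (0 < i)%N (1 < i)%N x) = (i%:Z%:~R - 1) *: x.
Proof. by apply: q_EF0_bool; lia. Qed.

Lemma q_EF_bool k (t0 t1 t2 : bool) (x : qW t1) : (t1 -> t0) -> (t2 -> t1) ->
  (t0 -> ~~ t1 -> k.+1 = i) -> (t1 -> ~~ t2 -> k.+2 = i) ->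
  qE k.+1 t2 t1 (qF t1 t2 x) = qF t0 t1 (qE k t1 t0 x) + (i%:R - 1 - 2 * k.+1%:R) *: x.
Proof.
case: t0 t1 t2 x => [] [] [] x //= h1 h2 h3 h4; try by [have := h1 isT|have := h2 isT].
- by rewrite /scalmap /qe -!natr1; lmod K V2; ring.
- rewrite ab0 /scalmap /qe -(h4 isT isT) -!natr1; lmod K V2; ring.
- rewrite /qba /qe -(h3 isT isT) -!natr1; lmod K V1; ring.
- by rewrite /qba /qe -!natr1; lmod K V1; ring.
Qed.

Lemma q_EF k (x : qW (k.+1 < i)%N) :
  qE k.+1 (k.+2 < i)%N (k.+1 < i)%N (qF (k.+1 < i)%N (k.+2 < i)%N x)
  = qF (k < i)%N (k.+1 < i)%N (qE k (k.+1 < i)%N (k < i)%N x)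
    + (i%:Z%:~R - 1 - 2 * k.+1%:R) *: x.
Proof. by apply: q_EF_bool; lia. Qed.

Definition qchain : chain K :=
  @Chain K i (fun k => qW (k < i)%N) (fun k => qF (k < i)%N (k.+1 < i)%N)
    (fun k => qE k (k.+1 < i)%N (k < i)%N) q_EF0 q_EF.

(** Here and in [in2], the zero map is a default for the value of [t] at which the space is the
    other one. *)
Definition in1 (t : bool) : {linear V1 -> qW t} := match t with true => \0 | false => idfun end.
Definition in2 (t : bool) : {linear V2 -> qW t} := match t with true => idfun | false => \0 end.

Variables (c : K) (c0 : c != 0).
Notation X := (chainU qchain c0).

Lemma qF_surj k : (i <= k)%N -> forall w, exists w', ch_F qchain k w' = w.
Proof.
move=> ik w; have h1 : (k < i)%N = false by rewrite ltnNge ik.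
have h2 : (k.+1 < i)%N = false by rewrite ltnNge (leq_trans ik).
rewrite /= in w *; move: w; rewrite h2 h1 => w; by exists w.
Qed.

Hypotheses (fin1 : fin_dim [set: V1]%classic) (fin2 : fin_dim [set: V2]%classic).

Lemma qX_O_xi : O_xi (xi_c c) X.
Proof.
apply: (X_O_xi c0 qF_surj) => k _ /=; by case: (k < i)%N.
Qed.

Lemma qF_in2 (t t' : bool) v : t -> t' -> qF t t' (in2 t v) = in2 t' v.
Proof. by case: t t' => [] []. Qed.
Lemma qF_in21 (t t' : bool) v : t -> ~~ t' -> qF t t' (in2 t v) = in1 t' (b v).
Proof. by case: t t' => [] []. Qed.
Lemma qE_in1 k (t' t : bool) v : ~~ t' -> t -> qE k t' t (in1 t' v) = in2 t (a v).
Proof. by case: t t' => [] []. Qed.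
Lemma qW_in (t : bool) (w : qW t) : (exists2 v, t & w = in2 t v) \/ (exists2 v, ~~ t & w = in1 t v).
Proof. by case: t w => w; [left|right]; exists w. Qed.

Lemma mono_in2 (k : nat) (v : V2) : (k < i)%N ->
  iter k (@oF K c X) (mono c0 0 (in2 (0 < i)%N v : ch_sp qchain 0))
  = mono c0 0 (in2 (k < i)%N v : ch_sp qchain k).
Proof.
elim: k => [//|k IH] ki; rewrite iterS IH ?(ltnW ki) // mono_F; congr (mono c0 0 _).
by apply: qF_in2 => //; exact: ltnW.
Qed.

Lemma mono_F_top (k : nat) (v : V2) : k.+1 = i ->
  iter k.+1 (@oF K c X) (mono c0 0 (in2 (0 < i)%N v : ch_sp qchain 0))
  = mono c0 0 (in1 (k.+1 < i)%N (b v) : ch_sp qchain k.+1).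
Proof.
move=> ik; rewrite iterS mono_in2 -?ik // mono_F; congr (mono c0 0 _).
by apply: qF_in21; rewrite -ik ?ltnn ?ltnSn.
Qed.

Lemma mono_E_top (k : nat) (w : V1) : k.+1 = i ->
  oE c (mono c0 0 (in1 (k.+1 < i)%N w : ch_sp qchain k.+1))
  = iter k (@oF K c X) (mono c0 0 (in2 (0 < i)%N (a w) : ch_sp qchain 0)).
Proof.
move=> ik; rewrite mono_in2 -?ik // mono_E; congr (mono c0 0 _).
by apply: qE_in1; rewrite -ik ?ltnn ?ltnSn.
Qed.

Section Theta.
Variables (M : lmodType (U K)) (j2 : {linear V2 -> vect M}) (j1 : {linear V1 -> vect M}).
Hypothesis zc : forall v : vect M, op sZ v = c *: v.
Hypothesis j2_gr : forall v, gr c M i (j2 v).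
Hypothesis j2_p : forall v, op sP (j2 v) = 0.
Hypothesis j2_E : forall v, oE c (j2 v) = 0.
Hypothesis j1_gr : forall v, gr c M (- i%:Z) (j1 v).
Hypothesis j1_p : forall v, op sP (j1 v) = 0.
Hypothesis j1_E0 : i = 0%N -> forall v, oE c (j1 v) = 0.
Hypothesis j1_E : forall k, k.+1 = i -> forall v, oE c (j1 v) = iter k (@oF K c M) (j2 (a v)).
Hypothesis j2_F : (0 < i)%N -> forall v, iter i (@oF K c M) (j2 v) = j1 (b v).

(** V2 is placed at the top by [j2] and V1 at index i by [j1]; F carries both down. The case [false]
    is meant for i <= k, where k - i is a true difference. *)
Definition place_fun (k : nat) (t : bool) : qW t -> vect M :=
  match t with
  | true => fun v => iter k (@oF K c M) (j2 v)
  | false => fun v => iter (k - i) (@oF K c M) (j1 v)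
  end.
Lemma place_linear k t : linear (@place_fun k t).
Proof. by case: t => x u v /=; rewrite !linearP oF_iterD oF_iterZ. Qed.
HB.instance Definition _ k t := GRing.isLinear.Build K (qW t) (vect M) _ (@place_fun k t) (@place_linear k t).
Definition place k t : {linear qW t -> vect M} := @place_fun k t.

Lemma place_p k t (w : qW t) : op sP (place k t w) = 0.
Proof. by case: t w => w /=; apply: oF_iter_p. Qed.

Lemma place_F k (t t' : bool) (w : qW t) : (t' -> t) -> (t -> ~~ t' -> k.+1 = i) ->
  (~~ t -> (i <= k)%N) -> oF c (place k t w) = place k.+1 t' (qF t t' w).
Proof.
case: t t' w => [] [] w /= h1 h2 h3 //; try by have := h1 isT.
- by rewrite -iterS (h2 isT isT) j2_F -?(h2 isT isT) // subnn.
- by rewrite subSn // h3.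
Qed.

Lemma place_H k (t : bool) (w : qW t) : (~~ t -> (i <= k)%N) ->
  oH c (place k t w) = (i%:Z%:~R - 1 - 2 * k%:R) *: place k t w.
Proof.
case: t w => w /= h; first by rewrite (oH_oF_iter c0 zc k (j2_gr w) (j2_p w)).
rewrite (oH_oF_iter c0 zc _ (j1_gr w) (j1_p w)); congr (_ *: _).
by rewrite natrB ?h // mulrNz -[i%:Z%:~R]/(i%:R : K); ring.
Qed.

Lemma place_E0 (t : bool) (w : qW t) : t = (0 < i)%N -> oE c (place 0 t w) = 0.
Proof. by case: t w => w /= h; [exact: j2_E|rewrite /= ?sub0n /= j1_E0 //; lia]. Qed.

Lemma place_E k (t t' : bool) (w : qW t') : (t' -> t) -> (t -> ~~ t' -> k.+1 = i) ->
  (~~ t -> (i <= k)%N) -> oE c (place k.+1 t' w) = place k t (qE k t' t w).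
Proof.
case: t t' w => [] [] w // h1 h2 h3; try by have := h1 isT.
- rewrite [place _ _ _]/(iter k.+1 _ _) (oE_oF_iter c0 zc k (j2_gr w) (j2_p w)) j2_E oF_iter0 add0r.
  by rewrite /= /scalmap (lmapZ j2) oF_iterZ.
- by rewrite /= -(h2 isT isT) subnn /= (j1_E (h2 isT isT)).
have ik := h3 isT.
rewrite [place k.+1 _ _]/(iter (k.+1 - i) _ _) subSn // (oE_oF_iter c0 zc _ (j1_gr w) (j1_p w)).
(* For i > 0, E (j1 w) is F^(i-1) of j2 (a w), and one more F turns this into j1 (b (a w)). *)
have key : iter (k - i).+1 (@oF K c M) (oE c (j1 w)) = iter (k - i) (@oF K c M) (j1 (b (a w))).
  have [i0|i0] := posnP i; first by rewrite j1_E0 // ba0 // linear0 !oF_iter0.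
  by rewrite (j1_E (prednK i0)) -iterD addSnnS prednK // iterD j2_F.
rewrite key; transitivity (iter (k - i) (@oF K c M) (j1 (b (a w) + qe k *: w))); last by [].
rewrite (lmapD j1) (lmapZ j1) oF_iterD oF_iterZ; congr (_ + _ *: _).
by rewrite /qe -!natr1 natrB // mulrNz -[i%:Z%:~R]/(i%:R : K); ring.
Qed.

Lemma theta_ex : exists g : {linear X -> M}, forall k (w : ch_sp qchain k),
  g (mono c0 0 w) = place k (k < i)%N w.
Proof.
apply: (@chain_lift K qchain c c0 M (fun k => place k (k < i)%N)) => //= [k w|w|k w|k w|k w].
- exact: place_p.
- exact: place_E0.
- by apply: place_E; lia.
- by apply: place_F; lia.
- by apply: place_H; lia.
Qed.

Variable g : {linear X -> M}.
Hypothesis g_mono : forall k (w : ch_sp qchain k), g (mono c0 0 w) = place k (k < i)%N w.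

Lemma theta_in2 v : (0 < i)%N -> g (mono c0 0 (in2 (0 < i)%N v : ch_sp qchain 0)) = j2 v.
Proof. by move=> i0; rewrite g_mono; case: (0 < i)%N i0. Qed.
Lemma theta_in1 v : g (mono c0 0 (in1 (i < i)%N v : ch_sp qchain i)) = j1 v.
Proof.
rewrite g_mono; have : ~~ (i < i)%N by rewrite ltnn.
by case: (i < i)%N => //= _; rewrite subnn.
Qed.

Hypothesis cX : casM c X i.

Lemma place_inj k (t : bool) (w : qW t) : (t -> k = 0%N /\ injective j2) ->
  (~~ t -> k = i) -> injective j1 -> place k t w = 0 -> w = 0.
Proof.
case: t w => w /= h2 h1 I1 h.
  have [k0 I2] := h2 isT; by rewrite k0 /= in h; apply: I2; rewrite h linear0.
by rewrite (h1 isT) subnn /= in h; apply: I1; rewrite h linear0.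
Qed.

(** A nonzero kernel contains a highest weight vector, of degree i or -i. It lies in ker p, so in
    the chain space of index 0 or i, where [g] is [j2] or [j1]. *)
Lemma theta_injective : ((0 < i)%N -> injective j2) -> injective j1 -> injective g.
Proof.
clear j1_E0 j1_E j2_F; move=> I2 I1 x y e; apply/eqP; rewrite -subr_eq0; apply/eqP/notP => xy.
have kxy : kernel_submod g (x - y) by rewrite /= linearB e subrr.
have [m [z [hz z0 gz]]] := sub_has_hw (@X_gradable K qchain c c0) (@X_nilp K qchain c c0) kxy xy.
have mi := hw_degree hz z0 (cX z).
have [gz' _ pz] := hz; have [k [w [mk zw]]] := X_ker gz' pz z0.
apply: z0; rewrite zw; suff -> : w = 0 by exact: (lmap0 (@mono K qchain c c0 0 k)).
have {}gz : place k (k < i)%N w = 0 by rewrite -g_mono -zw.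
rewrite /= in mk.
by apply: (place_inj _ _ I1 gz) => h; [split; [|apply: I2]|]; case: mi => ?; lia.
Qed.

Hypothesis gM : gradable c M.
Hypothesis nM : nilp M.
Hypothesis cM : casM c M i.

(** A nonzero cokernel contains a highest weight vector of degree i or -i. Since p is onto on the
    image of [g], it lifts to ker p of [M], which [j2] and [j1] cover in these degrees. *)
Lemma theta_surjective :
  (forall v : vect M, gr c M i v -> op sP v = 0 -> (0 < i)%N -> exists x, j2 x = v) ->
  (forall v : vect M, gr c M (- i%:Z) v -> op sP v = 0 -> exists x, j1 x = v) ->
  forall y, exists x, g x = y.
Proof.
move=> s2 s1 y; apply/notP => hy; pose N := image_submod g.
have y0 : quom_pi N y <> 0 by move/quom_pi_eq0.
have Tcl : True /\ forall (u : U K) (v w : quom N), True -> True -> True by [].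
have gQ := gradable_surj (@quom_pi_surj _ _ N) gM.
have nQ := nilp_surj (@quom_pi_surj _ _ N) nM.
have cQ := casM_surj (@quom_pi_surj _ _ N) cM.
have [m [z [hz z0 _]]] := sub_has_hw (S := Submod Tcl) gQ nQ I y0.
have mi := hw_degree hz z0 (cQ z); have [gz _ pz] := hz.
have pN u : N u -> exists2 y, N y & op sP y = u.
  move=> [x <-]; have [x' hx] := X_p_surj (x : vect X).
  by exists (g x'); [exists x'|rewrite -(map_op g) hx].
have [v [gv pv vz]] := quotient_lift gM pN gz pz.
apply: z0; rewrite -vz; apply/quom_pi_eq0.
have low : m = - i%:Z -> N v.
  by move=> em; rewrite em in gv; have [x <-] := s1 v gv pv; eexists; exact: theta_in1.
case: mi => em; last exact: low.
have [i0|i0] := posnP i; first by apply: low; rewrite em i0.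
by rewrite em in gv; have [x <-] := s2 v gv pv i0; eexists; exact: theta_in2.
Qed.
End Theta.

(** Only index i > 0 needs work: there (H + 1)^2 is i^2, so the Casimir element differs from i^2 by
    4FE, and E leads into a space already treated. Index 0 consists of highest weight vectors, and
    at any other index F is onto from the previous space. *)
Lemma qX_cas : casM c X i.
Proof.
have zc (v : vect X) := gradable_z v (@X_gradable K qchain c c0).
pose S := eig_submod c0 zc (i%:Z%:~R ^+ 2).
suff h : forall x, S x by move=> x; exact: h.
apply: (X_generated (S := S) qF_surj) => k + _; elim: k => [|k IH] w.
  exists 1%N; rewrite /= /shifted /=.
  have gw : gr c X i (mono c0 0 w) by apply: mono_gr => /=; lia.
  rewrite (casimir_hw gw) ?subrr //; last exact: mono_p.
  by rewrite -(oE_ker c (mono_p c0 w)) mono_E0.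
have [[t0 t1]|[ki|ki]] : ((k < i)%N /\ (k.+1 < i)%N) \/ (k.+1 = i \/ (i <= k)%N) by lia.
- have surj (t t' : bool) (u : qW t') : t -> t' -> exists w', qF t t' w' = u.
    by case: t t' u => [] [] // u _ _; exists u.
  by have [w' <-] := surj _ _ w t0 t1; rewrite -(mono_F c0); apply: sub_oF.
- have : S (oE c (mono c0 0 w)) by rewrite mono_E; exact: IH.
  move=> /(sub_oF c) /(subZ 4); rewrite -/S => h.
  apply: nilat_unshift; have <- : 4 *: oF c (oE c (mono c0 0 w))
      = shifted (@casimir K c X) (i%:Z%:~R ^+ 2) (mono c0 0 w); last exact: h.
  have eK : (i%:Z)%:~R = k%:R + 1 :> K by rewrite -ki natr1.
  rewrite /shifted /= /casimir !mono_H oHZ mono_H /= eK -natr1.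
  by lmod K (vect X); ring.
by have [w' <-] := qF_surj ki w; rewrite -(mono_F c0); apply: sub_oF.
Qed.

Lemma qX_block : O_block (xi_c c) (wt c i) X.
Proof. by apply/(O_blockP c0); split; [exact: qX_O_xi|exact: qX_cas]. Qed.
End QuiverChain.

(** * Primitive vectors in the i-th block *)

Section PrimitiveVectors.
Variables (K : numFieldType) (c : K) (c0 : c != 0).

Section Iterates.
Variable M : lmodType (U K).
Definition Fpow k (v : vect M) : vect M := iter k (@oF K c M) v.
Definition Epow k (v : vect M) : vect M := iter k (@oE K c M) v.
Lemma Fpow_linear k : linear (Fpow k).
Proof. by move=> a u v; rewrite /Fpow oF_iterD oF_iterZ. Qed.
HB.instance Definition _ k := GRing.isLinear.Build K (vect M) (vect M) _ (Fpow k) (Fpow_linear k).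
Lemma Epow_linear k : linear (Epow k).
Proof. by move=> a u v; rewrite /Epow; elim: k => //= k ->; rewrite oED oEZ. Qed.
HB.instance Definition _ k := GRing.isLinear.Build K (vect M) (vect M) _ (Epow k) (Epow_linear k).

(** Primitive means killed by p; in degree -i, E need not vanish, and its action there is what the
    arrow a records. *)
Definition prim (d : int) : submod (vect M) := cap_submod (gr c M d) (kernel_submod (@op K M sP)).
Lemma primP d v : prim d v <-> gr c M d v /\ op sP v = 0.
Proof. by []. Qed.
End Iterates.

Lemma map_Fpow (M N : lmodType (U K)) (f : {linear M -> N}) k (v : vect M) : f (Fpow k v) = Fpow k (f v : vect N).
Proof. by rewrite /Fpow; elim: k => //= k IH; rewrite map_oF IH. Qed.
Lemma map_Epow (M N : lmodType (U K)) (f : {linear M -> N}) k (v : vect M) : f (Epow k v) = Epow k (f v : vect N).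
Proof. by rewrite /Epow; elim: k => //= k IH; rewrite map_oE IH. Qed.
Lemma map_prim (M N : lmodType (U K)) (f : {linear M -> N}) d (v : vect M) : prim M d v -> prim N d (f v : vect N).
Proof.
move=> /primP[h1 h2]; apply/primP; split; first exact: map_gr.
by rewrite -(map_op f) h2 linear0.
Qed.

Section InBlock.
Variables (M : lmodType (U K)) (i : nat).
Hypotheses (gM : gradable c M) (nM : nilp M) (cM : casM c M i).
Let zc (v : vect M) : op sZ v = c *: v. Proof. exact: gradable_z. Qed.

Lemma Fpow_prim k d d' (v : vect M) : prim M d v -> d' = d - 2 * k%:Z -> prim M d' (Fpow k v).
Proof.
move=> /primP[h1 h2] e; apply/primP; split; first exact: oF_iter_gr h1 e.
exact: oF_iter_p.
Qed.
Lemma Epow_prim k d d' (v : vect M) : prim M d v -> d' = d + 2 * k%:Z -> prim M d' (Epow k v).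
Proof.
move=> /primP[h1 h2] e; apply/primP; split; first exact: oE_iter_gr h1 e.
exact: oE_iter_p.
Qed.

(** From a nonzero vector one climbs to a highest weight vector of at least the same degree, and
    that degree is i or -i. *)
Lemma top_zero d (v : vect M) : gr c M d v -> (i%:Z < d)%R -> v = 0.
Proof.
move=> gv id_; apply/notP => v0; have [D hD] := nM v.
have Tcl : True /\ forall (u : U K) (v w : M), True -> True -> True by [].
have [m [x [dm hx x0 _]]] := reach (S := Submod Tcl) gv v0 hD I.
by have [] := hw_degree hx x0 (cM x); lia.
Qed.

Lemma prim_top v : prim M i v -> oE c v = 0.
Proof. by move=> /primP[h1 _]; apply: (top_zero (gr_oE h1 erefl)); lia. Qed.

Lemma gr_top_p d (v : vect M) : gr c M d v -> (i%:Z <= d)%R -> op sP v = 0.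
Proof. by move=> h hd; apply: (top_zero (gr_op h erefl)) => /=; lia. Qed.

(** The eigenvalue of E^k F^k on primitive vectors of degree i. *)
Definition EF_scalar (k : nat) : K := \prod_(j < k) (j.+1%:R * (i%:R - 1 - j%:R)).

Lemma EFpow k v : prim M i v -> Epow k (Fpow k v) = EF_scalar k *: v.
Proof.
move=> hv; have [h1 h2] := hv; elim: k => [|k IH]; first by rewrite /EF_scalar big_ord0 scale1r.
rewrite /Epow iterSr /Fpow (oE_oF_iter c0 zc k h1 h2) (prim_top hv) oF_iter0 add0r.
rewrite [LHS](lmapZ (@Epow M k) _ (Fpow k v)) [X in _ *: X]IH.
by rewrite scalerA /EF_scalar big_ord_recr /= mulrC.
Qed.

Lemma EF_scalar_neq0 k : (k < i)%N -> EF_scalar k != 0.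
Proof.
move=> ki; apply/prodf_neq0 => -[j /= jk] _; rewrite mulf_neq0 ?pnatr_eq0 //.
have -> : i%:R - 1 - j%:R = (i - j.+1)%:R :> K by rewrite natrB ?(leq_trans jk (ltnW ki)) // -natr1; ring.
by rewrite pnatr_eq0 subn_eq0 -ltnNge (leq_ltn_trans jk ki).
Qed.

Lemma EF_scalar_top : (0 < i)%N -> EF_scalar i = 0.
Proof.
move=> i0; have [k ik] : exists k, i = k.+1 by exists i.-1; rewrite prednK.
by rewrite /EF_scalar ik big_ord_recr /= -(natr1 k) addrK subrr !mulr0.
Qed.

Lemma prim_EF_top v : prim M i v -> (0 < i)%N -> Epow i (Fpow i v) = 0.
Proof. by move=> hv i0; rewrite EFpow // EF_scalar_top // scale0r. Qed.

(* The difference of the two sides lies in degree 2 - i and is killed by E^k, while the only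
   highest weights available are i and - i. *)
Lemma prim_E_bottom k v : k.+1 = i -> prim M (- i%:Z) v ->
  oE c v = (EF_scalar k)^-1 *: Fpow k (Epow k.+1 v).
Proof.
move=> ki hv; have ki' : (k < i)%N by rewrite -ki.
have sk := EF_scalar_neq0 ki'.
have h1 : prim M (- i%:Z + 2) (oE c v) := Epow_prim (k := 1) hv erefl.
have h2 : prim M i (Epow k.+1 v) by apply: (Epow_prim hv); lia.
have h3 : prim M (- i%:Z + 2) (Fpow k (Epow k.+1 v)) by apply: (Fpow_prim h2); lia.
apply/eqP; rewrite -subr_eq0; apply/eqP/notP; set d := _ - _ => d0.
have hd : prim M (- i%:Z + 2) d.
  have -> : d = - (EF_scalar k)^-1 *: Fpow k (Epow k.+1 v) + oE c v by rewrite /d [LHS]addrC scaleNr.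
  exact: (sm_closed (prim M _)).2.
have Ed : Epow k d = 0.
  have e : Epow k (oE c v) = Epow k.+1 v by rewrite /Epow iterSr.
  rewrite /d (lmapD (@Epow M k)) (lmapN (@Epow M k)) (lmapZ (@Epow M k)).
  by rewrite [X in X - _]e [X in _ *: X](EFpow k h2) scalerA mulVf // scale1r subrr.
have [D hD] := nM d; have [gd pd] := hd.
have [j [hj j0]] := reach_oE c0 gM gd d0 pd hD.
have jk : (j < k)%N.
  rewrite ltnNge; apply/negP => kj; apply: j0.
  by rewrite -(subnK kj) iterD [iter k _ _]Ed; exact: (lmap0 (@Epow M _)).
by have [] := hw_degree hj j0 (cM _); lia.
Qed.
End InBlock.
End PrimitiveVectors.

(** * The equivalence with quiver representations *)

Lemma quiver_iso (K : fieldType) (V W : quiver_rep K) (h : quiver_hom V W) :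
  injective (qh_1 h) -> (forall y, exists x, qh_1 h x = y) ->
  injective (qh_2 h) -> (forall y, exists x, qh_2 h x = y) ->
  exists g : quiver_hom W V, quiver_comp g h = quiver_id V /\ quiver_comp h g = quiver_id W.
Proof.
move=> i1 s1 i2 s2; have [g1 [g1h hg1]] := linear_inverse i1 s1.
have [g2 [g2h hg2]] := linear_inverse i2 s2.
have ga v : g2 (qr_a W v) = qr_a V (g1 v) by rewrite -{1}[v]hg1 -qh_a g2h.
have gb v : g1 (qr_b W v) = qr_b V (g2 v) by rewrite -{1}[v]hg2 -qh_b g1h.
by exists (QuiverHom ga gb); split; apply: quiver_hom_eq.
Qed.

Section QuiverFunctor.
Variables (K : numFieldType) (c : K) (c0 : c != 0) (k : nat).
Notation i := k.+1.
Notation xi := (xi_c c).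
Notation block := (O_block xi (wt c k.+1)).

Section Objects.
Variables (M : lmodType (U K)) (hM : block M).

Lemma block_gradable : gradable c M.
Proof. by have [/O_xiP[]] := O_block_class c0 hM. Qed.
Lemma block_nilp : nilp M.
Proof. by have [/O_xiP[]] := O_block_class c0 hM. Qed.
Lemma block_cas : casM c M i.
Proof. by have [] := O_block_class c0 hM. Qed.
Lemma prim_fin d : fin_dim [set: subm (prim c M d)]%classic.
Proof.
apply/fin_dim_subm; have [_ _ /(_ d)/fin_dimP[s hs]] := O_block_class c0 hM.
by apply/fin_dimP; exists s => v [/hs].
Qed.
Let zc (v : vect M) : op sZ v = c *: v. Proof. exact: gradable_z block_gradable. Qed.

Lemma sm_in d (v : subm (prim c M d)) : prim c M d (sm_val v).
Proof. exact/sm_predP/sm_valP. Qed.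

Lemma qa_proof (v : subm (prim c M (- i%:Z))) : prim c M i (Epow c i (sm_val v)).
Proof. by apply: (Epow_prim (sm_in v)); lia. Qed.
Lemma qb_proof (v : subm (prim c M i)) : prim c M (- i%:Z) (Fpow c i (sm_val v)).
Proof. by apply: (Fpow_prim c0 block_gradable (sm_in v)); lia. Qed.

Definition qa : {linear subm (prim c M (- i%:Z)) -> subm (prim c M i)} :=
  @sub_corestr K (subm (prim c M (- i%:Z))) (vect M) (prim c M i)
    (@Epow K c M i \o sm_val (S := prim c M (- i%:Z))) qa_proof.
Definition qb : {linear subm (prim c M i) -> subm (prim c M (- i%:Z))} :=
  @sub_corestr K (subm (prim c M i)) (vect M) (prim c M (- i%:Z))
    (@Fpow K c M i \o sm_val (S := prim c M i)) qb_proof.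

Lemma qab v : qa (qb v) = 0.
Proof.
apply: val_inj; exact: (prim_EF_top c0 block_gradable block_nilp block_cas (sm_in v) isT).
Qed.

Definition phi_obj : quiver_rep K :=
  QuiverRep (prim_fin (- i%:Z)) (prim_fin i) qab.
End Objects.

Section Maps.
Variables (M N : lmodType (U K)) (hM : block M) (hN : block N) (f : {linear M -> N}).

Lemma prim_map_proof d (v : subm (prim c M d)) : prim c N d (f (sm_val v)).
Proof. apply: map_prim; exact: sm_in. Qed.
Definition prim_map d : {linear subm (prim c M d) -> subm (prim c N d)} :=
  @sub_corestr K (subm (prim c M d)) (vect N) (prim c N d)
    (vmap f \o sm_val (S := prim c M d)) (@prim_map_proof d).

Lemma phi_map_a v : prim_map i (qr_a (phi_obj hM) v) = qr_a (phi_obj hN) (prim_map (- i%:Z) v).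
Proof. by apply: val_inj; exact: map_Epow. Qed.
Lemma phi_map_b v : prim_map (- i%:Z) (qr_b (phi_obj hM) v) = qr_b (phi_obj hN) (prim_map i v).
Proof. by apply: val_inj; exact: map_Fpow. Qed.
Definition phi_map : quiver_hom (phi_obj hM) (phi_obj hN) :=
  @QuiverHom K (phi_obj hM) (phi_obj hN) (prim_map (- i%:Z)) (prim_map i) phi_map_a phi_map_b.
End Maps.

Definition phi_fobj (M : O_block_cat xi (wt c i)) : QuiverReps K := phi_obj (svalP M).
Definition phi_fmap (M N : O_block_cat xi (wt c i)) (f : hom M N) :
  hom (phi_fobj M) (phi_fobj N) := phi_map (svalP M) (svalP N) f.
Lemma phi_id M : phi_fmap (idc M) = idc (phi_fobj M).
Proof. by apply: quiver_hom_eq => v; apply: val_inj. Qed.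
Lemma phi_comp (M N T : O_block_cat xi (wt c i)) (f : hom N T) (g : hom M N) :
  phi_fmap (compc f g) = compc (phi_fmap f) (phi_fmap g).
Proof. by apply: quiver_hom_eq => v; apply: val_inj. Qed.
Definition Phi : functor (O_block_cat xi (wt c i)) (QuiverReps K) := Functor phi_id phi_comp.

Section Theta.
Variables (M : lmodType (U K)) (hM : block M).
Notation V2 := (subm (prim c M i)).
Notation V1 := (subm (prim c M (- i%:Z))).
Let s := EF_scalar K i k.
(** The chain module needs a map a with E v = F^(i-1) (a v) on primitive vectors of degree -i; by
    [prim_E_bottom] this is E^i divided by the scalar [s]. *)
Definition qa' : {linear V1 -> V2} := scalmap s^-1 \o qa M.
Lemma qab' v : qa' (qb hM v) = 0.
Proof. by rewrite /= qab /scalmap scaler0. Qed.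
Lemma qba0 : i = 0%N -> forall v, qb hM (qa' v) = 0. Proof. by []. Qed.
Definition XM := chainU (qchain qab' qba0) c0.

Lemma XM_block : block XM.
Proof. by apply: qX_block; exact: prim_fin. Qed.

(** A morphism of quiver representations meets all the conditions on a placement: those at top
    degree hold by [prim_top], and the one on E at degree -i is [prim_E_bottom] in the target. *)
Lemma theta_out (N : lmodType (U K)) (hN : block N)
    (f2 : {linear V2 -> subm (prim c N i)}) (f1 : {linear V1 -> subm (prim c N (- i%:Z))}) :
  (forall v, f2 (qa M v) = qa N (f1 v)) -> (forall v, f1 (qb hM v) = qb hN (f2 v)) ->
  exists g : {linear XM -> N}, forall k' (w : ch_sp (qchain qab' qba0) k'),
    g (mono c0 0 w) = place i c (sm_val (S := prim c N i) \o f2)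
      (sm_val (S := prim c N (- i%:Z)) \o f1) k' (k' < i)%N w.
Proof.
move=> fa fb; have gN := block_gradable hN; have zc (v : vect N) := gradable_z v gN.
have nN := block_nilp hN; have cN := block_cas hN.
have k1 v := sm_in (f1 v); have k2 v := sm_in (f2 v).
apply: theta_ex => //= [v|v|v|v|v|k' [->] v|_ v].
- by have [] := k2 v.
- by have [] := k2 v.
- exact: (prim_top c0 nN cN (k2 v)).
- by have [] := k1 v.
- by have [] := k1 v.
- rewrite (prim_E_bottom c0 gN nN cN erefl (k1 v)) /scalmap lmapZ /= -[RHS]/(Fpow c k _).
  rewrite -(lmapZ (@Fpow K c N k)); congr (Fpow c k (_ *: _)).
  by rewrite fa.
- by rewrite -[LHS]/(sm_val (qb hN (f2 v))) -fb.
Qed.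
End Theta.
End QuiverFunctor.

Lemma mono_inj (K : numFieldType) (C : chain K) (c : K) (c0 : c != 0) m k :
  injective (@mono K C c c0 m k).
Proof.
move=> x y /(congr1 (fun z : pol (chm C) => z m k)).
have E z : (mono c0 m z : pol (chm C)) m k = z.
  by rewrite /mono (_ : dinj (cinj z) m = cinj z); exact: dinj_in.
by rewrite !E.
Qed.

Lemma in1_inj (K : numFieldType) (V2 V1 : lmodType K) (t : bool) :
  ~~ t -> injective (in1 V2 V1 t).
Proof. by case: t => //= _ x y. Qed.

Section Place.
Variables (K : numFieldType) (c : K) (i : nat) (V2 V1 : lmodType K) (M : lmodType (U K)).

Lemma place_congr (j2 j2' : {linear V2 -> vect M}) (j1 j1' : {linear V1 -> vect M}) k t (w : qW V2 V1 t) : j2 =1 j2' -> j1 =1 j1' ->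
  place i c j2 j1 k t w = place i c j2' j1' k t w.
Proof. by case: t w => w /= e2 e1; rewrite ?e2 ?e1. Qed.

Lemma placeP (j2 : {linear V2 -> vect M}) (j1 : {linear V1 -> vect M}) k t (w : qW V2 V1 t) :
  (exists v, place i c j2 j1 k t w = Fpow c k (j2 v)) \/
  (exists v, place i c j2 j1 k t w = Fpow c (k - i) (j1 v)).
Proof. by case: t w => w; [left|right]; exists w. Qed.

Lemma place_in1 (j2 : {linear V2 -> vect M}) (j1 : {linear V1 -> vect M}) t v : ~~ t -> place i c j2 j1 i t (in1 V2 V1 t v) = j1 v.
Proof. by case: t => //= _; rewrite subnn. Qed.
End Place.

Section QuiverEquivalence.
Variables (K : numFieldType) (c : K) (c0 : c != 0) (k : nat).
Notation i := k.+1.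
Notation xi := (xi_c c).
Notation block := (O_block xi (wt c k.+1)).
Notation XM hM := (XM c0 hM).

Section Resolution.
Variables (M : lmodType (U K)) (hM : block M).

(** Every module of the block is the chain module on its own primitive vectors: this is the identity
    placement. *)
Lemma resolution : exists g : {linear XM hM -> M},
  [/\ injective g, forall y, exists x, g x = y &
    forall k' (w : ch_sp (qchain (qab' c0 hM) (qba0 c0 hM)) k'), g (mono c0 0 w)
      = place i c (sm_val (S := prim c M i)) (sm_val (S := prim c M (- i%:Z))) k' (k' < i)%N w].
Proof.
have [||g hg] := @theta_out K c c0 k M hM M hM idfun idfun; [by []|by []|].
have cX : casM c (XM hM) i := block_cas c0 (XM_block c0 hM).
exists g; split.
- by apply: (theta_injective hg cX) => [_|] x y; exact: val_inj.
- apply: (theta_surjective hg (block_gradable c0 hM) (block_nilp c0 hM) (block_cas c0 hM)).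
    move=> v g1 g2 _; have vp : v \in sm_pred (prim c M i) by apply/sm_predP.
    by exists (Subm vp).
  move=> v g1 g2; have vp : v \in sm_pred (prim c M (- i%:Z)) by apply/sm_predP.
  by exists (Subm vp).
- by move=> k' w; rewrite hg; apply: place_congr.
Qed.

Lemma block_ext (N : lmodType (U K)) (f g : {linear M -> N}) :
  (forall v, prim c M i v -> f v = g v) -> (forall v, prim c M (- i%:Z) v -> f v = g v) -> f = g.
Proof.
move=> h2 h1; have [t [_ ts tm]] := resolution.
have Scl : f (t 0) = g (t 0) /\ forall (a : U K) u v, f (t u) = g (t u) -> f (t v) = g (t v) ->
    f (t (a *: u + v)) = g (t (a *: u + v)).
  by split=> [|a u v hu hv]; rewrite ?linear0 // !linearP hu hv.
apply: linear_eq => y; have [x <-] := ts y.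
move: x; apply: (X_generated (S := Submod Scl) (B := i) (C := qchain (qab' c0 hM) (qba0 c0 hM))).
  exact: qF_surj.
move=> k' w _ /=; rewrite tm.
have [[v ->]|[v ->]] := @placeP K c i _ _ M (sm_val (S := prim c M i)) (sm_val (S := prim c M (- i%:Z))) k' (k' < i)%N w.
  by rewrite !map_Fpow h2 //; exact: sm_in.
by rewrite !map_Fpow h1 //; exact: sm_in.
Qed.

(** The morphism [h] defines a map out of the chain module, which is carried to [M] by inverting the
    resolution. *)
Lemma block_extend (N : lmodType (U K)) (hN : block N)
    (h : quiver_hom (phi_obj c0 hM) (phi_obj c0 hN)) :
  exists f : {linear M -> N}, phi_map c0 hM hN f = h.
Proof.
have [t [ti ts tm]] := resolution; have [t' [t't tt']] := linear_inverse ti ts.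
have [||g hg] := @theta_out K c c0 k M hM N hN (qh_2 h) (qh_1 h).
- by move=> v; exact: (qh_a h v).
- by move=> v; exact: (qh_b h v).
exists (g \o t'); apply: quiver_hom_eq => v; apply: val_inj.
  have ii : ~~ (i < i)%N by rewrite ltnn.
  have := tm i (in1 _ _ (i < i)%N v); have := hg i (in1 _ _ (i < i)%N v).
  rewrite !place_in1 // => gx tx.
  by rewrite -[LHS]/(g (t' (sm_val v))) -tx t't gx.
have := tm 0%N v; have := hg 0%N v; rewrite /= => gx tx.
by rewrite -[LHS]/(g (t' (sm_val v))) -tx t't gx.
Qed.
End Resolution.

Lemma phi_surj (Q : QuiverReps K) : exists (M : O_block_cat xi (wt c i)) (f : hom (Phi c0 k M) Q), is_iso f.
Proof.
case: Q => V1 V2 fin1 fin2 a b ab.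
pose s := EF_scalar K i k; have s0 : s != 0 by apply: EF_scalar_neq0.
(* In X, E^i maps v in V1 to E^k F^k (a' v) = s a' v, so this scaling makes the functor return the
   given [a]. *)
pose a' : {linear V1 -> V2} := scalmap s^-1 \o a.
have ab' v : a' (b v) = 0 by rewrite /= ab /scalmap scaler0.
have ba0 : i = 0%N -> forall v, b (a' v) = 0 by [].
pose X := chainU (qchain ab' ba0) c0.
have hX0 : block X by apply: qX_block.
pose M : O_block_cat xi (wt c i) := exist _ X hX0; exists M.
pose hX : block X := svalP M; have gX := block_gradable c0 hX.
pose f2 : {linear V2 -> vect X} :=
  (@mono K (qchain ab' ba0) c c0 0 0 : {linear ch_sp (qchain ab' ba0) 0 -> vect X}).
pose f1 : {linear V1 -> vect X} :=
  (@mono K (qchain ab' ba0) c c0 0 i : {linear ch_sp (qchain ab' ba0) i -> vect X}) \o in1 V2 V1 (i < i)%N.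
have h2p v : prim c X i (f2 v).
  by split; [apply: mono_gr => /=; lia|exact: mono_p].
have h1p v : prim c X (- i%:Z) (f1 v).
  by split; [apply: mono_gr => /=; lia|exact: mono_p].
pose h2 : {linear V2 -> subm (prim c X i)} := sub_corestr h2p.
pose h1 : {linear V1 -> subm (prim c X (- i%:Z))} := sub_corestr h1p.
have ha v : h2 (a v) = @qa K c c0 k X (h1 v).
  apply: val_inj; rewrite -[RHS]/(Epow c k.+1 (f1 v)) /Epow iterSr.
  rewrite [oE c _](mono_E_top ab' ba0 c0 v erefl).
  have := EFpow c0 gX (block_nilp c0 hX) (block_cas c0 hX) k (h2p (a' v)).
  rewrite /Epow /Fpow => ->; rewrite -/s -(lmapZ f2); congr (f2 _).
  by rewrite /= /scalmap scalerA mulfV // scale1r.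
have hb v : h1 (b v) = qb c0 hX (h2 v).
  apply: val_inj; rewrite -[RHS]/(iter k.+1 (@oF K c X) (f2 v)).
  by rewrite (mono_F_top ab' ba0 c0 v erefl).
have f2I : injective f2 by move=> x y; exact: mono_inj.
have f1I : injective f1.
  by move=> x y /mono_inj; apply: in1_inj; rewrite ltnn.
(* In degrees i and -i this leaves the chain indices 0 and i, that is, V2 and V1. *)
have surj d (v : subm (prim c X d)) : sm_val v <> 0 -> exists k' (w : ch_sp (qchain ab' ba0) k'),
    d = i%:Z - 2 * k'%:Z /\ sm_val v = mono c0 0 w.
  by move=> v0; have [g1 g2] := sm_in v; exact: X_ker g1 g2 v0.
have h2s y : exists x, h2 x = y.
  have [y0|y0] := pselect (sm_val y = 0).
    by exists 0; apply: val_inj; rewrite linear0; exact: esym y0.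
  have [[|k'] [w [dk yw]]] := surj _ _ y0; last by exfalso; move: dk; lia.
  by exists w; apply: val_inj; exact: esym yw.
have h1s y : exists x, h1 x = y.
  have [y0|y0] := pselect (sm_val y = 0).
    by exists 0; apply: val_inj; rewrite linear0; exact: esym y0.
  have [k' [w [dk yw]]] := surj _ _ y0.
  have ki : k' = i by move: dk; lia.
  rewrite {}ki in w dk yw *.
  have [x wx] : exists x, w = in1 V2 V1 (i < i)%N x.
    have := qW_in w; have : ~~ (i < i)%N by rewrite ltnn.
    by move=> /negP ii [[x /ii//]|[x _ ->]]; exists x.
  by exists x; apply: val_inj; apply: etrans (esym yw); rewrite wx.
pose h := @QuiverHom K (QuiverRep fin1 fin2 ab) (phi_obj c0 hX) h1 h2 ha hb.
have [g [gh hg]] := quiver_iso (h := h) (fun x y e => f1I x y (congr1 val e)) h1s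
  (fun x y e => f2I x y (congr1 val e)) h2s.
by exists g, h.
Qed.

Theorem Phi_equivalence : is_equivalence (Phi c0 k).
Proof.
apply: equivalence_of_full_faithful_surj; last exact: phi_surj.
- move=> M N h; have [f hf] := @block_extend _ (svalP M) _ (svalP N) h.
  by exists f; exact: hf.
move=> M N f g fg; apply: (block_ext (svalP M)) => v hv.
  have vp : v \in sm_pred (prim c _ i) by apply/sm_predP.
  by have := congr1 (fun h : quiver_hom (phi_obj c0 (svalP M)) (phi_obj c0 (svalP N)) => sm_val (qh_2 h (Subm vp))) fg.
have vp : v \in sm_pred (prim c _ (- i%:Z)) by apply/sm_predP.
by have := congr1 (fun h : quiver_hom (phi_obj c0 (svalP M)) (phi_obj c0 (svalP N)) => sm_val (qh_1 h (Subm vp))) fg.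
Qed.
End QuiverEquivalence.

(** * The block of lambda_0 *)

Section WeightFunctorEquivalence.
Variables (K : numFieldType) (c : K) (c0 : c != 0).
Notation xi := (xi_c c).
Notation block := (O_block xi (wt c 0%N)).

Lemma wt_space_fin (M : O_block_cat xi (wt c 0%N)) :
  fin_dim [set: (block_wt_functor xi (wt c 0%N) M : lmodType K)]%classic.
Proof. by apply/fin_dim_subm; have [_ _] := O_block_class c0 (svalP M); apply. Qed.

Section ZeroChain.
Variable V : lmodType K.
Let a0 : {linear V -> V} := \0.
Lemma zero_ab v : a0 (a0 v) = 0. Proof. by []. Qed.
(** For i = 0 the test k < i always fails, so every chain space is [V]; with a = b = 0 this models
    the Verma module of lambda_0 tensored with [V]. *)
Definition zchain := qchain zero_ab (i := 0) (fun _ => zero_ab).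
Definition zX := chainU zchain c0.

Lemma zX_block : fin_dim [set: V]%classic -> block zX.
Proof. by move=> fV; exact: qX_block. Qed.

(** Degree 0 is the top of this block, so p and E vanish on the whole weight space and every linear
    map into it is a placement. *)
Lemma zX_out (M : lmodType (U K)) (hM : block M) (j : {linear V -> subm (gr c M 0)}) :
  exists g : {linear zX -> M}, forall k (w : ch_sp zchain k),
    g (mono c0 0 w) = Fpow c k (sm_val (j w)).
Proof.
have [/O_xiP[_ gM nM] cM _] := O_block_class c0 hM; have zc (v : vect M) := gradable_z v gM.
have gj v : gr c M 0 (sm_val (j v)) by exact/sm_predP/sm_valP.
have pj v : op sP (sm_val (j v) : vect M) = 0 by exact: (gr_top_p c0 nM cM (gj v)).
have Ej v : oE c (sm_val (j v) : vect M) = 0.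
  by apply: (top_zero c0 nM cM (gr_oE (gj v) erefl)); lia.
have [|||||||||g hg] := @theta_ex K 0 V V a0 a0 zero_ab (fun _ => zero_ab) c c0 M
  (sm_val (S := gr c M 0) \o j) (sm_val (S := gr c M 0) \o j); try by [].
by exists g => k w; rewrite hg /= subn0.
Qed.
End ZeroChain.

Section Resolution.
Variables (M : lmodType (U K)) (hM : block M).
Notation V := (subm (gr c M 0)).

Lemma zero_resolution : exists g : {linear zX V -> M},
  [/\ injective g, forall y, exists x, g x = y &
    forall k (w : ch_sp (zchain V) k), g (mono c0 0 w) = Fpow c k (sm_val (w : V))].
Proof.
have [g hg] := zX_out hM (V := V) idfun.
have [/O_xiP[_ gM nM] cM fM] := O_block_class c0 hM.
have cX : casM c (zX V) 0%N.
  have [] := O_block_class c0 (zX_block (V := V) _) => //.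
  by apply/fin_dim_subm; exact: fM.
have hg' k (w : ch_sp (zchain V) k) : g (mono c0 0 w) =
    place 0 c (sm_val (S := gr c M 0)) (sm_val (S := gr c M 0)) k (k < 0)%N w.
  by rewrite hg /= subn0.
exists g; split=> //.
- by apply: (theta_injective hg' cX) => // x y; exact: val_inj.
- apply: (theta_surjective hg' gM nM cM) => // v g1 _.
  have vp : v \in sm_pred (gr c M 0) by apply/sm_predP.
  by exists (Subm vp).
Qed.

Lemma zero_ext (N : lmodType (U K)) (f g : {linear M -> N}) :
  (forall v, gr c M 0 v -> f v = g v) -> f = g.
Proof.
move=> h; have [t [_ ts tm]] := zero_resolution.
have Scl : f (t 0) = g (t 0) /\ forall (a : U K) u v, f (t u) = g (t u) -> f (t v) = g (t v) ->
    f (t (a *: u + v)) = g (t (a *: u + v)).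
  by split=> [|a u v hu hv]; rewrite ?linear0 // !linearP hu hv.
apply: linear_eq => y; have [x <-] := ts y.
move: x; apply: (X_generated (S := Submod Scl) (B := 0) (C := zchain V)).
  exact: qF_surj.
move=> k w _ /=; rewrite tm !map_Fpow h //; exact/sm_predP/sm_valP.
Qed.

Lemma zero_extend (N : lmodType (U K)) (hN : block N) (h : {linear V -> subm (gr c N 0)}) :
  exists f : {linear M -> N}, forall v : V, f (sm_val v) = sm_val (h v).
Proof.
have [t [ti ts tm]] := zero_resolution; have [t' [t't tt']] := linear_inverse ti ts.
have [g hg] := zX_out hN h.
exists (g \o t') => v; have := tm 0%N v; have := hg 0%N v; rewrite /= => gx tx.
by rewrite -[LHS]/(g (t' (sm_val v))) -[sm_val v]tx t't gx.
Qed.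
End Resolution.

Lemma wt_surj (V : FinVect K) :
  exists (M : O_block_cat xi (wt c 0%N)) (f : hom (corestrict wt_space_fin M : FinVect K) V), is_iso f.
Proof.
case: V => V fV; pose M : O_block_cat xi (wt c 0%N) := exist _ (zX V) (zX_block fV).
exists M; have [_ cM _] := O_block_class c0 (svalP M).
pose j : {linear V -> vect (zX V)} :=
  (@mono K (zchain V) c c0 0 0 : {linear ch_sp (zchain V) 0 -> vect (zX V)}).
have jg v : gr c (zX V) 0 (j v) by apply: mono_gr => /=; lia.
pose h : {linear V -> subm (gr c (zX V) 0)} := sub_corestr jg.
have hI : injective h by move=> x y /(congr1 val); exact: mono_inj.
have hS y : exists x, h x = y.
  have [y0|y0] := pselect (sm_val y = 0).
    by exists 0; apply: val_inj; rewrite linear0; exact: esym y0.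
  have gy : gr c (zX V) 0 (sm_val y) by exact/sm_predP/sm_valP.
  have py : op sP (sm_val y : vect (zX V)) = 0.
    by apply: (gr_top_p c0 _ cM gy) => //; exact: X_nilp.
  have [[|k] [w [dk yw]]] := X_ker gy py y0; last by exfalso; move: dk => /=; lia.
  by exists w; apply: val_inj; exact: esym yw.
have [g [gh hg]] := mod_iso hI hS.
by exists g, h; split.
Qed.

Theorem weight_functor_equivalence : is_equivalence (corestrict wt_space_fin :
  functor (O_block_cat xi (wt c 0%N)) (FinVect K)).
Proof.
apply: equivalence_of_full_faithful_surj; last exact: wt_surj.
- move=> M N h; have [f hf] := zero_extend (svalP M) (svalP N) h.
  by exists f; apply: linear_eq => v; apply: val_inj; exact: hf.
move=> M N f g fg; apply: (zero_ext (svalP M)) => v hv.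
have vp : v \in sm_pred (wt_space (wt c 0%N) (sval M)) by apply/sm_predP.
exact: (congr1 (fun h : {linear subm (wt_space (wt c 0%N) (sval M)) ->
   subm (wt_space (wt c 0%N) (sval N))} => sm_val (h (Subm vp))) fg).
Qed.
End WeightFunctorEquivalence.

(** * Coordinates on the coset and the assembled statement *)

Lemma coset_weights (K : numFieldType) (xi : set (weight K)) (lam : nat -> weight K) :
  is_coset xi -> (forall mu, xi mu -> mu.2 <> 0 :> K) ->
  (forall i : nat, xi (lam i) /\ (lam i).1 = - (3 / 2) + i%:R :> K) ->
  exists2 c : K, c != 0 & xi = xi_c c /\ lam = fun i : nat => wt c i.
Proof.
move=> [mu0 xiP] xi2 hlam; pose c : K := (lam 0%N).2; exists c.
  by apply/eqP/xi2; have [] := hlam 0%N.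
have hveeN n : hvee K *+ n = (n%:R, 0) :> weight K.
  elim: n => [|n IH]; first by rewrite !mulr0n.
  by rewrite mulrSr IH; exact: (congr2 pair (natr1 n) (addr0 (0 : K))).
have hveeE n : hvee K *~ n = (n%:~R, 0) :> weight K.
  case: n => n; first exact: hveeN.
  by rewrite NegzE !mulrNz -pmulrn hveeN; exact: (congr2 pair (erefl _) (oppr0 K)).
have shift mu nu : xi mu -> (xi nu <-> exists n : int, nu = (mu.1 + n%:~R, mu.2)).
  move=> /xiP[m ->]; split=> [/xiP[n ->]|[n ->]]; last apply/xiP.
    exists (n - m); rewrite !hveeE; congr pair => /=.
    by rewrite rmorphB /= addrACA [in RHS]addrC; ring.
  by exists (m + n); rewrite !hveeE; congr pair => /=; rewrite rmorphD /=; ring.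
have [xi0 lam0] := hlam 0%N.
have lamE : lam = fun i : nat => wt c i.
  apply: funext => i; have [/(shift _ _ xi0)[n en] li] := hlam i.
  rewrite [lam i]surjective_pairing li /wt; congr pair.
    by rewrite -[i%:Z%:~R]/(i%:R); exact: addrC.
  by rewrite en.
split=> //; apply/predeqP => mu; rewrite (shift _ _ xi0) lam0 addr0.
by split=> -[n ->]; exists n; rewrite /wt addrC.
Qed.

Theorem proposition4 (R : realType)
    (xi : set (weight R[i])) (lam : nat -> weight R[i]) :
  is_coset xi ->
  (forall mu, xi mu -> mu.2 <> 0 :> R[i]) ->
  (forall mu, xi mu -> exists n : int, mu.1 = n%:~R + 1 / 2 :> R[i]) ->
  (forall i : nat, xi (lam i) /\ (lam i).1 = - (3 / 2) + i%:R :> R[i]) ->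
  [/\ forall mu, xi mu ->
        (simple (verma mu) <-> (mu.1 : R[i]) <= - (3 / 2)),
      forall i : nat, (1 <= i)%N ->
        exists (f : {linear verma (dot_refl (lam i)) -> verma (lam i)})
               (g : {linear verma (lam i) -> simple_hw (lam i)}),
          short_exact f g /\ ~ split_epi g,
      exists sum_in : forall M : blocks_cat xi lam, O_xi xi (blocks_sum xi lam M),
        is_equivalence (corestrict sum_in : functor (blocks_cat xi lam) (O_xi_cat xi)),
      exists wt_fin : forall N : O_block_cat xi (lam 0%N),
          fin_dim [set: (block_wt_functor xi (lam 0%N) N : lmodType R[i])]%classic,
        is_equivalence (corestrict wt_fin :
          functor (O_block_cat xi (lam 0%N)) (FinVect R[i])) &
      forall i : nat, (1 <= i)%N ->
        equivalent (O_block_cat xi (lam i)) (QuiverReps R[i])].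
Proof.
move=> xi_coset xi2 _ hlam.
have [c c0 [-> ->]] := coset_weights xi_coset xi2 hlam; split.
- move=> _ [n ->]; have -> : ((wt c n).1 <= - (3 / 2) :> R[i]) = (n <= 0)%R.
    by rewrite [(wt c n).1]addrC gerDl -[0 : R[i]]/(0%:~R) ler_int.
  split=> [|n0]; last exact: verma_simple.
  case: n => [[|i]|i] // s; have [f fv] := verma_emb_ex c0 i.+1.
  by case: (@verma_not_simple _ c c0 i.+1 isT f fv s).
- move=> i i0; have [f fv] := verma_emb_ex c0 i; have [g hg] := verma_exact c0 i0 fv.
  by rewrite dot_refl_wt; exists f, g.
- by exists (blocks_sum_O_xi c0); exact: block_decomposition.
- by exists (wt_space_fin c0); exact: weight_functor_equivalence.
- by move=> [//|k] _; exists (Phi c0 k); exact: Phi_equivalence.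
Qed.
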